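(* Consider a discrete memoryless MARC or MABRC with channel law $p(y,y_3|x_1,x_2,x_3)$, correlated sources $(S_1,S_2)$, relay side information $W_3$ and receiver side information $W$ with joint law $p(s_1,s_2,w_3,w)$. A source-channel rate $\kappa>0$ is achievable (for the MARC, and also for the MABRC) if $$\begin{aligned} H(S_1|S_2,W_3) &< \kappa I(X_1;Y_3|V_1,X_2,X_3),\\ H(S_2|S_1,W_3) &< \kappa I(X_2;Y_3|V_2,X_1,X_3),\\ H(S_1,S_2|W_3) &< \kappa I(X_1,X_2;Y_3|V_1,V_2,X_3),\\ H(S_1|S_2,W) &< \kappa I(X_1,X_3;Y|V_2,X_2),\\ H(S_2|S_1,W) &< \kappa I(X_2,X_3;Y|V_1,X_1),\\ H(S_1,S_2|W) &< \kappa I(X_1,X_2,X_3;Y), \end{aligned}$$ for some joint distribution $p(s_1,s_2,w_3,w,v_1,v_2,x_1,x_2,x_3)$ (with auxiliary random variables $V_1,V_2$ on finite alphabets, and $(Y,Y_3)$ generated from $(X_1,X_2,X_3)$ through the channel law) that factorizes as $$p(s_1,s_2,w_3,w)\,p(v_1)\,p(x_1|v_1)\,p(v_2)\,p(x_2|v_2)\,p(x_3|v_1,v_2).$$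
   Context: Sources and side information. $\{(S_{1,k},S_{2,k},W_k,W_{3,k})\}_{k\ge 1}$ are i.i.d. across $k$ with joint law $p(s_1,s_2,w,w_3)$ on a finite alphabet $\mathcal S_1\times\mathcal S_2\times\mathcal W\times\mathcal W_3$, known to all nodes. Transmitter $i$ ($i=1,2$) observes $S_i^m$, the relay observes side information $W_3^m$, the receiver (destination) observes side information $W^m$. Channel. The discrete memoryless multiple-access relay channel (MARC) has finite input alphabets $\mathcal X_1,\mathcal X_2,\mathcal X_3$ (transmitter 1, transmitter 2, relay), finite output alphabets $\mathcal Y$ (receiver), $\mathcal Y_3$ (relay), and is memoryless: for each $k=1,\dots,n$, the conditional law of $(Y_k,Y_{3,k})$ given all sources, side informations, inputs up to time $k$ and outputs up to time $k-1$ equals $p(y_k,y_{3,k}|x_{1,k},x_{2,k},x_{3,k})$. Codes. An $(m,n)$ source-channel code for the multiple-access broadcast relay channel (MABRC) consists of encoders $f_i^{(m,n)}:\mathcal S_i^m\to\mathcal X_i^n$, $i=1,2$; causal relay encoders with $x_{3,k}=f_{3,k}^{(m,n)}(y_{3,1}^{k-1},w_3^m)$, $1\le k\le n$; a receiver decoder $g^{(m,n)}:\mathcal Y^n\times\mathcal W^m\to\mathcal S_1^m\times\mathcal S_2^m$ with output $(\hat S_1^m,\hat S_2^m)$; and a relay decoder $g_3^{(m,n)}:\mathcal Y_3^n\times\mathcal W_3^m\to\mathcal S_1^m\times\mathcal S_2^m$ with output $(\tilde S_1^m,\tilde S_2^m)$. A code for the MARC is the same without the relay decoder $g_3^{(m,n)}$.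 Error probability. MABRC: $P_e^{(m,n)}=\Pr\big\{\{(\hat S_1^m,\hat S_2^m)\ne(S_1^m,S_2^m)\}\cup\{(\tilde S_1^m,\tilde S_2^m)\neq(S_1^m,S_2^m)\}\big\}$. MARC: $P_e^{(m,n)}=\Pr\{(\hat S_1^m,\hat S_2^m)\ne(S_1^m,S_2^m)\}$. Achievability. A source-channel rate $\kappa$ is achievable if for every $\epsilon>0$ there is $m_0$ such that for all $m>m_0$, with $n=\lfloor\kappa m\rfloor$, there exists an $(m,n)$ code with $P_e^{(m,n)}<\epsilon$. *)

(* Defs.v *)
From mathcomp Require Import all_boot all_order all_algebra.
From mathcomp Require Import reals exp.

Set Implicit Arguments.
Unset Strict Implicit.
Unset Printing Implicit Defensive.

Import Order.TTheory GRing.Theory Num.Theory.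
Local Open Scope ring_scope.

Definition is_pmf (R : realType) (T : finType) (p : T -> R) : Prop :=
  (forall x, 0 <= p x) /\ \sum_(x : T) p x = 1.

Definition prob (R : realType) (Om : finType) (P : Om -> R) (E : pred Om) : R :=
  \sum_(o | E o) P o.

Notation "[% X , Y ]" := (fun o => (X o, Y o)).
Notation "[% X , Y , Z ]" := (fun o => (X o, Y o, Z o)).

(* The definitions below rely on ln 0 = 0 and x / 0 = 0.  These values only
   ever occur in summands whose weight is a null probability, so the usual
   conventions (0 log 0 = 0, null conditioning events are ignored) hold. *)

Definition log2 (R : realType) (x : R) : R := ln x / ln 2.

Definition pr_eq (R : realType) (Om A : finType) (P : Om -> R)
    (X : Om -> A) (x : A) : R :=
  prob P [pred o | X o == x].

Definition cond_pr (R : realType) (Om A B : finType) (P : Om -> R)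
    (X : Om -> A) (Y : Om -> B) (x : A) (y : B) : R :=
  pr_eq P [% X, Y] (x, y) / pr_eq P Y y.

Definition cond_entropy (R : realType) (Om A B : finType) (P : Om -> R)
    (X : Om -> A) (Y : Om -> B) : R :=
  - \sum_(x : A) \sum_(y : B)
      pr_eq P [% X, Y] (x, y) * log2 (cond_pr P X Y x y).

Definition mutual_info (R : realType) (Om A B : finType) (P : Om -> R)
    (X : Om -> A) (Y : Om -> B) : R :=
  \sum_(x : A) \sum_(y : B)
    pr_eq P [% X, Y] (x, y) *
    log2 (pr_eq P [% X, Y] (x, y) / (pr_eq P X x * pr_eq P Y y)).

Definition cond_mutual_info (R : realType) (Om A B C : finType) (P : Om -> R)
    (X : Om -> A) (Y : Om -> B) (Z : Om -> C) : R :=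
  \sum_(x : A) \sum_(y : B) \sum_(z : C)
    pr_eq P [% X, Y, Z] (x, y, z) *
    log2 (cond_pr P [% X, Y] Z (x, y) z /
          (cond_pr P X Z x z * cond_pr P Y Z y z)).

Section RelayChannel.
Variables (R : realType) (S1 S2 W3 W X1 X2 X3 Y Y3 : finType).
Variables (src : S1 * S2 * W3 * W -> R) (ch : X1 -> X2 -> X3 -> Y * Y3 -> R).

(* The k-th relay input (k counted from 0) is a function of the k channel
   outputs received so far and of the whole side information. *)
Record marc_code (m n : nat) := MarcCode {
  enc1 : {ffun 'I_m -> S1} -> {ffun 'I_n -> X1};
  enc2 : {ffun 'I_m -> S2} -> {ffun 'I_n -> X2};
  enc3 : forall k : 'I_n, {ffun 'I_k -> Y3} -> {ffun 'I_m -> W3} -> X3;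
  dec : {ffun 'I_n -> Y} -> {ffun 'I_m -> W} ->
        {ffun 'I_m -> S1} * {ffun 'I_m -> S2}
}.

Record mabrc_code (m n : nat) := MabrcCode {
  marc_of :> marc_code m n;
  dec3 : {ffun 'I_n -> Y3} -> {ffun 'I_m -> W3} ->
         {ffun 'I_m -> S1} * {ffun 'I_m -> S2}
}.

Definition past (n : nat) (T : Type) (y : {ffun 'I_n -> T}) (k : 'I_n) :
    {ffun 'I_k -> T} :=
  [ffun j : 'I_k => y (widen_ord (ltnW (ltn_ord k)) j)].

Definition run (m n : nat) : finType :=
  ({ffun 'I_m -> S1} * {ffun 'I_m -> S2} * {ffun 'I_m -> W3} *
   {ffun 'I_m -> W} * {ffun 'I_n -> Y} * {ffun 'I_n -> Y3})%type.

(* Joint law of (S1^m, S2^m, W3^m, W^m, Y^n, Y3^n) under a code: i.i.d. sources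
   and, by the chain rule over k, the memoryless channel fed with the inputs
   determined by the encoders. *)
Definition run_law (m n : nat) (c : marc_code m n) (o : run m n) : R :=
  let: (s1, s2, w3, w, y, y3) := o in
  (\prod_(i < m) src (s1 i, s2 i, w3 i, w i)) *
  (\prod_(k < n) ch (enc1 c s1 k) (enc2 c s2 k)
                    (enc3 c (past y3 k) w3) (y k, y3 k)).

Definition dest_error (m n : nat) (c : marc_code m n) : pred (run m n) :=
  fun o => let: (s1, s2, w3, w, y, y3) := o in dec c y w != (s1, s2).

Definition relay_error (m n : nat) (c : mabrc_code m n) : pred (run m n) :=
  fun o => let: (s1, s2, w3, w, y, y3) := o in dec3 c y3 w3 != (s1, s2).

Definition marc_Pe (m n : nat) (c : marc_code m n) : R :=
  prob (run_law c) (dest_error c).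

Definition mabrc_Pe (m n : nat) (c : mabrc_code m n) : R :=
  prob (run_law c) [predU dest_error c & relay_error c].

(* Num.truncn is the floor on nonnegative reals, and is 0 on negative ones. *)
Definition marc_achievable (kappa : R) : Prop :=
  forall eps : R, 0 < eps -> exists m0 : nat, forall m : nat, (m0 < m)%N ->
    exists c : marc_code m (Num.truncn (kappa * m%:R)), marc_Pe c < eps.

Definition mabrc_achievable (kappa : R) : Prop :=
  forall eps : R, 0 < eps -> exists m0 : nat, forall m : nat, (m0 < m)%N ->
    exists c : mabrc_code m (Num.truncn (kappa * m%:R)), mabrc_Pe c < eps.

Variables (V1 V2 : finType).

Definition aux_space : finType :=
  (S1 * S2 * W3 * W * V1 * V2 * X1 * X2 * X3)%type.

(* The conditional laws are total: their values at null conditioning letters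
   are arbitrary pmfs and do not affect q. *)
Definition factorizes (q : aux_space -> R) : Prop :=
  exists (pV1 : V1 -> R) (pX1 : V1 -> X1 -> R)
         (pV2 : V2 -> R) (pX2 : V2 -> X2 -> R) (pX3 : V1 -> V2 -> X3 -> R),
    [/\ is_pmf pV1 /\ (forall v1, is_pmf (pX1 v1)),
        is_pmf pV2 /\ (forall v2, is_pmf (pX2 v2)),
        forall v1 v2, is_pmf (pX3 v1 v2)
      & forall s1 s2 w3 w v1 v2 x1 x2 x3,
          q (s1, s2, w3, w, v1, v2, x1, x2, x3) =
            src (s1, s2, w3, w) * pV1 v1 * pX1 v1 x1 * pV2 v2 * pX2 v2 x2 *
            pX3 v1 v2 x3].

Definition joint_space : finType := (aux_space * Y * Y3)%type.

Definition joint_law (q : aux_space -> R) (o : joint_space) : R :=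
  let: (a, y, y3) := o in
  let: (s1, s2, w3, w, v1, v2, x1, x2, x3) := a in q a * ch x1 x2 x3 (y, y3).

Definition rS1 (o : joint_space) : S1 :=
  let: (s1, s2, w3, w, v1, v2, x1, x2, x3, y, y3) := o in s1.
Definition rS2 (o : joint_space) : S2 :=
  let: (s1, s2, w3, w, v1, v2, x1, x2, x3, y, y3) := o in s2.
Definition rW3 (o : joint_space) : W3 :=
  let: (s1, s2, w3, w, v1, v2, x1, x2, x3, y, y3) := o in w3.
Definition rW (o : joint_space) : W :=
  let: (s1, s2, w3, w, v1, v2, x1, x2, x3, y, y3) := o in w.
Definition rV1 (o : joint_space) : V1 :=
  let: (s1, s2, w3, w, v1, v2, x1, x2, x3, y, y3) := o in v1.
Definition rV2 (o : joint_space) : V2 :=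
  let: (s1, s2, w3, w, v1, v2, x1, x2, x3, y, y3) := o in v2.
Definition rX1 (o : joint_space) : X1 :=
  let: (s1, s2, w3, w, v1, v2, x1, x2, x3, y, y3) := o in x1.
Definition rX2 (o : joint_space) : X2 :=
  let: (s1, s2, w3, w, v1, v2, x1, x2, x3, y, y3) := o in x2.
Definition rX3 (o : joint_space) : X3 :=
  let: (s1, s2, w3, w, v1, v2, x1, x2, x3, y, y3) := o in x3.
Definition rY (o : joint_space) : Y :=
  let: (s1, s2, w3, w, v1, v2, x1, x2, x3, y, y3) := o in y.
Definition rY3 (o : joint_space) : Y3 :=
  let: (s1, s2, w3, w, v1, v2, x1, x2, x3, y, y3) := o in y3.

Definition relay_conditions (kappa : R) (P : joint_space -> R) : Prop :=
  [/\ cond_entropy P rS1 [% rS2, rW3]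
        < kappa * cond_mutual_info P rX1 rY3 [% rV1, rX2, rX3],
      cond_entropy P rS2 [% rS1, rW3]
        < kappa * cond_mutual_info P rX2 rY3 [% rV2, rX1, rX3]
    & cond_entropy P [% rS1, rS2] rW3
        < kappa * cond_mutual_info P [% rX1, rX2] rY3 [% rV1, rV2, rX3]].

Definition dest_conditions (kappa : R) (P : joint_space -> R) : Prop :=
  [/\ cond_entropy P rS1 [% rS2, rW]
        < kappa * cond_mutual_info P [% rX1, rX3] rY [% rV2, rX2],
      cond_entropy P rS2 [% rS1, rW]
        < kappa * cond_mutual_info P [% rX2, rX3] rY [% rV1, rX1]
    & cond_entropy P [% rS1, rS2] rW
        < kappa * mutual_info P [% rX1, rX2, rX3] rY].

End RelayChannel.

(* Main.v *)
Require Import Defs.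
From mathcomp Require Import all_boot all_order all_algebra.
From mathcomp Require Import reals sequences exp.
From mathcomp Require Import ring lra zify.
Import Order.TTheory GRing.Theory Num.Theory.
Local Open Scope ring_scope.
Set Implicit Arguments.
Unset Strict Implicit.
Unset Printing Implicit Defensive.

(** Block-Markov decode-and-forward with a joint source-channel random code.
    Source letters are split into B blocks and channel uses into B + 1 blocks.
    In block b transmitter i sends x_i, drawn from p(x_i|v_i) and selected by its
    current and previous source blocks, on top of a cloud centre v_i selected by
    its previous block; the relay, which knows the previous pair of source
    blocks, sends x_3 drawn from p(x_3|v_1,v_2).  The relay decodes the current
    block forwards, the destination decodes the previous block backwards.

    Both decoders solve the same one-shot multiple-access problem: two messages,
    codewords u_1(m_1), u_2(m_2), and a codeword u_3(m_1,m_2) drawn given the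
    other two.  A candidate is accepted when, for each of the three ways of
    being wrong, (posterior of the wrong part) * (channel likelihood) exceeds
    g * (output law when the wrong part is resampled).  A wrong candidate
    passes with expected probability at most (its posterior) / g, so the false
    alarms add up to at most 3 / g without any counting of typical sequences;
    the true one fails with exponentially small probability, by a Chernoff
    bound, for an exponentially large g, exactly under the six rate conditions.

    As long as no block fails the relay inputs agree with those of a
    genie-aided relay, for which each block can be analysed separately. *)

(** * Finite expectations and product laws *)

(** The six mutual informations record what a wrong candidate changes. The relay knows the previous
    block, hence [v_1], [v_2] and [x_3], so a wrong current message redraws only a satellite [x_i].
    The destination already knows the current block, thanks to the backward order, and looks for the
    previous one: a wrong [m_1] redraws the centre [v_1], its satellite and [x_3], so [X_3] joins
    the information term and only [V_2], [X_2] stay in the condition. Spreading B source blocks over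
    B + 1 channel blocks loads each channel use slightly beyond its share. One constant c > 0, cut
    out of the slack in the strict inequalities, is at once the tolerated excess rate, the exponent
    of g and the error exponent; B then depends on c and kappa only, and a union bound over blocks
    suffices. Each block has its own codebook, derandomised on its own for the sum of the errors of
    both decoders. The obstacle is causality: relay inputs depend on earlier outputs through the
    relay's estimates, so the outputs are not independent given the sources; this is the dependence
    that the genie removes. *)

Definition Ex (R : realType) (T : finType) (p f : T -> R) : R :=
  \sum_x p x * f x.

Notation "\E_ ( x ~ p ) f" := (Ex p (fun x => f))
  (at level 10, f at level 41, x, p at level 50,
   format "'[' \E_ ( x  ~  p ) '/  '  f ']'") : ring_scope.

Section Expectation.
Variable R : realType.
Implicit Types (T K : finType).

Lemma eq_ler (x y : R) : x = y -> x <= y.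
Proof. by move=> ->. Qed.

Lemma eq_Ex T (p f g : T -> R) : f =1 g -> Ex p f = Ex p g.
Proof. by move=> fg; apply: eq_bigr => x _; rewrite fg. Qed.

Lemma eq_Exl T (p q f : T -> R) : p =1 q -> Ex p f = Ex q f.
Proof. by move=> pq; apply: eq_bigr => x _; rewrite pq. Qed.

Lemma ExD T (p f g : T -> R) : \E_(x ~ p) (f x + g x) = Ex p f + Ex p g.
Proof. by rewrite -big_split; apply: eq_bigr => x _; rewrite mulrDr. Qed.

Lemma ExZl T (p f : T -> R) c : \E_(x ~ p) (c * f x) = c * Ex p f.
Proof. by rewrite big_distrr; apply: eq_bigr => x _; rewrite mulrCA. Qed.

Lemma ExZr T (p f : T -> R) c : \E_(x ~ p) (f x * c) = Ex p f * c.
Proof. by rewrite mulrC -ExZl; apply: eq_Ex => x; rewrite mulrC. Qed.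

Lemma ExN T (p f : T -> R) : \E_(x ~ p) (- f x) = - Ex p f.
Proof. by rewrite -mulN1r -ExZl; apply: eq_Ex => x; rewrite mulN1r. Qed.

Lemma Ex_sum T (I : finType) (P : pred I) (p : T -> R) (f : I -> T -> R) :
  \E_(x ~ p) (\sum_(i | P i) f i x) = \sum_(i | P i) Ex p (f i).
Proof. by rewrite exchange_big; apply: eq_bigr => x _; rewrite big_distrr. Qed.

Lemma Ex_swap T T' (p : T -> R) (q : T' -> R) (f : T -> T' -> R) :
  \E_(x ~ p) \E_(y ~ q) f x y = \E_(y ~ q) \E_(x ~ p) f x y.
Proof.
rewrite /Ex; under eq_bigr => x _ do rewrite big_distrr /=.
rewrite exchange_big /=; apply: eq_bigr => y _; rewrite big_distrr /=.
by apply: eq_bigr => x _; rewrite mulrCA.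
Qed.

Lemma ler_Ex_supp T (p f g : T -> R) : (forall x, 0 <= p x) ->
  (forall x, 0 < p x -> f x <= g x) -> Ex p f <= Ex p g.
Proof.
move=> p0 fg; apply: ler_sum => x _; have := p0 x.
by rewrite le0r => /orP[/eqP->|px]; rewrite ?mul0r ?ler_pM2l ?fg.
Qed.

Lemma ler_Ex T (p f g : T -> R) : (forall x, 0 <= p x) ->
  (forall x, f x <= g x) -> Ex p f <= Ex p g.
Proof. by move=> p0 fg; apply: ler_Ex_supp. Qed.

Lemma Ex_ge0 T (p f : T -> R) : (forall x, 0 <= p x) ->
  (forall x, 0 <= f x) -> 0 <= Ex p f.
Proof. by move=> p0 f0; apply: sumr_ge0 => x _; apply: mulr_ge0. Qed.

Lemma Ex_cst T (p : T -> R) c : is_pmf p -> \E_(x ~ p) c = c.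
Proof. by case=> _ p1; rewrite /Ex -big_distrl /= p1 mul1r. Qed.

(** This turns a random codebook into a fixed one. If every value exceeded [c], the mean would too,
    since equality of the means would force [p] to vanish everywhere. *)
Lemma Ex_le_exists T (p f : T -> R) c : is_pmf p -> Ex p f <= c ->
  exists x, f x <= c.
Proof.
move=> pp Efc; case: (pickP (fun x => f x <= c)) => [x fx|fc]; first by exists x.
have [p0 p1] := pp; suff: Ex p (fun=> c) < Ex p f.
  by rewrite Ex_cst // => /lt_le_trans/(_ Efc); rewrite ltxx.
have cf x : c < f x by rewrite ltNge fc.
rewrite lt_neqAle ler_Ex //; last by move=> x; apply: ltW.
rewrite andbT; apply/eqP => E.
suff p00 x : p x = 0 by move: p1; rewrite big1 // => /eqP; rewrite eq_sym oner_eq0.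
have /eqP : Ex p (fun x => f x - c) = 0 by rewrite ExD ExN E subrr.
rewrite psumr_eq0 => [/allP /(_ x (mem_index_enum _))|y _] /=.
  by rewrite mulf_eq0 subr_eq0 [f x == c]gt_eqF ?cf // orbF => /eqP.
by rewrite mulr_ge0 // subr_ge0 ltW.
Qed.

Lemma Ex_delta T (p f : T -> R) a : \E_(x ~ p) ((x == a)%:R * f x) = p a * f a.
Proof.
rewrite /Ex (bigD1 a) //= eqxx mul1r big1 ?addr0 // => x /negPf->.
by rewrite mul0r mulr0.
Qed.

Lemma Ex_indic T (p : T -> R) a : \E_(x ~ p) (x == a)%:R = p a.
Proof.
by rewrite -[RHS]mulr1 -(Ex_delta p (fun=> 1)); apply: eq_Ex => x; rewrite mulr1.
Qed.

Lemma Ex_pair T T' (p : T -> R) (q : T -> T' -> R) (f : T * T' -> R) :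
  \E_(u ~ fun u => p u.1 * q u.1 u.2) f u = \E_(x ~ p) \E_(y ~ q x) f (x, y).
Proof.
rewrite /Ex; under [RHS]eq_bigr => x _ do rewrite big_distrr /=.
by rewrite pair_bigA /=; apply: eq_bigr => -[x y] _ /=; rewrite mulrA.
Qed.

Lemma pmf_pair T T' (p : T -> R) (q : T -> T' -> R) :
  is_pmf p -> (forall x, is_pmf (q x)) -> is_pmf (fun u => p u.1 * q u.1 u.2).
Proof.
move=> p_pmf q_pmf; split=> [u|].
  by rewrite mulr_ge0 //; [case: p_pmf|case: (q_pmf u.1)].
have := Ex_pair p q (fun=> 1); rewrite /Ex (eq_bigr _ (fun u _ => mulr1 _)) => ->.
rewrite -[RHS](Ex_cst 1 p_pmf); apply: eq_bigr => x _.
by congr (_ * _); exact: (Ex_cst 1 (q_pmf x)).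
Qed.

(** Random codebooks, i.i.d. sources and memoryless channels are all of this form; the law may vary
    with the index. *)
Definition prodp K T (mu : K -> T -> R) (F : {ffun K -> T}) : R :=
  \prod_k mu k (F k).

Lemma Ex_prodp_prod K T (mu f : K -> T -> R) :
  \E_(F ~ prodp mu) (\prod_k f k (F k)) = \prod_k Ex (mu k) (f k).
Proof.
by rewrite bigA_distr_bigA; apply: eq_bigr => F _; rewrite /prodp -big_split.
Qed.

Lemma prodp_ge0 K T (mu : K -> T -> R) F :
  (forall k x, 0 <= mu k x) -> 0 <= prodp mu F.
Proof. by move=> mu0; apply: prodr_ge0. Qed.

Lemma prodp_pmf K T (mu : K -> T -> R) :
  (forall k, is_pmf (mu k)) -> is_pmf (prodp mu).
Proof.
move=> mu_pmf; split=> [F|]; first by apply: prodp_ge0 => k; case: (mu_pmf k).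
rewrite /prodp -(bigA_distr_bigA mu) big1 // => k _.
by case: (mu_pmf k).
Qed.

(** A function of two coordinates is a combination of products of indicators of their values, and
    [Ex_prodp_prod] handles products. This is the independence of two distinct codewords. *)
Lemma Ex_prodp2 K T (mu : K -> T -> R) (g : T -> T -> R) (a b : K) :
  (forall k, is_pmf (mu k)) -> a != b ->
  \E_(F ~ prodp mu) g (F a) (F b) = \E_(t ~ mu a) \E_(u ~ mu b) g t u.
Proof.
move=> mu_pmf ab.
pose f (t u : T) k (x : T) : R := (if k == a then (x == t)%:R else 1) *
                      (if k == b then (x == u)%:R else 1).
have gE (F : {ffun K -> T}) : g (F a) (F b) =
    \sum_t \sum_u g t u * \prod_k f t u k (F k).
  rewrite (bigD1 (F a)) //= (bigD1 (F b)) //= [X in _ * X]big1; last first.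
    move=> k _; rewrite /f; case: (k =P a) => [<-|_]; case: (k =P b) => [<-|_];
    by rewrite ?eqxx !mulr1.
  rewrite mulr1 [X in _ + X + _]big1 ?addr0; last first.
    move=> u uF; rewrite (bigD1 b) //= /f eqxx [F b == u]eq_sym (negPf uF).
    by rewrite mulr0 mul0r mulr0.
  rewrite big1 ?addr0 // => t tF; rewrite big1 // => u _.
  rewrite (bigD1 a) //= /f eqxx [F a == t]eq_sym.
  by rewrite (negPf tF) !mul0r mulr0.
rewrite (eq_Ex _ gE) Ex_sum; apply: eq_bigr => t _; rewrite Ex_sum /Ex big_distrr.
apply: eq_bigr => u _ /=; rewrite -!/(Ex _ _) ExZl Ex_prodp_prod.
rewrite (bigD1 a) //= (bigD1 b) 1?eq_sym //= big1 => [|k /andP[ka kb]].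
  have -> : Ex (mu a) (f t u a) = mu a t.
    by rewrite -Ex_indic; apply: eq_Ex => x; rewrite /f eqxx (negPf ab) mulr1.
  have -> : Ex (mu b) (f t u b) = mu b u.
    by rewrite -Ex_indic; apply: eq_Ex => x; rewrite /f eqxx eq_sym (negPf ab) mul1r.
  by ring.
rewrite -[RHS](Ex_cst 1 (mu_pmf k)); apply: eq_Ex => x.
by rewrite /f (negPf ka) (negPf kb) mulr1.
Qed.

(** Same device: the indicator that [F] agrees with [G] along [h] is a product over [K], with
    factors 1 off the image of [h]. *)
Lemma Ex_prodp_restrict K K' T (mu : K -> T -> R) (h : K' -> K)
    (g : {ffun K' -> T} -> R) :
  (forall k, is_pmf (mu k)) -> injective h ->
  \E_(F ~ prodp mu) g [ffun k => F (h k)] =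
  \E_(G ~ prodp (fun k => mu (h k))) g G.
Proof.
move=> mu_pmf h_inj.
pose f (G : {ffun K' -> T}) k (x : T) : R :=
  [forall k', (h k' == k) ==> (x == G k')]%:R.
have gE (F : {ffun K -> T}) : g [ffun k => F (h k)] =
    \sum_G g G * \prod_k f G k (F k).
  rewrite (bigD1 [ffun k => F (h k)]) //= [X in _ * X]big1; last first.
    move=> k _; rewrite /f; case: forallP => //= -[] k'; apply/implyP => /eqP<-.
    by rewrite ffunE.
  rewrite mulr1 big1 ?addr0 // => G GF.
  have [k' kG] : exists k', G k' != F (h k').
    apply/existsP; rewrite -negb_forall; apply: contra GF => /forallP GF.
    by apply/eqP/ffunP => k; rewrite ffunE; apply/eqP.
  rewrite (bigD1 (h k')) //= /f; case: forallP => [/(_ k')|_]; last first.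
    by rewrite mul0r mulr0.
  by rewrite eqxx /= eq_sym (negPf kG).
rewrite (eq_Ex _ gE) Ex_sum; apply: eq_bigr => G _; rewrite ExZl mulrC.
congr (_ * _); rewrite Ex_prodp_prod (bigID (mem (h @: setT))) /=.
rewrite [X in _ * X]big1 => [|k kh]; last first.
  rewrite -[RHS](Ex_cst 1 (mu_pmf k)); apply: eq_Ex => x; rewrite /f.
  case: forallP => //= -[] k'; apply/implyP => /eqP hk.
  by case/imsetP: kh; exists k'.
rewrite mulr1 big_imset /=; last by move=> ? ? _ _; apply: h_inj.
rewrite /prodp; apply: eq_big => [k|k _]; first by rewrite inE.
rewrite -[RHS]Ex_indic; apply: eq_Ex => x; rewrite /f; congr (nat_of_bool _)%:R.
apply/forallP/eqP => [/(_ k)|-> k']; first by rewrite eqxx => /eqP.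
by apply/implyP => /eqP/h_inj->.
Qed.

Lemma Ex_prodp1 K T (mu : K -> T -> R) (g : T -> R) (a : K) :
  (forall k, is_pmf (mu k)) ->
  \E_(F ~ prodp mu) g (F a) = \E_(t ~ mu a) g t.
Proof.
move=> mu_pmf.
have tt_inj : injective (fun _ : unit => a) by move=> [] [].
have := Ex_prodp_restrict (fun G => g (G tt)) mu_pmf tt_inj.
under eq_Ex => F do rewrite ffunE.
move=> ->; rewrite /Ex (reindex (fun t => [ffun _ : unit => t])) /=.
  by apply: eq_bigr => t _; rewrite /prodp (big_pred1 tt) ?ffunE // => -[].
exists (fun F : {ffun unit -> T} => F tt) => [t|F] _; first by rewrite ffunE.
by apply/ffunP => -[]; rewrite ffunE.
Qed.

Lemma Ex_prodp_sum K1 K2 T (mu : K1 + K2 -> T -> R)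
    (g : {ffun K1 -> T} -> {ffun K2 -> T} -> R) :
  \E_(F ~ prodp mu) g [ffun k => F (inl k)] [ffun k => F (inr k)] =
  \E_(G ~ prodp (fun k => mu (inl k))) \E_(H ~ prodp (fun k => mu (inr k))) g G H.
Proof.
rewrite /Ex; under [RHS]eq_bigr => G _ do rewrite big_distrr /=.
rewrite pair_bigA /=.
pose j (u : {ffun K1 -> T} * {ffun K2 -> T}) : {ffun K1 + K2 -> T} :=
  [ffun k => match k with inl k => u.1 k | inr k => u.2 k end].
rewrite (reindex j) /=.
  apply: eq_bigr => -[G H] _ /=; rewrite mulrA /prodp big_sumType /=.
  congr (_ * _ * _); try by apply: eq_bigr => k _; rewrite ffunE.
  by congr (g _ _); apply/ffunP => k; rewrite !ffunE.
exists (fun F => ([ffun k => F (inl k)], [ffun k => F (inr k)])).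
  by case=> G H _; congr pair; apply/ffunP => k; rewrite !ffunE.
by move=> F _; apply/ffunP => -[] k; rewrite !ffunE.
Qed.

(** Disjoint images give independence: [h1] and [h2] combine into one injection from the sum
    type. *)
Lemma Ex_prodp_restrict2 K K1 K2 T (mu : K -> T -> R) (h1 : K1 -> K)
    (h2 : K2 -> K) (g : {ffun K1 -> T} -> {ffun K2 -> T} -> R) :
  (forall k, is_pmf (mu k)) -> injective h1 -> injective h2 ->
  (forall k k', h1 k != h2 k') ->
  \E_(F ~ prodp mu) g [ffun k => F (h1 k)] [ffun k => F (h2 k)] =
  \E_(G ~ prodp (fun k => mu (h1 k))) \E_(H ~ prodp (fun k => mu (h2 k))) g G H.
Proof.
move=> mu_pmf h1_inj h2_inj h12.
pose h (k : K1 + K2) := match k with inl k => h1 k | inr k => h2 k end.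
have h_inj : injective h.
  move=> [] k [] k' //=; first by move/h1_inj->.
  - by move/eqP; rewrite (negPf (h12 _ _)).
  - by move/eqP; rewrite eq_sym (negPf (h12 _ _)).
  by move/h2_inj->.
rewrite -(Ex_prodp_sum (fun k => mu (h k))).
rewrite -(Ex_prodp_restrict _ mu_pmf h_inj); apply: eq_Ex => F.
by congr (g _ _); apply/ffunP => k; rewrite !ffunE.
Qed.

(** Two draws in succession, letter by letter, are one draw of pairs. Letting [q'] take the whole of
    [G] absorbs the [ffun] wrappers left by earlier stages. *)
Lemma Ex_prodp_dep K T T' (p : T -> R) (q : T -> T' -> R)
    (q' : {ffun K -> T} -> K -> T' -> R)
    (g : {ffun K -> T} -> {ffun K -> T'} -> R) :
  (forall G k, q' G k =1 q (G k)) ->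
  \E_(G ~ prodp (fun=> p)) \E_(H ~ prodp (q' G)) g G H =
  \E_(F ~ prodp (fun _ u => p u.1 * q u.1 u.2))
     g [ffun k => (F k).1] [ffun k => (F k).2].
Proof.
move=> qq'; rewrite /Ex; under eq_bigr => G _ do rewrite big_distrr /=.
rewrite pair_bigA /=.
rewrite [RHS](reindex (fun u : {ffun K -> T} * {ffun K -> T'} =>
  [ffun k => (u.1 k, u.2 k)])) /=.
  apply: eq_bigr => -[G H] _ /=; rewrite mulrA /prodp -big_split /=.
  congr (_ * _); first by apply: eq_bigr => k _; rewrite !ffunE qq'.
  by congr (g _ _); apply/ffunP => k; rewrite !ffunE.
exists (fun F => ([ffun k => (F k).1], [ffun k => (F k).2])).
  by case=> G H _; congr pair; apply/ffunP => k; rewrite !ffunE.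
by move=> F _; apply/ffunP => k; rewrite !ffunE; case: (F k).
Qed.

Lemma pmf_supp T (p : T -> R) : is_pmf p -> exists x, 0 < p x.
Proof.
move=> [p0 p1]; case: (pickP (fun x => 0 < p x)) => [x px|px]; first by exists x.
move: p1; rewrite big1 => [/eqP|x _]; first by rewrite eq_sym oner_eq0.
by apply/eqP; rewrite eq_le p0 leNgt px.
Qed.

Lemma Ex_gt0 T (p f : T -> R) x : (forall y, 0 <= p y) -> (forall y, 0 <= f y) ->
  0 < p x -> 0 < f x -> 0 < Ex p f.
Proof.
move=> p0 f0 px fx; rewrite /Ex (bigD1 x) //= ltr_pwDl ?mulr_gt0 //.
by apply: sumr_ge0 => y _; apply: mulr_ge0.
Qed.

End Expectation.

(** * One-shot random coding for the multiple-access channel *)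

Section OneShotMac.
Variables (R : realType) (Om M1 M2 Wt U1 U2 U3 Y : finType).
Variables (p : Om -> R) (a1 : Om -> M1) (a2 : Om -> M2) (w : Om -> Wt).
Variables (p1 : U1 -> R) (p2 : U2 -> R) (p3 : U1 -> U2 -> U3 -> R).
Variables (K : U1 -> U2 -> U3 -> Y -> R).
Variables (sg1 sg2 sg12 : M1 -> M2 -> Wt -> R) (g : R).

(** An error in [m1] alone also changes the pair that indexes the third codeword, so [u3] is redrawn
    along with [u1]; likewise for [m2]. *)
Definition mac_den1 u2 y := \E_(u1 ~ p1) \E_(u3 ~ p3 u1 u2) K u1 u2 u3 y.
Definition mac_den2 u1 y := \E_(u2 ~ p2) \E_(u3 ~ p3 u1 u2) K u1 u2 u3 y.
Definition mac_den12 y :=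
  \E_(u1 ~ p1) \E_(u2 ~ p2) \E_(u3 ~ p3 u1 u2) K u1 u2 u3 y.

Definition mac_test1 m1 m2 w u1 u2 u3 y :=
  g * mac_den1 u2 y <= K u1 u2 u3 y * sg1 m1 m2 w.
Definition mac_test2 m1 m2 w u1 u2 u3 y :=
  g * mac_den2 u1 y <= K u1 u2 u3 y * sg2 m1 m2 w.
Definition mac_test12 m1 m2 w u1 u2 u3 y :=
  g * mac_den12 y <= K u1 u2 u3 y * sg12 m1 m2 w.

(** Uniqueness of the accepted candidate is not checked: any wrong one that passes is counted as a
    false alarm anyway. *)
Definition mac_dec (c1 : M1 -> U1) (c2 : M2 -> U2) (c3 : M1 * M2 -> U3) y w :
    option (M1 * M2) :=
  [pick m | [&& mac_test1 m.1 m.2 w (c1 m.1) (c2 m.2) (c3 m) y,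
                mac_test2 m.1 m.2 w (c1 m.1) (c2 m.2) (c3 m) y
              & mac_test12 m.1 m.2 w (c1 m.1) (c2 m.2) (c3 m) y]].

(** A count of failed tests rather than an indicator: the union bound over the three tests is built
    in. *)
Definition mac_fail m1 m2 w u1 u2 u3 y : R :=
  (~~ mac_test1 m1 m2 w u1 u2 u3 y)%:R + (~~ mac_test2 m1 m2 w u1 u2 u3 y)%:R +
  (~~ mac_test12 m1 m2 w u1 u2 u3 y)%:R.

Definition mac_avg (f : (M1 -> U1) -> (M2 -> U2) -> (M1 * M2 -> U3) -> R) :=
  \E_(c1 ~ prodp (fun _ : M1 => p1)) \E_(c2 ~ prodp (fun _ : M2 => p2))
  \E_(c3 ~ prodp (fun m : M1 * M2 => p3 (c1 m.1) (c2 m.2))) f c1 c2 c3.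

Hypothesis p_pmf : is_pmf p.
Hypothesis p1_pmf : is_pmf p1.
Hypothesis p2_pmf : is_pmf p2.
Hypothesis p3_pmf : forall u1 u2, is_pmf (p3 u1 u2).
Hypothesis K_pmf : forall u1 u2 u3, is_pmf (K u1 u2 u3).
Hypothesis g_gt0 : 0 < g.

Lemma mac_avgD f f' :
  mac_avg (fun c1 c2 c3 => f c1 c2 c3 + f' c1 c2 c3) = mac_avg f + mac_avg f'.
Proof.
rewrite -ExD; apply: eq_Ex => c1; rewrite -ExD; apply: eq_Ex => c2.
by rewrite -ExD.
Qed.

Lemma mac_avg_sum (I : finType) (P : pred I) f :
  mac_avg (fun c1 c2 c3 => \sum_(i | P i) f i c1 c2 c3) =
  \sum_(i | P i) mac_avg (f i).
Proof.
rewrite -Ex_sum; apply: eq_Ex => c1; rewrite -Ex_sum; apply: eq_Ex => c2.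
by rewrite -Ex_sum.
Qed.

Let cw1_pmf (m : M1) := p1_pmf.
Let cw2_pmf (m : M2) := p2_pmf.
Let cw3_pmf (c1 : M1 -> U1) (c2 : M2 -> U2) (m : M1 * M2) :=
  p3_pmf (c1 m.1) (c2 m.2).

Lemma ler_mac_avg f f' : (forall c1 c2 c3, f c1 c2 c3 <= f' c1 c2 c3) ->
  mac_avg f <= mac_avg f'.
Proof.
move=> ff'; apply: ler_Ex => [F|c1]; first exact: (prodp_pmf cw1_pmf).1.
apply: ler_Ex => [F|c2]; first exact: (prodp_pmf cw2_pmf).1.
by apply: ler_Ex => [F|c3]; first exact: (prodp_pmf (cw3_pmf c1 c2)).1.
Qed.

Lemma mac_avg1 m1 m2 (f : U1 -> U2 -> U3 -> R) :
  mac_avg (fun c1 c2 c3 => f (c1 m1) (c2 m2) (c3 (m1, m2))) =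
  \E_(u1 ~ p1) \E_(u2 ~ p2) \E_(u3 ~ p3 u1 u2) f u1 u2 u3.
Proof.
rewrite -(Ex_prodp1 _ m1 cw1_pmf); apply: eq_Ex => c1.
rewrite -(Ex_prodp1 _ m2 cw2_pmf); apply: eq_Ex => c2.
by rewrite (Ex_prodp1 (f (c1 m1) (c2 m2)) (m1, m2) (cw3_pmf c1 c2)).
Qed.

(* A wrong codeword is independent of [y], whose law is [D]; on acceptance
   [D y <= kern z y * c / g]. *)
Lemma false_accept_le (Z : finType) (q : Z -> R) (kern : Z -> Y -> R)
    (D : Y -> R) (c : R) : is_pmf q -> (forall z, is_pmf (kern z)) -> 0 <= c ->
  \sum_y D y * (\E_(z ~ q) (g * D y <= kern z y * c)%R%:R) <= c / g.
Proof.
move=> q_pmf kern_pmf c_ge0; have [q_ge0 _] := q_pmf.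
have cg_ge0 : 0 <= c / g by rewrite divr_ge0 // ltW.
have -> : c / g = \sum_y \E_(z ~ q) (kern z y * (c / g)).
  rewrite -Ex_sum -[LHS](Ex_cst (c / g) q_pmf); apply: eq_Ex => z.
  by rewrite -big_distrl /=; case: (kern_pmf z) => _ ->; rewrite mul1r.
apply: ler_sum => y _; rewrite -ExZl; apply: ler_Ex => // z.
have [kern_ge0 _] := kern_pmf z.
case: (boolP (g * D y <= kern z y * c)) => [le|_]; last by rewrite mulr0 mulr_ge0.
by rewrite mulr1 mulrA ler_pdivlMr // mulrC.
Qed.

(** The true and the competing candidate share [u2]. Given it, the competitor's [u1] and [u3] are
    independent of the transmitted ones, and averaging the channel over the latter gives exactly
    [mac_den1], so [false_accept_le] applies. *)
Lemma mac_alt1 m1 n1 m2 (c : R) : n1 != m1 -> 0 <= c ->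
  mac_avg (fun c1 c2 c3 => \E_(y ~ K (c1 m1) (c2 m2) (c3 (m1, m2)))
    (g * mac_den1 (c2 m2) y <= K (c1 n1) (c2 m2) (c3 (n1, m2)) y * c)%R%:R)
  <= c / g.
Proof.
move=> mn c0.
have -> : mac_avg (fun c1 c2 c3 => \E_(y ~ K (c1 m1) (c2 m2) (c3 (m1, m2)))
    (g * mac_den1 (c2 m2) y <= K (c1 n1) (c2 m2) (c3 (n1, m2)) y * c)%R%:R) =
  \E_(u2 ~ p2) \E_(u1 ~ p1) \E_(v1 ~ p1) \E_(u3 ~ p3 u1 u2) \E_(v3 ~ p3 v1 u2)
  \E_(y ~ K u1 u2 u3) (g * mac_den1 u2 y <= K v1 u2 v3 y * c)%R%:R.
  rewrite /mac_avg Ex_swap -(Ex_prodp1 _ m2 cw2_pmf); apply: eq_Ex => c2.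
  rewrite -(@Ex_prodp2 _ _ _ _ _ m1 n1 cw1_pmf) 1?eq_sym //; apply: eq_Ex => c1.
  (* The index pairs differ, so the two third codewords are independent given [c1] and [c2]. *)
  have mn' : (m1, m2) != (n1, m2) by rewrite xpair_eqE eqxx andbT eq_sym.
  exact: (Ex_prodp2 (fun u3 v3 => \E_(y ~ K (c1 m1) (c2 m2) u3)
    (g * mac_den1 (c2 m2) y <= K (c1 n1) (c2 m2) v3 y * c)%R%:R) (cw3_pmf c1 c2)).
rewrite -[leRHS](Ex_cst _ p2_pmf).
apply: ler_Ex => [|u2]; first by case: p2_pmf.
pose q (z : U1 * U3) := p1 z.1 * p3 z.1 u2 z.2.
have q_pmf : is_pmf q := pmf_pair p1_pmf (fun u1 => p3_pmf u1 u2).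
apply: le_trans (false_accept_le (mac_den1 u2) q_pmf
                   (fun z => K_pmf z.1 u2 z.2) c0).
apply: eq_ler.
under [RHS]eq_bigr => y _ do rewrite mulrC -ExZl.
rewrite -Ex_sum; apply: eq_Ex => u1; rewrite Ex_swap.
under [RHS]eq_bigr => y _ do rewrite mulrC -ExZr.
rewrite -Ex_sum; apply: eq_Ex => u3.
under eq_Ex => v1 do rewrite Ex_swap.
rewrite Ex_swap /Ex -/(Ex _ _); apply: eq_bigr => y _; congr (_ * _).
exact: esym (Ex_pair p1 (fun u1 => p3 u1 u2) _).
Qed.

Lemma mac_alt2 m1 m2 n2 (c : R) : n2 != m2 -> 0 <= c ->
  mac_avg (fun c1 c2 c3 => \E_(y ~ K (c1 m1) (c2 m2) (c3 (m1, m2)))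
    (g * mac_den2 (c1 m1) y <= K (c1 m1) (c2 n2) (c3 (m1, n2)) y * c)%R%:R)
  <= c / g.
Proof.
move=> mn c0.
have -> : mac_avg (fun c1 c2 c3 => \E_(y ~ K (c1 m1) (c2 m2) (c3 (m1, m2)))
    (g * mac_den2 (c1 m1) y <= K (c1 m1) (c2 n2) (c3 (m1, n2)) y * c)%R%:R) =
  \E_(u1 ~ p1) \E_(u2 ~ p2) \E_(v2 ~ p2) \E_(u3 ~ p3 u1 u2) \E_(v3 ~ p3 u1 v2)
  \E_(y ~ K u1 u2 u3) (g * mac_den2 u1 y <= K u1 v2 v3 y * c)%R%:R.
  rewrite -(Ex_prodp1 _ m1 cw1_pmf); apply: eq_Ex => c1.
  rewrite -(@Ex_prodp2 _ _ _ _ _ m2 n2 cw2_pmf) 1?eq_sym //; apply: eq_Ex => c2.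
  have mn' : (m1, m2) != (m1, n2) by rewrite xpair_eqE eqxx eq_sym.
  exact: (Ex_prodp2 (fun u3 v3 => \E_(y ~ K (c1 m1) (c2 m2) u3)
    (g * mac_den2 (c1 m1) y <= K (c1 m1) (c2 n2) v3 y * c)%R%:R) (cw3_pmf c1 c2)).
rewrite -[leRHS](Ex_cst _ p1_pmf).
apply: ler_Ex => [|u1]; first by case: p1_pmf.
pose q (z : U2 * U3) := p2 z.1 * p3 u1 z.1 z.2.
have q_pmf : is_pmf q := pmf_pair p2_pmf (p3_pmf u1).
apply: le_trans (false_accept_le (mac_den2 u1) q_pmf
                   (fun z => K_pmf u1 z.1 z.2) c0).
apply: eq_ler.
under [RHS]eq_bigr => y _ do rewrite mulrC -ExZl.
rewrite -Ex_sum; apply: eq_Ex => u2; rewrite Ex_swap.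
under [RHS]eq_bigr => y _ do rewrite mulrC -ExZr.
rewrite -Ex_sum; apply: eq_Ex => u3.
under eq_Ex => v2 do rewrite Ex_swap.
rewrite Ex_swap /Ex -/(Ex _ _); apply: eq_bigr => y _; congr (_ * _).
exact: esym (Ex_pair p2 (p3 u1) _).
Qed.

Lemma mac_alt12 m1 m2 n1 n2 (c : R) : n1 != m1 -> n2 != m2 -> 0 <= c ->
  mac_avg (fun c1 c2 c3 => \E_(y ~ K (c1 m1) (c2 m2) (c3 (m1, m2)))
    (g * mac_den12 y <= K (c1 n1) (c2 n2) (c3 (n1, n2)) y * c)%R%:R)
  <= c / g.
Proof.
move=> mn1 mn2 c0.
have -> : mac_avg (fun c1 c2 c3 => \E_(y ~ K (c1 m1) (c2 m2) (c3 (m1, m2)))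
    (g * mac_den12 y <= K (c1 n1) (c2 n2) (c3 (n1, n2)) y * c)%R%:R) =
  \E_(u1 ~ p1) \E_(v1 ~ p1) \E_(u2 ~ p2) \E_(v2 ~ p2)
  \E_(u3 ~ p3 u1 u2) \E_(v3 ~ p3 v1 v2)
  \E_(y ~ K u1 u2 u3) (g * mac_den12 y <= K v1 v2 v3 y * c)%R%:R.
  rewrite -(@Ex_prodp2 _ _ _ _ _ m1 n1 cw1_pmf) 1?eq_sym //; apply: eq_Ex => c1.
  rewrite -(@Ex_prodp2 _ _ _ _ _ m2 n2 cw2_pmf) 1?eq_sym //; apply: eq_Ex => c2.
  have mn' : (m1, m2) != (n1, n2).
    by rewrite xpair_eqE eq_sym negb_and mn1.
  exact: (Ex_prodp2 (fun u3 v3 => \E_(y ~ K (c1 m1) (c2 m2) u3)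
    (g * mac_den12 y <= K (c1 n1) (c2 n2) v3 y * c)%R%:R) (cw3_pmf c1 c2)).
(* Nothing is shared here: the competitor is an entirely fresh triple. *)
pose q (z : (U1 * U2) * U3) := p1 z.1.1 * p2 z.1.2 * p3 z.1.1 z.1.2 z.2.
have q_pmf : is_pmf q.
  exact: (pmf_pair (q := fun u : U1 * U2 => p3 u.1 u.2)
            (pmf_pair p1_pmf (fun=> p2_pmf))).
apply: le_trans (false_accept_le mac_den12 q_pmf
                   (fun z => K_pmf z.1.1 z.1.2 z.2) c0).
apply: eq_ler.
under [RHS]eq_bigr => y _ do rewrite mulrC -ExZl.
rewrite -Ex_sum; apply: eq_Ex => u1; rewrite Ex_swap.
under [RHS]eq_bigr => y _ do rewrite mulrC -ExZr.
rewrite -Ex_sum; apply: eq_Ex => u2.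
under [RHS]eq_bigr => y _ do rewrite -ExZr.
rewrite -Ex_sum.
under eq_Ex => v1 do rewrite Ex_swap.
rewrite Ex_swap; apply: eq_Ex => u3.
under eq_Ex => v1 do under eq_Ex => v2 do rewrite Ex_swap.
under eq_Ex => v1 do rewrite Ex_swap.
rewrite Ex_swap /Ex -!/(Ex _ _); apply: eq_bigr => y _; congr (_ * _).
apply/esym.
apply: (etrans (Ex_pair (fun u : U1 * U2 => p1 u.1 * p2 u.2)
                        (fun u => p3 u.1 u.2) _)).
exact: (Ex_pair p1 (fun=> p2)
  (fun u => \E_(v3 ~ p3 u.1 u.2) (g * mac_den12 y <= K u.1 u.2 v3 y * c)%R%:R)).
Qed.

(** A wrong accepted candidate passes all three tests but is charged only to the one matching its
    wrong part, so each sum ranges over a single posterior. If nothing is accepted, the true pair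
    failed a test. *)
Lemma mac_dec_error_le (c1 : M1 -> U1) (c2 : M2 -> U2) (c3 : M1 * M2 -> U3)
    y v m1 m2 :
  (mac_dec c1 c2 c3 y v != Some (m1, m2))%:R <=
  mac_fail m1 m2 v (c1 m1) (c2 m2) (c3 (m1, m2)) y +
  (\sum_(n1 | n1 != m1)
      (mac_test1 n1 m2 v (c1 n1) (c2 m2) (c3 (n1, m2)) y)%:R +
   \sum_(n2 | n2 != m2)
      (mac_test2 m1 n2 v (c1 m1) (c2 n2) (c3 (m1, n2)) y)%:R +
   \sum_(n : M1 * M2 | (n.1 != m1) && (n.2 != m2))
      (mac_test12 n.1 n.2 v (c1 n.1) (c2 n.2) (c3 n) y)%:R) :> R.
Proof.
rewrite /mac_fail.
set s1 := \sum_(_ | _) _; set s2 := \sum_(_ | _) _; set s12 := \sum_(_ | _) _.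
have s1_ge0 : 0 <= s1 by apply: sumr_ge0.
have s2_ge0 : 0 <= s2 by apply: sumr_ge0.
have s12_ge0 : 0 <= s12 by apply: sumr_ge0.
have b0 (b : bool) : 0 <= b%:R :> R by [].
case: (boolP (_ == _)) => [_|]; first by rewrite !addr_ge0.
rewrite /mac_dec; case: pickP => [[n1 n2] /= /and3P[t1 t2 t12] ne|/(_ (m1, m2))] /=.
  apply: (@le_trans _ _ (s1 + s2 + s12)); last first.
    by rewrite lerDr !addr_ge0.
  case: (n1 =P m1) => [e1|/eqP n1m].
    rewrite -[leLHS]add0r -[X in X <= _]addr0 !lerD //.
    have n2m : n2 != m2 by apply: contra ne => /eqP->; rewrite e1.
    by rewrite /s2 (bigD1 n2) //= -e1 t2 lerDl sumr_ge0.
  case: (n2 =P m2) => [e2|/eqP n2m].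
    rewrite -[leLHS]addr0 -[X in X + 0 <= _]addr0 !lerD //.
    by rewrite /s1 (bigD1 n1) //= -e2 t1 lerDl sumr_ge0.
  rewrite -[leLHS]add0r lerD ?addr_ge0 //.
  by rewrite /s12 (bigD1 (n1, n2)) /= ?n1m ?n2m // t12 lerDl sumr_ge0.
move=> F _; rewrite -[leLHS]addr0 lerD ?addr_ge0 //.
by move: F => /=; case: (mac_test1 _ _ _ _ _ _ _);
  case: (mac_test2 _ _ _ _ _ _ _); case: (mac_test12 _ _ _ _ _ _ _) => //= _;
  rewrite ?addr0 ?add0r // -?addrA lerDl ?addr_ge0.
Qed.

Hypothesis sg1_ge0 : forall m1 m2 w, 0 <= sg1 m1 m2 w.
Hypothesis sg2_ge0 : forall m1 m2 w, 0 <= sg2 m1 m2 w.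
Hypothesis sg12_ge0 : forall m1 m2 w, 0 <= sg12 m1 m2 w.
Hypothesis sg1_le1 : forall m2 w, \sum_m1 sg1 m1 m2 w <= 1.
Hypothesis sg2_le1 : forall m1 w, \sum_m2 sg2 m1 m2 w <= 1.
Hypothesis sg12_le1 : forall w, \sum_m1 \sum_m2 sg12 m1 m2 w <= 1.

Theorem mac_random_coding :
  mac_avg (fun c1 c2 c3 => \E_(o ~ p)
    \E_(y ~ K (c1 (a1 o)) (c2 (a2 o)) (c3 (a1 o, a2 o)))
      (mac_dec c1 c2 c3 y (w o) != Some (a1 o, a2 o))%:R) <=
  \E_(o ~ p) (\E_(u1 ~ p1) \E_(u2 ~ p2) \E_(u3 ~ p3 u1 u2) \E_(y ~ K u1 u2 u3)
    mac_fail (a1 o) (a2 o) (w o) u1 u2 u3 y) + 3 / g.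
Proof.
have p_ge0 := p_pmf.1.
rewrite /mac_avg; under eq_Ex => c1 do under eq_Ex => c2 do rewrite Ex_swap.
under eq_Ex => c1 do rewrite Ex_swap.
rewrite Ex_swap -[3 / g](Ex_cst _ p_pmf) -ExD; apply: ler_Ex => // o.
move: (a1 o) (a2 o) (w o) => m1 m2 v.
rewrite -[X in X <= _]/(mac_avg (fun c1 c2 c3 =>
  \E_(y ~ K (c1 m1) (c2 m2) (c3 (m1, m2)))
    (mac_dec c1 c2 c3 y v != Some (m1, m2))%:R)).
pose A1 c1 c2 c3 y : R := \sum_(n1 | n1 != m1)
      (mac_test1 n1 m2 v (c1 n1) (c2 m2) (c3 (n1, m2)) y)%:R.
pose A2 c1 c2 c3 y : R := \sum_(n2 | n2 != m2)
      (mac_test2 m1 n2 v (c1 m1) (c2 n2) (c3 (m1, n2)) y)%:R.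
pose A12 c1 c2 c3 y : R := \sum_(n : M1 * M2 | (n.1 != m1) && (n.2 != m2))
      (mac_test12 n.1 n.2 v (c1 n.1) (c2 n.2) (c3 n) y)%:R.
pose L (f : (M1 -> U1) -> (M2 -> U2) -> (M1 * M2 -> U3) -> Y -> R) :=
  mac_avg (fun c1 c2 c3 =>
    \E_(y ~ K (c1 m1) (c2 m2) (c3 (m1, m2))) f c1 c2 c3 y).
have LD f f' : L (fun c1 c2 c3 y => f c1 c2 c3 y + f' c1 c2 c3 y) = L f + L f'.
  rewrite -mac_avgD; apply: eq_Ex => c1; apply: eq_Ex => c2; apply: eq_Ex => c3.
  exact: ExD.
have Lsum (I : finType) (P : pred I) f :
    L (fun c1 c2 c3 y => \sum_(i | P i) f i c1 c2 c3 y) = \sum_(i | P i) L (f i).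
  rewrite -mac_avg_sum; apply: eq_Ex => c1; apply: eq_Ex => c2; apply: eq_Ex => c3.
  exact: Ex_sum.
apply: (@le_trans _ _ (L (fun c1 c2 c3 y =>
  mac_fail m1 m2 v (c1 m1) (c2 m2) (c3 (m1, m2)) y +
  (A1 c1 c2 c3 y + A2 c1 c2 c3 y + A12 c1 c2 c3 y)))).
  apply: ler_mac_avg => c1 c2 c3; apply: ler_Ex => [|y].
    by case: (K_pmf (c1 m1) (c2 m2) (c3 (m1, m2))).
  exact: mac_dec_error_le.
rewrite LD LD LD lerD //.
  apply: eq_ler.
  exact: (mac_avg1 m1 m2 (fun u1 u2 u3 =>
    \E_(y ~ K u1 u2 u3) mac_fail m1 m2 v u1 u2 u3 y)).
(* One [1 / g] per kind of error: each false alarm costs its posterior over [g], and a posterior has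
   total mass at most 1. *)
have -> : 3 / g = 1 / g + 1 / g + 1 / g by ring.
have le_g x : x <= 1 -> x / g <= 1 / g by rewrite ler_pM2r // invr_gt0.
rewrite !lerD //.
- rewrite /A1 Lsum; apply: le_trans (le_g _ (sg1_le1 m2 v)).
  rewrite [X in _ <= X / _](bigID (fun n1 => n1 != m1)) /= mulrDl big_distrl /=.
  rewrite -[leLHS]addr0 lerD //; last by rewrite divr_ge0 ?sumr_ge0 // ltW.
  by apply: ler_sum => n1 n1m; apply: mac_alt1.
- rewrite /A2 Lsum; apply: le_trans (le_g _ (sg2_le1 m1 v)).
  rewrite [X in _ <= X / _](bigID (fun n2 => n2 != m2)) /= mulrDl big_distrl /=.
  rewrite -[leLHS]addr0 lerD //; last by rewrite divr_ge0 ?sumr_ge0 // ltW.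
  by apply: ler_sum => n2 n2m; apply: mac_alt2.
- rewrite /A12 Lsum; apply: le_trans (le_g _ (sg12_le1 v)).
  rewrite pair_bigA /= [X in _ <= X / _](bigID (fun n => (n.1 != m1) && (n.2 != m2))).
  rewrite /= mulrDl big_distrl /=.
  rewrite -[leLHS]addr0 lerD //; last by rewrite divr_ge0 ?sumr_ge0 // ltW.
  by apply: ler_sum => -[n1 n2] /= /andP[n1m n2m]; apply: mac_alt12.
Qed.

End OneShotMac.

(** * Chernoff bound for the threshold tests *)

Section Chernoff.
Variable R : realType.

Lemma prodp_gt0_supp (K T : finType) (mu : K -> T -> R) F :
  (forall k x, 0 <= mu k x) -> 0 < prodp mu F -> forall k, 0 < mu k (F k).
Proof.
move=> mu0 F0 k; rewrite lt0r mu0 andbT; move: F0; apply: contraTN => /eqP E.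
by rewrite /prodp (bigD1 k) //= E mul0r ltxx.
Qed.

(** From [expR (- x) >= 1 - x] and (1 + x + 2x^2)(1 - x) = 1 + x^2 (1 - 2x) >= 1. As x is bounded
    from above only, so need be the exponents to which it is applied. *)
Lemma expR_le_quad (x : R) : x <= 2^-1 -> expR x <= 1 + x + 2 * x ^+ 2.
Proof.
move=> x_le; rewrite -[expR x]invrK -expRN.
have x1 : 0 < 1 - x by lra.
apply: (@le_trans _ _ (1 - x)^-1).
  by rewrite lef_pV2 ?posrE ?expR_gt0 // expR_ge1Dx.
rewrite -[leLHS]mul1r ler_pdivrMr //.
have -> : (1 + x + 2 * x ^+ 2) * (1 - x) = 1 + x ^+ 2 * (1 - 2 * x) by ring.
by rewrite lerDl mulr_ge0 ?sqr_ge0 //; lra.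
Qed.

(** For small r the negative mean of [Z - z] beats the quadratic term. The bound is kept for every r
    up to [r0] because source and channel letters must later share one r. *)
Lemma chernoff_letter (T : finType) (p Z : T -> R) (z : R) :
  is_pmf p -> Ex p Z < z ->
  exists2 r0, 0 < r0 & forall r, 0 < r <= r0 ->
    \E_(x ~ p) expR (r * Z x) <= expR (r * z).
Proof.
move=> p_pmf Zz; pose D x := Z x - z; have [p_ge0 _] := p_pmf.
have ED : Ex p D = Ex p Z - z.
  by rewrite /D (ExD p Z (fun=> - z)) Ex_cst.
have DE x : D x = Z x - z by [].
clearbody D.
pose M := \sum_x `|D x|; pose V := \E_(x ~ p) D x ^+ 2.
have M_ge0 : 0 <= M by apply: sumr_ge0.
have DM x : D x <= M.
  apply: le_trans (ler_norm _) _; rewrite /M (bigD1 x) //= lerDl.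
  exact: sumr_ge0.
have V_ge0 : 0 <= V by apply: Ex_ge0 => // x; apply: sqr_ge0.
(* The first term keeps [r * D x] below 1/2; the second makes [2 * r ^+ 2 * V] at most
   [r * (z - Ex p Z)]. *)
exists (Num.min (2^-1 / (M + 1)) ((z - Ex p Z) / (2 * (V + 1)))).
  rewrite lt_min !divr_gt0 ?mulr_gt0 ?subr_gt0 //; lra.
move=> r /andP[r_gt0]; rewrite le_min => /andP[rM rV].
have rD x : r * D x <= 2^-1.
  have M1 : 0 < M + 1 by lra.
  move: rM; rewrite ler_pdivlMr // => rM; apply: le_trans rM.
  by rewrite ler_pM2l //; apply: le_trans (DM x) _; lra.
suff H : \E_(x ~ p) expR (r * D x) <= 1.
  have -> : \E_(x ~ p) expR (r * Z x) =
      expR (r * z) * \E_(x ~ p) expR (r * D x).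
    by rewrite -ExZl; apply: eq_Ex => x; rewrite -expRD DE; congr expR; ring.
  by rewrite ger_pMr ?expR_gt0.
apply: (@le_trans _ _ (\E_(x ~ p) (1 + r * D x + 2 * (r * D x) ^+ 2))).
  by apply: ler_Ex => // x; apply: expR_le_quad.
have -> : \E_(x ~ p) (1 + r * D x + 2 * (r * D x) ^+ 2) =
    1 + r * Ex p D + 2 * r ^+ 2 * V.
  rewrite !ExD Ex_cst // /V -!ExZl -!addrA; congr (_ + (_ + _)).
  by apply: eq_Ex => x; ring.
move: rV; rewrite ler_pdivlMr; last by lra.
rewrite ED => rV.
have : r * (r * (2 * (V + 1))) <= r * (z - Ex p Z) by rewrite ler_pM2l.
have : 0 <= r ^+ 2 by apply: sqr_ge0.
nra.
Qed.

(** In logarithms, failure means that the letters [ln (sg s)] and [ln (K t / D t)] sum to less than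
    [c * #|J|], whereas the rate condition keeps the mean of that sum above a positive multiple of
    [#|J|] for small c. One exponential moment treats both sums at once. *)
Lemma threshold_exponent (T S : finType) (P K D : T -> R) (src sg : S -> R)
    (kappa : R) :
  is_pmf P -> is_pmf src -> 0 < kappa ->
  (forall t, 0 < P t -> 0 < K t /\ 0 < D t) ->
  (forall s, 0 < src s -> 0 < sg s) ->
  0 <= \E_(s ~ src) (- ln (sg s)) ->
  \E_(s ~ src) (- ln (sg s)) < kappa * \E_(t ~ P) ln (K t / D t) ->
  exists2 c0, 0 < c0 & forall c, 0 < c <= c0 -> forall I J : finType,
    #|I|%:R <= (kappa^-1 + c) * #|J|%:R ->
    \E_(F ~ prodp (fun _ : J => P)) \E_(o ~ prodp (fun _ : I => src))
      (~~ (expR (c * #|J|%:R) * \prod_j D (F j) <=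
           \prod_j K (F j) * \prod_i sg (o i))%R)%:R
    <= expR (- (c * #|J|%:R)).
Proof.
move=> P_pmf src_pmf kappa_gt0 KD_gt0 sg_gt0.
set H := Ex src _; set i0 := Ex P _ => H_ge0 Hi0.
have [P_ge0 _] := P_pmf; have [src_ge0 _] := src_pmf.
pose gap := i0 - H / kappa.
have gap_gt0 : 0 < gap by rewrite subr_gt0 ltr_pdivrMr // mulrC.
(* The gap is cut into quarters: one for the source mean, one for the channel mean, one for the
   threshold and the excess of source letters, and one left for the exponent. *)
pose h := H + kappa * (gap / 4); pose i1 := i0 - gap / 4.
have kgap : 0 < kappa * (gap / 4) by rewrite mulr_gt0 //; lra.
have Hh : \E_(s ~ src) (- ln (sg s)) < h by rewrite /h -/H; lra.
have Hi : \E_(t ~ P) (- ln (K t / D t)) < - i1.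
  by rewrite ExN -/i0 /i1; lra.
have [ra ra_gt0 Ha] := chernoff_letter src_pmf Hh.
have [rb rb_gt0 Hb] := chernoff_letter P_pmf Hi.
pose r := Num.min ra rb.
have r_gt0 : 0 < r by rewrite lt_min ra_gt0.
have {}Ha := Ha r; have {}Hb := Hb r.
rewrite r_gt0 ge_min lexx /= in Ha; rewrite r_gt0 ge_min lexx orbT /= in Hb.
have {}Ha := Ha isT; have {}Hb := Hb isT.
have h_gt0 : 0 < h by rewrite /h; lra.
(* The first bound pays [c * (1 + h)] out of a quarter of the gap; the second makes the remaining
   decay rate at least [c]. *)
exists (Num.min (gap / (4 * (1 + h))) (r * gap / 4)).
  rewrite lt_min !divr_gt0 ?mulr_gt0 //; lra.
move=> c /andP[c_gt0]; rewrite le_min => /andP[c1 c2] I J IJ.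
set n : R := #|J|%:R in IJ *.
have n_ge0 : 0 <= n by rewrite ler0n.
apply: (@le_trans _ _ (\E_(F ~ prodp (fun _ : J => P))
  \E_(o ~ prodp (fun _ : I => src)) (expR (r * (c * n)) *
    (\prod_i expR (r * - ln (sg (o i)))) *
    (\prod_j expR (r * - ln (K (F j) / D (F j))))))).
  apply: ler_Ex_supp => [F|F F_gt0]; first exact: prodp_ge0.
  apply: ler_Ex_supp => [o|o o_gt0]; first exact: prodp_ge0.
  have {F_gt0} PF := prodp_gt0_supp (fun _ => P_ge0) F_gt0.
  have {o_gt0} so := prodp_gt0_supp (fun _ => src_ge0) o_gt0.
  case: (boolP (_ * \prod_j D (F j) <= _)) => /= [_|]; first by
    rewrite !mulr_ge0 ?expR_ge0 // prodr_ge0 // => *; rewrite expR_ge0.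
  rewrite -ltNge => lt.
  rewrite -!expR_sum -!mulr_sumr !sumrN -!expRD -[1]expR0 ler_expR.
  rewrite !mulrN -!mulrBr mulr_ge0 ?(ltW r_gt0) //.
  suff : \sum_i ln (sg (o i)) + \sum_j ln (K (F j) / D (F j)) < c * n by lra.
  rewrite -ltr_expR expRD !expR_sum.
  under eq_bigr => i _ do rewrite lnK ?posrE ?sg_gt0 //.
  have lnKD j : expR (ln (K (F j) / D (F j))) = K (F j) / D (F j).
    by have [K0 D0] := KD_gt0 _ (PF j); rewrite lnK // posrE divr_gt0.
  rewrite [X in _ * X](eq_bigr (fun j => K (F j) / D (F j))) => [|j _]; last first.
    exact: lnKD.
  rewrite prodf_div mulrA ltr_pdivrMr; last first.
    by apply: prodr_gt0 => j _; case: (KD_gt0 _ (PF j)).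
  by rewrite mulrC.
under eq_Ex => F do rewrite ExZr ExZl
  (Ex_prodp_prod (fun=> src) (fun _ x => expR (r * - ln (sg x)))).
rewrite ExZl (Ex_prodp_prod (fun=> P) (fun _ x => expR (r * - ln (K x / D x)))).
rewrite !prodr_const /=.
apply: (@le_trans _ _ (expR (r * (c * n)) * expR (r * h) ^+ #|I| *
                       expR (r * - i1) ^+ #|J|)).
  apply: ler_pM; rewrite ?mulr_ge0 ?exprn_ge0 ?expR_ge0 //.
  - by apply: Ex_ge0 => // x; apply: expR_ge0.
  - by apply: Ex_ge0 => // x; apply: expR_ge0.
  - rewrite ler_pM2l ?expR_gt0 // lerXn2r ?nnegrE ?expR_ge0 //.
    by apply: Ex_ge0 => // x; apply: expR_ge0.
  rewrite lerXn2r ?nnegrE ?expR_ge0 //.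
  by apply: Ex_ge0 => // x; apply: expR_ge0.
rewrite -!expRM_natr -!expRD ler_expR -/n.
have hI : h * #|I|%:R <= h * ((kappa^-1 + c) * n) by rewrite ler_pM2l.
have hk : h / kappa = i1 - gap / 2.
  rewrite /h /i1 mulrDl mulrAC mulfV ?gt_eqF // mul1r /gap; lra.
have hI' : h * #|I|%:R <= (i1 - gap / 2) * n + h * c * n.
  by apply: le_trans hI _; rewrite -hk; lra.
have c1' : c * (1 + h) <= gap / 4.
  move: c1; rewrite ler_pdivlMr; last by lra.
  by lra.
have key : n * (c * (1 + h)) <= n * (gap / 4) by rewrite ler_wpM2l.
have key2 : n * c <= n * (r * gap / 4) by rewrite ler_wpM2l.
have : r * (c * n + h * #|I|%:R - i1 * n) <= r * (- (gap / 4) * n).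
  by rewrite ler_pM2l //; lra.
lra.
Qed.

End Chernoff.

(** * One-shot superposition block code *)

Section BlockCode.
Variables (R : realType) (V1 V2 X1 X2 X3 Y Y3 : finType).
Variables (pV1 : V1 -> R) (pX1 : V1 -> X1 -> R).
Variables (pV2 : V2 -> R) (pX2 : V2 -> X2 -> R) (pX3 : V1 -> V2 -> X3 -> R).
Variables (chY : X1 -> X2 -> X3 -> Y -> R) (chR : X1 -> X2 -> X3 -> Y3 -> R).
Hypothesis pV1_pmf : is_pmf pV1.
Hypothesis pX1_pmf : forall v, is_pmf (pX1 v).
Hypothesis pV2_pmf : is_pmf pV2.
Hypothesis pX2_pmf : forall v, is_pmf (pX2 v).
Hypothesis pX3_pmf : forall v1 v2, is_pmf (pX3 v1 v2).
Hypothesis chY_pmf : forall x1 x2 x3, is_pmf (chY x1 x2 x3).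
Hypothesis chR_pmf : forall x1 x2 x3, is_pmf (chR x1 x2 x3).

Definition avg_letters (T : finType) (ch : X1 -> X2 -> X3 -> T -> R)
    (f : V1 -> X1 -> V2 -> X2 -> X3 -> T -> R) : R :=
  \E_(v1 ~ pV1) \E_(x1 ~ pX1 v1) \E_(v2 ~ pV2) \E_(x2 ~ pX2 v2)
  \E_(x3 ~ pX3 v1 v2) \E_(y ~ ch x1 x2 x3) f v1 x1 v2 x2 x3 y.

Definition rden1 v1 x2 x3 y := \E_(x1 ~ pX1 v1) chR x1 x2 x3 y.
Definition rden2 v2 x1 x3 y := \E_(x2 ~ pX2 v2) chR x1 x2 x3 y.
Definition rden12 v1 v2 x3 y :=
  \E_(x1 ~ pX1 v1) \E_(x2 ~ pX2 v2) chR x1 x2 x3 y.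
Definition dden1 v2 x2 y :=
  \E_(v1 ~ pV1) \E_(x1 ~ pX1 v1) \E_(x3 ~ pX3 v1 v2) chY x1 x2 x3 y.
Definition dden2 v1 x1 y :=
  \E_(v2 ~ pV2) \E_(x2 ~ pX2 v2) \E_(x3 ~ pX3 v1 v2) chY x1 x2 x3 y.
Definition dden12 y :=
  \E_(v1 ~ pV1) \E_(x1 ~ pX1 v1) \E_(v2 ~ pV2) \E_(x2 ~ pX2 v2)
  \E_(x3 ~ pX3 v1 v2) chY x1 x2 x3 y.

(* [Ap] indexes the messages sent in the previous block, [Ac] the current ones. *)
Variables (Ap1 Ap2 Ac1 Ac2 W W3 : finType) (g : R).
Hypothesis g_gt0 : 0 < g.
Variables (rs1 rs2 rs12 : Ac1 -> Ac2 -> W3 -> R).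
Variables (ds1 ds2 ds12 : Ap1 -> Ap2 -> W -> R).
Hypothesis rs1_ge0 : forall m1 m2 w, 0 <= rs1 m1 m2 w.
Hypothesis rs2_ge0 : forall m1 m2 w, 0 <= rs2 m1 m2 w.
Hypothesis rs12_ge0 : forall m1 m2 w, 0 <= rs12 m1 m2 w.
Hypothesis rs1_le1 : forall m2 w, \sum_m1 rs1 m1 m2 w <= 1.
Hypothesis rs2_le1 : forall m1 w, \sum_m2 rs2 m1 m2 w <= 1.
Hypothesis rs12_le1 : forall w, \sum_m1 \sum_m2 rs12 m1 m2 w <= 1.
Hypothesis ds1_ge0 : forall m1 m2 w, 0 <= ds1 m1 m2 w.
Hypothesis ds2_ge0 : forall m1 m2 w, 0 <= ds2 m1 m2 w.
Hypothesis ds12_ge0 : forall m1 m2 w, 0 <= ds12 m1 m2 w.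
Hypothesis ds1_le1 : forall m2 w, \sum_m1 ds1 m1 m2 w <= 1.
Hypothesis ds2_le1 : forall m1 w, \sum_m2 ds2 m1 m2 w <= 1.
Hypothesis ds12_le1 : forall w, \sum_m1 \sum_m2 ds12 m1 m2 w <= 1.

(* A letter of the superposition codebook: the cloud centre [v] selected by the
   previous message and the satellites selected by each current message. *)
Notation U1 := (V1 * {ffun Ac1 -> X1})%type.
Notation U2 := (V2 * {ffun Ac2 -> X2})%type.

Definition cloud1 (u : U1) : R := pV1 u.1 * prodp (fun _ : Ac1 => pX1 u.1) u.2.
Definition cloud2 (u : U2) : R := pV2 u.1 * prodp (fun _ : Ac2 => pX2 u.1) u.2.

Definition cloud3 (u1 : U1) (u2 : U2) := pX3 u1.1 u2.1.
(** The current messages [b1], [b2] are known to the backward decoder and select which satellites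
    enter the channel. *)
Definition cloud_ch b1 b2 (u1 : U1) (u2 : U2) := chY (u1.2 b1) (u2.2 b2).

Lemma cloud1_pmf : is_pmf cloud1.
Proof. exact: (pmf_pair pV1_pmf (fun v => prodp_pmf (fun=> pX1_pmf v))). Qed.

Lemma cloud2_pmf : is_pmf cloud2.
Proof. exact: (pmf_pair pV2_pmf (fun v => prodp_pmf (fun=> pX2_pmf v))). Qed.

Lemma Ex_cloud1 b (f : V1 -> X1 -> R) :
  \E_(u ~ cloud1) f u.1 (u.2 b) = \E_(v ~ pV1) \E_(x ~ pX1 v) f v x.
Proof.
rewrite [LHS](Ex_pair pV1 (fun v => prodp (fun=> pX1 v))) /=.
by apply: eq_Ex => v; rewrite Ex_prodp1.
Qed.

Lemma Ex_cloud2 b (f : V2 -> X2 -> R) :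
  \E_(u ~ cloud2) f u.1 (u.2 b) = \E_(v ~ pV2) \E_(x ~ pX2 v) f v x.
Proof.
rewrite [LHS](Ex_pair pV2 (fun v => prodp (fun=> pX2 v))) /=.
by apply: eq_Ex => v; rewrite Ex_prodp1.
Qed.

(** The centres and [x3] are known here. The unknown codewords are the satellites in [u1.2] and
    [u2.2], and the third codeword degenerates to the point of [unit]. *)
Definition relay_dec (u1 : U1) (u2 : U2) x3 (y : Y3) (w : W3) :=
  mac_dec (pX1 u1.1) (pX2 u2.1) (fun _ _ (_ : unit) => 1)
    (fun x1 x2 _ => chR x1 x2 x3) rs1 rs2 rs12 g u1.2 u2.2 (fun=> tt) y w.

(** A codeword here is a whole cloud letter, centre and all satellites, and [x3] is the third
    codeword. *)
Definition dest_dec (c1 : Ap1 -> U1) (c2 : Ap2 -> U2) (c3 : Ap1 * Ap2 -> X3)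
    b1 b2 (y : Y) (w : W) :=
  mac_dec cloud1 cloud2 cloud3
    (cloud_ch b1 b2) ds1 ds2 ds12 g c1 c2 c3 y w.

Definition relay_fail b1 b2 w v1 x1 v2 x2 x3 y : R :=
  (~~ (g * rden1 v1 x2 x3 y <= chR x1 x2 x3 y * rs1 b1 b2 w)%R)%:R +
  (~~ (g * rden2 v2 x1 x3 y <= chR x1 x2 x3 y * rs2 b1 b2 w)%R)%:R +
  (~~ (g * rden12 v1 v2 x3 y <= chR x1 x2 x3 y * rs12 b1 b2 w)%R)%:R.

Definition dest_fail m1 m2 w v1 x1 v2 x2 x3 y : R :=
  (~~ (g * dden1 v2 x2 y <= chY x1 x2 x3 y * ds1 m1 m2 w)%R)%:R +
  (~~ (g * dden2 v1 x1 y <= chY x1 x2 x3 y * ds2 m1 m2 w)%R)%:R +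
  (~~ (g * dden12 y <= chY x1 x2 x3 y * ds12 m1 m2 w)%R)%:R.

Definition block_avg (f : (Ap1 -> U1) -> (Ap2 -> U2) -> (Ap1 * Ap2 -> X3) -> R) :=
  mac_avg cloud1 cloud2 cloud3 f.

Variables (Oc Op : finType) (pc : Oc -> R) (pp : Op -> R).
Variables (bc1 : Oc -> Ac1) (bc2 : Oc -> Ac2) (wc : Oc -> W3).
Variables (mp1 : Op -> Ap1) (mp2 : Op -> Ap2) (wp : Op -> W).
Hypothesis pc_pmf : is_pmf pc.
Hypothesis pp_pmf : is_pmf pp.

Lemma dest_random_coding b1 b2 :
  block_avg (fun c1 c2 c3 => \E_(o ~ pp)
    \E_(y ~ chY ((c1 (mp1 o)).2 b1) ((c2 (mp2 o)).2 b2) (c3 (mp1 o, mp2 o)))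
      (dest_dec c1 c2 c3 b1 b2 y (wp o) != Some (mp1 o, mp2 o))%:R) <=
  \E_(o ~ pp) avg_letters chY (dest_fail (mp1 o) (mp2 o) (wp o)) + 3 / g.
Proof.
apply: le_trans (mac_random_coding _ _ _ pp_pmf cloud1_pmf cloud2_pmf
  (fun u1 u2 : _ * _ => pX3_pmf u1.1 u2.1)
  (fun u1 u2 : _ * {ffun _ -> _} => chY_pmf (u1.2 b1) (u2.2 b2)) g_gt0
  ds1_ge0 ds2_ge0 ds12_ge0 ds1_le1 ds2_le1 ds12_le1) _.
rewrite lerD2r; apply: eq_ler; apply: eq_Ex => o.
refine (etrans _ (Ex_cloud1 b1 (fun v1 x1 => \E_(v2 ~ pV2) \E_(x2 ~ pX2 v2)
  \E_(x3 ~ pX3 v1 v2) \E_(y ~ chY x1 x2 x3)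
  dest_fail (mp1 o) (mp2 o) (wp o) v1 x1 v2 x2 x3 y))).
apply: eq_Ex => u1.
refine (etrans _ (Ex_cloud2 b2 (fun v2 x2 => \E_(x3 ~ pX3 u1.1 v2)
  \E_(y ~ chY (u1.2 b1) x2 x3)
  dest_fail (mp1 o) (mp2 o) (wp o) u1.1 (u1.2 b1) v2 x2 x3 y))).
apply: eq_Ex => u2; apply: eq_Ex => x3; apply: eq_Ex => y.
have D1 : mac_den1 cloud1 cloud3
    (cloud_ch b1 b2) u2 y = dden1 u2.1 (u2.2 b2) y.
  exact: (Ex_cloud1 b1 (fun v1 x1 => \E_(x3 ~ pX3 v1 u2.1)
    chY x1 (u2.2 b2) x3 y)).
have D2 : mac_den2 cloud2 cloud3
    (cloud_ch b1 b2) u1 y = dden2 u1.1 (u1.2 b1) y.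
  exact: (Ex_cloud2 b2 (fun v2 x2 => \E_(x3 ~ pX3 u1.1 v2)
    chY (u1.2 b1) x2 x3 y)).
have D12 : mac_den12 cloud1 cloud2 cloud3
    (cloud_ch b1 b2) y = dden12 y.
  refine (etrans _ (Ex_cloud1 b1 (fun v1 x1 => \E_(v2 ~ pV2) \E_(x2 ~ pX2 v2)
    \E_(x3 ~ pX3 v1 v2) chY x1 x2 x3 y))).
  apply: eq_Ex => u1'; exact: (Ex_cloud2 b2 (fun v2 x2 =>
    \E_(x3 ~ pX3 u1'.1 v2) chY (u1'.2 b1) x2 x3 y)).
by rewrite /mac_fail /mac_test1 /mac_test2 /mac_test12 D1 D2 D12.
Qed.

(** With the previous messages fixed, their centres and [x3] can be drawn first; given those, the
    satellites form a plain two-user random code. *)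
Lemma relay_random_coding m1 m2 :
  block_avg (fun c1 c2 c3 => \E_(o ~ pc)
    \E_(y ~ chR ((c1 m1).2 (bc1 o)) ((c2 m2).2 (bc2 o)) (c3 (m1, m2)))
      (relay_dec (c1 m1) (c2 m2) (c3 (m1, m2)) y (wc o)
         != Some (bc1 o, bc2 o))%:R) <=
  \E_(o ~ pc) avg_letters chR (relay_fail (bc1 o) (bc2 o) (wc o)) + 3 / g.
Proof.
rewrite /block_avg (mac_avg1 cloud1_pmf cloud2_pmf (fun u1 u2 : _ * _ => pX3_pmf u1.1 u2.1)
  m1 m2 (fun u1 u2 x3 => \E_(o ~ pc) \E_(y ~ chR (u1.2 (bc1 o)) (u2.2 (bc2 o)) x3)
      (relay_dec u1 u2 x3 y (wc o) != Some (bc1 o, bc2 o))%:R)).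
pose avgu v1 v2 x3 := mac_avg (pX1 v1) (pX2 v2) (fun _ _ (_ : unit) => 1)
  (fun c1 c2 (c3 : Ac1 * Ac2 -> unit) => \E_(o ~ pc)
    \E_(y ~ chR (c1 (bc1 o)) (c2 (bc2 o)) x3)
    (mac_dec (pX1 v1) (pX2 v2) (fun _ _ (_ : unit) => 1)
      (fun x1 x2 _ => chR x1 x2 x3) rs1 rs2 rs12 g c1 c2 c3 y (wc o)
         != Some (bc1 o, bc2 o))%:R).
have unit_pmf : is_pmf (fun _ : unit => 1 : R).
  by split=> [_|]; rewrite ?ler01 // (big_pred1 tt) // => -[].
rewrite (_ : Ex cloud1 _ = \E_(v1 ~ pV1) \E_(v2 ~ pV2) \E_(x3 ~ pX3 v1 v2)
    avgu v1 v2 x3); last first.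
  rewrite [LHS](Ex_pair pV1 (fun v => prodp (fun=> pX1 v))).
  apply: eq_Ex => v1.
  transitivity (\E_(c1 ~ prodp (fun _ : Ac1 => pX1 v1)) \E_(v2 ~ pV2)
    \E_(c2 ~ prodp (fun _ : Ac2 => pX2 v2)) \E_(x3 ~ pX3 v1 v2)
    \E_(o ~ pc) \E_(y ~ chR (c1 (bc1 o)) (c2 (bc2 o)) x3)
      (relay_dec (v1, c1) (v2, c2) x3 y (wc o) != Some (bc1 o, bc2 o))%:R).
    apply: eq_Ex => c1.
    by rewrite [LHS](Ex_pair pV2 (fun v => prodp (fun=> pX2 v))).
  rewrite Ex_swap; apply: eq_Ex => v2.
  under eq_Ex => c1 do rewrite Ex_swap.
  rewrite Ex_swap; apply: eq_Ex => x3; apply: eq_Ex => c1; apply: eq_Ex => c2.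
  rewrite -[LHS](Ex_cst _ (prodp_pmf (fun _ : Ac1 * Ac2 => unit_pmf))).
  by apply: eq_Ex => c3.
apply: (@le_trans _ _ (\E_(v1 ~ pV1) \E_(v2 ~ pV2) \E_(x3 ~ pX3 v1 v2)
  (\E_(o ~ pc) \E_(x1 ~ pX1 v1) \E_(x2 ~ pX2 v2) \E_(y ~ chR x1 x2 x3)
     relay_fail (bc1 o) (bc2 o) (wc o) v1 x1 v2 x2 x3 y + 3 / g))).
  apply: ler_Ex => [|v1]; first by case: pV1_pmf.
  apply: ler_Ex => [|v2]; first by case: pV2_pmf.
  apply: ler_Ex => [|x3]; first by case: (pX3_pmf v1 v2).
  apply: le_trans (mac_random_coding bc1 bc2 wc pc_pmf (pX1_pmf v1) (pX2_pmf v2)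
    (fun _ _ => unit_pmf) (fun x1 x2 _ => chR_pmf x1 x2 x3) g_gt0
    rs1_ge0 rs2_ge0 rs12_ge0 rs1_le1 rs2_le1 rs12_le1) _.
  rewrite lerD2r; apply: eq_ler; apply: eq_Ex => o.
  apply: eq_Ex => x1; apply: eq_Ex => x2.
  refine (etrans _ (Ex_cst _ unit_pmf)); apply: eq_Ex => -[]; apply: eq_Ex => y.
  have D1 : mac_den1 (pX1 v1) (fun _ _ (_ : unit) => 1)
      (fun x1 x2 _ => chR x1 x2 x3) x2 y = rden1 v1 x2 x3 y.
    by apply: eq_Ex => x1'; rewrite Ex_cst.
  have D2 : mac_den2 (pX2 v2) (fun _ _ (_ : unit) => 1)
      (fun x1 x2 _ => chR x1 x2 x3) x1 y = rden2 v2 x1 x3 y.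
    by apply: eq_Ex => x2'; rewrite Ex_cst.
  have D12 : mac_den12 (pX1 v1) (pX2 v2) (fun _ _ (_ : unit) => 1)
      (fun x1 x2 _ => chR x1 x2 x3) y = rden12 v1 v2 x3 y.
    by apply: eq_Ex => x1'; apply: eq_Ex => x2'; rewrite Ex_cst.
  by rewrite /mac_fail /mac_test1 /mac_test2 /mac_test12 D1 D2 D12.
apply: eq_ler.
under eq_Ex => v1 do under eq_Ex => v2 do rewrite ExD Ex_cst //.
under eq_Ex => v1 do rewrite ExD Ex_cst //.
rewrite ExD Ex_cst //; congr (_ + _).
under eq_Ex => v1 do under eq_Ex => v2 do rewrite Ex_swap.
under eq_Ex => v1 do rewrite Ex_swap.
rewrite Ex_swap; apply: eq_Ex => o; apply: eq_Ex => v1.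
under eq_Ex => v2 do rewrite Ex_swap.
rewrite Ex_swap; apply: eq_Ex => x1; apply: eq_Ex => v2.
exact: Ex_swap.
Qed.

(** Both errors sit under one average, so that a single codebook can serve relay and destination
    simultaneously. *)
Theorem block_random_coding :
  block_avg (fun c1 c2 c3 =>
    (\E_(q ~ pp) \E_(o ~ pc)
       \E_(y ~ chR ((c1 (mp1 q)).2 (bc1 o)) ((c2 (mp2 q)).2 (bc2 o))
                   (c3 (mp1 q, mp2 q)))
         (relay_dec (c1 (mp1 q)) (c2 (mp2 q)) (c3 (mp1 q, mp2 q)) y (wc o)
            != Some (bc1 o, bc2 o))%:R) +
    (\E_(o ~ pc) \E_(q ~ pp)
       \E_(y ~ chY ((c1 (mp1 q)).2 (bc1 o)) ((c2 (mp2 q)).2 (bc2 o))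
                   (c3 (mp1 q, mp2 q)))
         (dest_dec c1 c2 c3 (bc1 o) (bc2 o) y (wp q)
            != Some (mp1 q, mp2 q))%:R)) <=
  \E_(o ~ pc) avg_letters chR (relay_fail (bc1 o) (bc2 o) (wc o)) +
  \E_(q ~ pp) avg_letters chY (dest_fail (mp1 q) (mp2 q) (wp q)) + 6 / g.
Proof.
set r := \E_(o ~ pc) _; set d := \E_(q ~ pp) _.
have -> : r + d + 6 / g = (r + 3 / g) + (d + 3 / g) by ring.
rewrite /block_avg mac_avgD lerD //.
  rewrite /mac_avg.
  under eq_Ex => c1 do under eq_Ex => c2 do rewrite Ex_swap.
  under eq_Ex => c1 do rewrite Ex_swap.
  rewrite Ex_swap -[leRHS](Ex_cst _ pp_pmf).
  by apply: ler_Ex => [|q]; [case: pp_pmf|apply: relay_random_coding].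
rewrite /mac_avg.
under eq_Ex => c1 do under eq_Ex => c2 do rewrite Ex_swap.
under eq_Ex => c1 do rewrite Ex_swap.
rewrite Ex_swap -[leRHS](Ex_cst _ pc_pmf).
by apply: ler_Ex => [|o]; [case: pc_pmf|apply: dest_random_coding].
Qed.

(** The law of [c3] depends on [c1] and [c2], which are therefore fixed before it. *)
Lemma block_avg_exists f (c : R) : block_avg f <= c -> exists
  (c1 : {ffun Ap1 -> U1}) (c2 : {ffun Ap2 -> U2}) (c3 : {ffun Ap1 * Ap2 -> X3}),
  f c1 c2 c3 <= c.
Proof.
case/(Ex_le_exists (prodp_pmf (fun=> cloud1_pmf))) => c1.
case/(Ex_le_exists (prodp_pmf (fun=> cloud2_pmf))) => c2.
case/(Ex_le_exists (prodp_pmf (fun m => pX3_pmf (c1 m.1).1 (c2 m.2).1))) => c3.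
by exists c1, c2, c3.
Qed.

End BlockCode.

(** * Product alphabets *)

Section Letters.
Variables (R : realType) (V1 V2 X1 X2 X3 T : finType).
Variables (pV1 : V1 -> R) (pX1 : V1 -> X1 -> R).
Variables (pV2 : V2 -> R) (pX2 : V2 -> X2 -> R) (pX3 : V1 -> V2 -> X3 -> R).
Variable (ch : X1 -> X2 -> X3 -> T -> R).
Hypothesis pV1_pmf : is_pmf pV1.
Hypothesis pX1_pmf : forall v, is_pmf (pX1 v).
Hypothesis pV2_pmf : is_pmf pV2.
Hypothesis pX2_pmf : forall v, is_pmf (pX2 v).
Hypothesis pX3_pmf : forall v1 v2, is_pmf (pX3 v1 v2).
Hypothesis ch_pmf : forall x1 x2 x3, is_pmf (ch x1 x2 x3).

Definition letter : finType := (V1 * X1 * V2 * X2 * X3 * T)%type.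

Definition letter_law (u : letter) : R :=
  let: (v1, x1, v2, x2, x3, y) := u in
  pV1 v1 * pX1 v1 x1 * pV2 v2 * pX2 v2 x2 * pX3 v1 v2 x3 * ch x1 x2 x3 y.

Definition on_letter (A : Type) (f : V1 -> X1 -> V2 -> X2 -> X3 -> T -> A)
    (u : letter) : A :=
  let: (v1, x1, v2, x2, x3, y) := u in f v1 x1 v2 x2 x3 y.

Definition vecX1 (J : finType) (v : {ffun J -> V1}) : {ffun J -> X1} -> R :=
  prodp (fun j => pX1 (v j)).
Definition vecX2 (J : finType) (v : {ffun J -> V2}) : {ffun J -> X2} -> R :=
  prodp (fun j => pX2 (v j)).
Definition vecX3 (J : finType) (v1 : {ffun J -> V1}) (v2 : {ffun J -> V2}) :
    {ffun J -> X3} -> R := prodp (fun j => pX3 (v1 j) (v2 j)).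
Definition vec_ch (J : finType) (x1 : {ffun J -> X1}) (x2 : {ffun J -> X2})
    (x3 : {ffun J -> X3}) : {ffun J -> T} -> R :=
  prodp (fun j => ch (x1 j) (x2 j) (x3 j)).

Lemma avg_lettersE f :
  avg_letters pV1 pX1 pV2 pX2 pX3 ch f = Ex letter_law (on_letter f).
Proof.
pose P2 (u : V1 * X1) := pV1 u.1 * pX1 u.1 u.2.
pose P3 (u : V1 * X1 * V2) := P2 u.1 * pV2 u.2.
pose q4 (u : V1 * X1 * V2) := pX2 u.2.
pose P4 (u : V1 * X1 * V2 * X2) := P3 u.1 * q4 u.1 u.2.
pose q5 (u : V1 * X1 * V2 * X2) := pX3 u.1.1.1 u.1.2.
pose P5 (u : V1 * X1 * V2 * X2 * X3) := P4 u.1 * q5 u.1 u.2.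
pose q6 (u : V1 * X1 * V2 * X2 * X3) := ch u.1.1.1.2 u.1.2 u.2.
transitivity (Ex (fun u => P5 u.1 * q6 u.1 u.2) (on_letter f)); last first.
  by apply: eq_Exl => -[[[[[v1 x1] v2] x2] x3] y].
rewrite Ex_pair (Ex_pair P4 q5) (Ex_pair P3 q4) (Ex_pair P2 (fun=> pV2)).
by rewrite (Ex_pair pV1 pX1).
Qed.

Lemma letter_law_pmf : is_pmf letter_law.
Proof.
split=> [[[[[[v1 x1] v2] x2] x3] y]|]; first by
  rewrite !mulr_ge0 //; [case: pV1_pmf|case: (pX1_pmf v1)|case: pV2_pmf|
    case: (pX2_pmf v2)|case: (pX3_pmf v1 v2)|case: (ch_pmf x1 x2 x3)].
transitivity (Ex letter_law (on_letter (fun _ _ _ _ _ _ => 1))).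
  by apply: eq_bigr => -[[[[[v1 x1] v2] x2] x3] y] _; rewrite mulr1.
rewrite -avg_lettersE -[RHS](Ex_cst 1 pV1_pmf); apply: eq_Ex => v1.
rewrite -[RHS](Ex_cst 1 (pX1_pmf v1)); apply: eq_Ex => x1.
rewrite -[RHS](Ex_cst 1 pV2_pmf); apply: eq_Ex => v2.
rewrite -[RHS](Ex_cst 1 (pX2_pmf v2)); apply: eq_Ex => x2.
rewrite -[RHS](Ex_cst 1 (pX3_pmf v1 v2)); apply: eq_Ex => x3.
by rewrite Ex_cst.
Qed.

(** Each stage of the draw is independent across [J] given the earlier stages, so the stages merge
    one by one into an i.i.d. sequence of complete letters. *)
Lemma avg_letters_vec (J : finType)
    (f : {ffun J -> V1} -> {ffun J -> X1} -> {ffun J -> V2} -> {ffun J -> X2} ->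
         {ffun J -> X3} -> {ffun J -> T} -> R) :
  avg_letters (prodp (fun=> pV1)) (@vecX1 J) (prodp (fun=> pV2)) (@vecX2 J)
    (@vecX3 J) (@vec_ch J) f =
  \E_(F ~ prodp (fun=> letter_law))
    f [ffun j => (F j).1.1.1.1.1] [ffun j => (F j).1.1.1.1.2]
      [ffun j => (F j).1.1.1.2] [ffun j => (F j).1.1.2] [ffun j => (F j).1.2]
      [ffun j => (F j).2].
Proof.
rewrite /avg_letters /vecX1 /vecX2 /vecX3 /vec_ch.
rewrite (@Ex_prodp_dep _ _ _ _ _ (pX1)) //.
rewrite (@Ex_prodp_dep _ _ _ _ _ (fun=> pV2)) //.
rewrite (@Ex_prodp_dep _ _ _ _ _ (fun u => pX2 u.2)); last by
  move=> G k x; rewrite !ffunE.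
rewrite (@Ex_prodp_dep _ _ _ _ _ (fun u => pX3 u.1.1.1 u.1.2)); last by
  move=> G k x; rewrite !ffunE.
rewrite (@Ex_prodp_dep _ _ _ _ _ (fun u => ch u.1.1.1.2 u.1.2 u.2)); last by
  move=> G k x; rewrite !ffunE.
rewrite [LHS](@eq_Exl _ _ _ (prodp (fun=> letter_law))).
  by apply: eq_Ex => F; congr (f _ _ _ _ _ _); apply/ffunP => j; rewrite !ffunE.
move=> F; apply: eq_bigr => j _.
by case: (F j) => -[[[[v1 x1] v2] x2] x3] y.
Qed.

Variables (S : finType) (src sg : S -> R) (kappa : R).
Variable (D : V1 -> X1 -> V2 -> X2 -> X3 -> T -> R).

(** A rate condition in nats: the first expectation will be a conditional entropy, the averaged
    log-ratio a mutual information. Positivity of [sg] on the support keeps its logarithm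
    meaningful. *)
Definition test_cond : Prop :=
  [/\ forall s, 0 < src s -> 0 < sg s,
      0 <= \E_(s ~ src) - ln (sg s)
    & \E_(s ~ src) - ln (sg s) <
      kappa * avg_letters pV1 pX1 pV2 pX2 pX3 ch
        (fun v1 x1 v2 x2 x3 y => ln (ch x1 x2 x3 y / D v1 x1 v2 x2 x3 y))].

Lemma vec_threshold_exponent :
  is_pmf src -> 0 < kappa ->
  test_cond ->
  (forall v1 x1 v2 x2 x3 y, 0 < pV1 v1 -> 0 < pX1 v1 x1 -> 0 < pV2 v2 ->
     0 < pX2 v2 x2 -> 0 < pX3 v1 v2 x3 -> 0 < ch x1 x2 x3 y ->
     0 < D v1 x1 v2 x2 x3 y) ->
  exists2 c0, 0 < c0 & forall c, 0 < c <= c0 -> forall I J : finType,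
    #|I|%:R <= (kappa^-1 + c) * #|J|%:R ->
    \E_(o ~ prodp (fun _ : I => src))
    avg_letters (prodp (fun=> pV1)) (@vecX1 J) (prodp (fun=> pV2)) (@vecX2 J)
      (@vecX3 J) (@vec_ch J) (fun v1 x1 v2 x2 x3 y =>
      (~~ (expR (c * #|J|%:R) *
             \prod_j D (v1 j) (x1 j) (v2 j) (x2 j) (x3 j) (y j) <=
           vec_ch x1 x2 x3 y * \prod_i sg (o i))%R)%:R)
    <= expR (- (c * #|J|%:R)).
Proof.
move=> src_pmf kappa_gt0 [sg_gt0 H0 H] D_gt0; rewrite avg_lettersE in H.
have law_gt0 u : 0 < letter_law u ->
    0 < on_letter (fun _ x1 _ x2 x3 y => ch x1 x2 x3 y) u /\
    0 < on_letter D u.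
  case: u => -[[[[v1 x1] v2] x2] x3] y /=.
  have := (ch_pmf x1 x2 x3).1 y; have := (pX3_pmf v1 v2).1 x3.
  have := (pX2_pmf v2).1 x2; have := pV2_pmf.1 v2.
  have := (pX1_pmf v1).1 x1; have := pV1_pmf.1 v1.
  rewrite !le0r; do 6 (case/predU1P => [->|?];
    first by rewrite ?(mul0r, mulr0) ltxx).
  by split=> //; apply: D_gt0.
case: (threshold_exponent letter_law_pmf src_pmf kappa_gt0 law_gt0 sg_gt0 H0).
  rewrite (@eq_Ex _ _ _ _ (on_letter
    (fun v1 x1 v2 x2 x3 y => ln (ch x1 x2 x3 y / D v1 x1 v2 x2 x3 y)))) //.
  by case=> -[[[[v1 x1] v2] x2] x3] y.
move=> c0 c0_gt0 Hc0; exists c0 => // c cc0 I J IJ.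
apply: le_trans (Hc0 c cc0 I J IJ); rewrite [leRHS]Ex_swap.
apply: eq_ler; apply: eq_Ex => o.
rewrite avg_letters_vec; apply: eq_Ex => F.
congr (~~ (_ * _ <= _ * _)%R)%:R; apply: eq_bigr => j _; rewrite !ffunE;
  by case: (F j) => -[[[[v1 x1] v2] x2] x3] y.
Qed.

End Letters.

(** * Vector block codes built from single-letter tests *)

Section VectorBlock.
Variables (R : realType) (S1 S2 W3 W V1 V2 X1 X2 X3 Y Y3 : finType).
Variables (pV1 : V1 -> R) (pX1 : V1 -> X1 -> R).
Variables (pV2 : V2 -> R) (pX2 : V2 -> X2 -> R) (pX3 : V1 -> V2 -> X3 -> R).
Variables (chY : X1 -> X2 -> X3 -> Y -> R) (chR : X1 -> X2 -> X3 -> Y3 -> R).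
Variables (src : S1 * S2 * W3 * W -> R) (kappa : R).
Hypothesis pV1_pmf : is_pmf pV1.
Hypothesis pX1_pmf : forall v, is_pmf (pX1 v).
Hypothesis pV2_pmf : is_pmf pV2.
Hypothesis pX2_pmf : forall v, is_pmf (pX2 v).
Hypothesis pX3_pmf : forall v1 v2, is_pmf (pX3 v1 v2).
Hypothesis chY_pmf : forall x1 x2 x3, is_pmf (chY x1 x2 x3).
Hypothesis chR_pmf : forall x1 x2 x3, is_pmf (chR x1 x2 x3).
Hypothesis src_pmf : is_pmf src.
Hypothesis kappa_gt0 : 0 < kappa.

Definition vec_s1 (I : finType) (o : {ffun I -> S1 * S2 * W3 * W}) :=
  [ffun i => (o i).1.1.1].
Definition vec_s2 (I : finType) (o : {ffun I -> S1 * S2 * W3 * W}) :=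
  [ffun i => (o i).1.1.2].
Definition vec_w3 (I : finType) (o : {ffun I -> S1 * S2 * W3 * W}) :=
  [ffun i => (o i).1.2].
Definition vec_w (I : finType) (o : {ffun I -> S1 * S2 * W3 * W}) :=
  [ffun i => (o i).2].

(** The index types are arbitrary finite types so that one notion covers all blocks: the first has
    no previous letters and the last no current ones. *)
Record block_code (Ip Ic J : finType) := BlockCode {
  blk_x1 : {ffun Ip -> S1} -> {ffun Ic -> S1} -> {ffun J -> X1};
  blk_x2 : {ffun Ip -> S2} -> {ffun Ic -> S2} -> {ffun J -> X2};
  blk_x3 : {ffun Ip -> S1} -> {ffun Ip -> S2} -> {ffun J -> X3};
  blk_rdec : {ffun Ip -> S1} -> {ffun Ip -> S2} -> {ffun J -> Y3} ->
             {ffun Ic -> W3} -> {ffun Ic -> S1} * {ffun Ic -> S2};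
  blk_ddec : {ffun Ic -> S1} -> {ffun Ic -> S2} -> {ffun J -> Y} ->
             {ffun Ip -> W} -> {ffun Ip -> S1} * {ffun Ip -> S2}
}.

Definition block_in (T Ip Ic J : finType) (c : block_code Ip Ic J)
    (ch : X1 -> X2 -> X3 -> T -> R) q o :=
  vec_ch ch (blk_x1 c (vec_s1 q) (vec_s1 o)) (blk_x2 c (vec_s2 q) (vec_s2 o))
            (blk_x3 c (vec_s1 q) (vec_s2 q)).

Definition block_rerr (Ip Ic J : finType) (c : block_code Ip Ic J) : R :=
  \E_(q ~ prodp (fun=> src)) \E_(o ~ prodp (fun=> src)) \E_(y ~ block_in c chR q o)
    (blk_rdec c (vec_s1 q) (vec_s2 q) y (vec_w3 o) != (vec_s1 o, vec_s2 o))%:R.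

Definition block_derr (Ip Ic J : finType) (c : block_code Ip Ic J) : R :=
  \E_(q ~ prodp (fun=> src)) \E_(o ~ prodp (fun=> src)) \E_(y ~ block_in c chY q o)
    (blk_ddec c (vec_s1 o) (vec_s2 o) y (vec_w q) != (vec_s1 q, vec_s2 q))%:R.

Lemma avg_lettersD (U1 U2 U3 U4 U5 U6 : finType) (p1 : U1 -> R) p2
    (p3 : U3 -> R) p4 p5 (ch : U2 -> U4 -> U5 -> U6 -> R) f f' :
  avg_letters p1 p2 p3 p4 p5 ch
    (fun v1 x1 v2 x2 x3 y => f v1 x1 v2 x2 x3 y + f' v1 x1 v2 x2 x3 y) =
  avg_letters p1 p2 p3 p4 p5 ch f + avg_letters p1 p2 p3 p4 p5 ch f'.
Proof.
rewrite -ExD; apply: eq_Ex => v1; rewrite -ExD; apply: eq_Ex => x1.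
rewrite -ExD; apply: eq_Ex => v2; rewrite -ExD; apply: eq_Ex => x2.
by rewrite -ExD; apply: eq_Ex => x3; rewrite -ExD.
Qed.

Lemma eq_avg_letters (U1 U2 U3 U4 U5 U6 : finType) (p1 : U1 -> R) p2
    (p3 : U3 -> R) p4 p5 (ch : U2 -> U4 -> U5 -> U6 -> R) f f' :
  (forall v1 x1 v2 x2 x3 y, f v1 x1 v2 x2 x3 y = f' v1 x1 v2 x2 x3 y) ->
  avg_letters p1 p2 p3 p4 p5 ch f = avg_letters p1 p2 p3 p4 p5 ch f'.
Proof.
move=> ff'; apply: eq_Ex => v1; apply: eq_Ex => x1; apply: eq_Ex => v2.
by apply: eq_Ex => x2; apply: eq_Ex => x3; apply: eq_Ex => y.
Qed.

Section Densities.
Variable J : finType.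

Lemma rden1_vec v1 x2 x3 y :
  rden1 (vecX1 pX1 (J := J)) (vec_ch chR (J := J)) v1 x2 x3 y =
  \prod_j rden1 pX1 chR (v1 j) (x2 j) (x3 j) (y j).
Proof. exact: Ex_prodp_prod. Qed.

Lemma rden2_vec v2 x1 x3 y :
  rden2 (vecX2 pX2 (J := J)) (vec_ch chR (J := J)) v2 x1 x3 y =
  \prod_j rden2 pX2 chR (v2 j) (x1 j) (x3 j) (y j).
Proof. exact: Ex_prodp_prod. Qed.

Lemma rden12_vec v1 v2 x3 y :
  rden12 (vecX1 pX1 (J := J)) (vecX2 pX2 (J := J)) (vec_ch chR (J := J))
    v1 v2 x3 y =
  \prod_j rden12 pX1 pX2 chR (v1 j) (v2 j) (x3 j) (y j).
Proof.
transitivity (\E_(x1 ~ vecX1 pX1 v1)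
  \prod_j rden2 pX2 chR (v2 j) (x1 j) (x3 j) (y j)).
  by apply: eq_Ex => x1; apply: rden2_vec.
exact: (Ex_prodp_prod _ (fun j x1 => rden2 pX2 chR (v2 j) x1 (x3 j) (y j))).
Qed.

Lemma dden1_vec v2 x2 y :
  dden1 (prodp (fun=> pV1)) (vecX1 pX1 (J := J)) (vecX3 pX3 (J := J))
    (vec_ch chY (J := J)) v2 x2 y =
  \prod_j dden1 pV1 pX1 pX3 chY (v2 j) (x2 j) (y j).
Proof.
pose f j v1 x1 := \E_(x3 ~ pX3 v1 (v2 j)) chY x1 (x2 j) x3 (y j).
transitivity (\E_(v1 ~ prodp (fun _ : J => pV1)) \prod_j \E_(x1 ~ pX1 (v1 j))
    f j (v1 j) x1); last first.
  exact: (Ex_prodp_prod _ (fun j v1 => \E_(x1 ~ pX1 v1) f j v1 x1)).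
apply: eq_Ex => v1.
transitivity (\E_(x1 ~ vecX1 pX1 v1) \prod_j f j (v1 j) (x1 j)); last first.
  exact: (Ex_prodp_prod _ (fun j x1 => f j (v1 j) x1)).
apply: eq_Ex => x1.
exact: (Ex_prodp_prod _ (fun j x3 => chY (x1 j) (x2 j) x3 (y j))).
Qed.

Lemma dden2_vec v1 x1 y :
  dden2 (prodp (fun=> pV2)) (vecX2 pX2 (J := J)) (vecX3 pX3 (J := J))
    (vec_ch chY (J := J)) v1 x1 y =
  \prod_j dden2 pV2 pX2 pX3 chY (v1 j) (x1 j) (y j).
Proof.
pose f j v2 x2 := \E_(x3 ~ pX3 (v1 j) v2) chY (x1 j) x2 x3 (y j).
transitivity (\E_(v2 ~ prodp (fun _ : J => pV2)) \prod_j \E_(x2 ~ pX2 (v2 j))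
    f j (v2 j) x2); last first.
  exact: (Ex_prodp_prod _ (fun j v2 => \E_(x2 ~ pX2 v2) f j v2 x2)).
apply: eq_Ex => v2.
transitivity (\E_(x2 ~ vecX2 pX2 v2) \prod_j f j (v2 j) (x2 j)); last first.
  exact: (Ex_prodp_prod _ (fun j x2 => f j (v2 j) x2)).
apply: eq_Ex => x2.
exact: (Ex_prodp_prod _ (fun j x3 => chY (x1 j) (x2 j) x3 (y j))).
Qed.

Lemma dden12_vec y :
  dden12 (prodp (fun=> pV1)) (vecX1 pX1 (J := J)) (prodp (fun=> pV2))
    (vecX2 pX2 (J := J)) (vecX3 pX3 (J := J)) (vec_ch chY (J := J)) y =
  \prod_j dden12 pV1 pX1 pV2 pX2 pX3 chY (y j).
Proof.
pose f j v1 x1 := dden2 pV2 pX2 pX3 chY v1 x1 (y j).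
transitivity (\E_(v1 ~ prodp (fun _ : J => pV1)) \prod_j \E_(x1 ~ pX1 (v1 j))
    f j (v1 j) x1); last first.
  exact: (Ex_prodp_prod _ (fun j v1 => \E_(x1 ~ pX1 v1) f j v1 x1)).
apply: eq_Ex => v1.
transitivity (\E_(x1 ~ vecX1 pX1 v1) \prod_j f j (v1 j) (x1 j)); last first.
  exact: (Ex_prodp_prod _ (fun j x1 => f j (v1 j) x1)).
by apply: eq_Ex => x1; apply: dden2_vec.
Qed.

End Densities.

Definition vec_sg (A B C I : finType) (sg : A -> B -> C -> R)
    (a : {ffun I -> A}) (b : {ffun I -> B}) (c : {ffun I -> C}) : R :=
  \prod_i sg (a i) (b i) (c i).

(** Masses are only required to be at most 1: with division by zero equal to zero, a posterior
    vanishes identically at a null conditioning letter. *)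
Definition cond_law3 (A B C : finType) (sg1 sg2 sg12 : A -> B -> C -> R) : Prop :=
  [/\ [/\ forall a b c, 0 <= sg1 a b c, forall a b c, 0 <= sg2 a b c
        & forall a b c, 0 <= sg12 a b c],
      forall b c, \sum_a sg1 a b c <= 1, forall a c, \sum_b sg2 a b c <= 1
    & forall c, \sum_a \sum_b sg12 a b c <= 1].

Lemma vec_cond_law3 (A B C : finType) (sg1 sg2 sg12 : A -> B -> C -> R)
    (I : finType) : cond_law3 sg1 sg2 sg12 ->
  cond_law3 (vec_sg sg1 (I := I)) (vec_sg sg2 (I := I)) (vec_sg sg12 (I := I)).
Proof.
case=> -[sg1_ge0 sg2_ge0 sg12_ge0] le1 le2 le12.
split; first by split=> a b c; apply: prodr_ge0.
- move=> b c; rewrite -(bigA_distr_bigA (fun i a => sg1 a (b i) (c i))).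
  by apply: prodr_ile1 => i _; rewrite le1 sumr_ge0.
- move=> a c; rewrite -(bigA_distr_bigA (fun i b => sg2 (a i) b (c i))).
  by apply: prodr_ile1 => i _; rewrite le2 sumr_ge0.
move=> c; have -> : \sum_a \sum_b vec_sg sg12 a b c =
    \sum_(a : {ffun I -> A}) \prod_i \sum_b sg12 (a i) b (c i).
  by apply: eq_bigr => a _; rewrite bigA_distr_bigA.
rewrite -(bigA_distr_bigA (fun i a => \sum_b sg12 a b (c i))).
by apply: prodr_ile1 => i _; rewrite le12 sumr_ge0 // => *; apply: sumr_ge0.
Qed.

Variables (rs1 rs2 rs12 : S1 -> S2 -> W3 -> R) (ds1 ds2 ds12 : S1 -> S2 -> W -> R).

Let rsrc (sg : S1 -> S2 -> W3 -> R) (s : S1 * S2 * W3 * W) :=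
  sg s.1.1.1 s.1.1.2 s.1.2.
Let dsrc (sg : S1 -> S2 -> W -> R) (s : S1 * S2 * W3 * W) :=
  sg s.1.1.1 s.1.1.2 s.2.
Let rtest sg D := test_cond pV1 pX1 pV2 pX2 pX3 chR src (rsrc sg) kappa D.
Let dtest sg D := test_cond pV1 pX1 pV2 pX2 pX3 chY src (dsrc sg) kappa D.

Definition relay_tests : Prop :=
  [/\ rtest rs1 (fun v1 x1 v2 x2 x3 y => rden1 pX1 chR v1 x2 x3 y),
      rtest rs2 (fun v1 x1 v2 x2 x3 y => rden2 pX2 chR v2 x1 x3 y)
    & rtest rs12 (fun v1 x1 v2 x2 x3 y => rden12 pX1 pX2 chR v1 v2 x3 y)].

Definition dest_tests : Prop :=
  [/\ dtest ds1 (fun v1 x1 v2 x2 x3 y => dden1 pV1 pX1 pX3 chY v2 x2 y),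
      dtest ds2 (fun v1 x1 v2 x2 x3 y => dden2 pV2 pX2 pX3 chY v1 x1 y)
    & dtest ds12 (fun v1 x1 v2 x2 x3 y => dden12 pV1 pX1 pV2 pX2 pX3 chY y)].

Theorem block_code_exists :
  cond_law3 rs1 rs2 rs12 -> cond_law3 ds1 ds2 ds12 ->
  relay_tests -> dest_tests ->
  exists2 c, 0 < c & forall Ip Ic J : finType,
    #|Ip|%:R <= (kappa^-1 + c) * #|J|%:R -> #|Ic|%:R <= (kappa^-1 + c) * #|J|%:R ->
    exists bc : block_code Ip Ic J,
      block_rerr bc + block_derr bc <= 12 * expR (- (c * #|J|%:R)).
Proof.
move=> rs_law ds_law [rt1 rt2 rt12] [dt1 dt2 dt12].
have pV1_0 := pV1_pmf.1; have pX1_0 v := (pX1_pmf v).1.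
have pV2_0 := pV2_pmf.1; have pX2_0 v := (pX2_pmf v).1.
have pX3_0 v1 v2 := (pX3_pmf v1 v2).1.
have chY_0 x1 x2 x3 := (chY_pmf x1 x2 x3).1.
have chR_0 x1 x2 x3 := (chR_pmf x1 x2 x3).1.
have [|r1 r1_gt0 R1] := vec_threshold_exponent pV1_pmf pX1_pmf pV2_pmf
  pX2_pmf pX3_pmf chR_pmf src_pmf kappa_gt0 rt1.
  by move=> v1 x1 v2 x2 x3 y *; apply: (@Ex_gt0 _ _ _ _ x1).
have [|r2 r2_gt0 R2] := vec_threshold_exponent pV1_pmf pX1_pmf pV2_pmf
  pX2_pmf pX3_pmf chR_pmf src_pmf kappa_gt0 rt2.
  by move=> v1 x1 v2 x2 x3 y *; apply: (@Ex_gt0 _ _ _ _ x2).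
have [|r3 r3_gt0 R3] := vec_threshold_exponent pV1_pmf pX1_pmf pV2_pmf
  pX2_pmf pX3_pmf chR_pmf src_pmf kappa_gt0 rt12.
  move=> v1 x1 v2 x2 x3 y *; apply: (@Ex_gt0 _ _ _ _ x1) => // *.
    exact: Ex_ge0.
  exact: (@Ex_gt0 _ _ _ _ x2).
have [|d1 d1_gt0 D1] := vec_threshold_exponent pV1_pmf pX1_pmf pV2_pmf
  pX2_pmf pX3_pmf chY_pmf src_pmf kappa_gt0 dt1.
  move=> v1 x1 v2 x2 x3 y *; apply: (@Ex_gt0 _ _ _ _ v1) => // *.
    by do 2!apply: Ex_ge0 => // *.
  apply: (@Ex_gt0 _ _ _ _ x1) => // *; first exact: Ex_ge0.
  exact: (@Ex_gt0 _ _ _ _ x3).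
have dden2_gt0 v1 x1 v2 x2 x3 y : 0 < pV2 v2 -> 0 < pX2 v2 x2 ->
    0 < pX3 v1 v2 x3 -> 0 < chY x1 x2 x3 y -> 0 < dden2 pV2 pX2 pX3 chY v1 x1 y.
  move=> *; apply: (@Ex_gt0 _ _ _ _ v2) => // *.
    by do 2!apply: Ex_ge0 => // *.
  apply: (@Ex_gt0 _ _ _ _ x2) => // *; first exact: Ex_ge0.
  exact: (@Ex_gt0 _ _ _ _ x3).
have [|d2 d2_gt0 D2] := vec_threshold_exponent pV1_pmf pX1_pmf pV2_pmf
  pX2_pmf pX3_pmf chY_pmf src_pmf kappa_gt0 dt2.
  by move=> v1 x1 v2 x2 x3 y *; apply: (@dden2_gt0 _ _ v2 x2 x3).
have [|d3 d3_gt0 D3] := vec_threshold_exponent pV1_pmf pX1_pmf pV2_pmf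
  pX2_pmf pX3_pmf chY_pmf src_pmf kappa_gt0 dt12.
  move=> v1 x1 v2 x2 x3 y *; apply: (@Ex_gt0 _ _ _ _ v1) => // *.
    by do 4!apply: Ex_ge0 => // *.
  apply: (@Ex_gt0 _ _ _ _ x1) => // *; first by do 3!apply: Ex_ge0 => // *.
  exact: (@dden2_gt0 _ _ v2 x2 x3).
(* Each of the six tests works for every small enough exponent, so the smallest of the six bounds
   serves all. *)
pose c := Num.min (Num.min r1 (Num.min r2 r3)) (Num.min d1 (Num.min d2 d3)).
have c_gt0 : 0 < c by rewrite !lt_min r1_gt0 r2_gt0 r3_gt0 d1_gt0 d2_gt0.
exists c => // Ip Ic J IpJ IcJ.
have [cr1 cr2 cr3] : [/\ 0 < c <= r1, 0 < c <= r2 & 0 < c <= r3].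
  by rewrite c_gt0 /c !ge_min !lexx ?orbT.
have [cd1 cd2 cd3] : [/\ 0 < c <= d1, 0 < c <= d2 & 0 < c <= d3].
  by rewrite c_gt0 /c !ge_min !lexx ?orbT.
have {}R1 := R1 c cr1 Ic J IcJ; have {}R2 := R2 c cr2 Ic J IcJ.
have {}R3 := R3 c cr3 Ic J IcJ; have {}D1 := D1 c cd1 Ip J IpJ.
have {}D2 := D2 c cd2 Ip J IpJ; have {}D3 := D3 c cd3 Ip J IpJ.
clearbody c.
set g := expR (c * _) in R1 R2 R3 D1 D2 D3.
have g_gt0 : 0 < g by apply: expR_gt0.
rewrite expRN -/g in R1 R2 R3 D1 D2 D3 *.
have [[rs1_0 rs2_0 rs12_0] rs1_1 rs2_1 rs12_1] := vec_cond_law3 Ic rs_law.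
have [[ds1_0 ds2_0 ds12_0] ds1_1 ds2_1 ds12_1] := vec_cond_law3 Ip ds_law.
have pV1J := prodp_pmf (fun _ : J => pV1_pmf).
have pV2J := prodp_pmf (fun _ : J => pV2_pmf).
have pX1J (v : {ffun J -> V1}) : is_pmf (vecX1 pX1 v).
  exact: prodp_pmf (fun j => pX1_pmf (v j)).
have pX2J (v : {ffun J -> V2}) : is_pmf (vecX2 pX2 v).
  exact: prodp_pmf (fun j => pX2_pmf (v j)).
have pX3J (v1 : {ffun J -> V1}) (v2 : {ffun J -> V2}) : is_pmf (vecX3 pX3 v1 v2).
  exact: prodp_pmf (fun j => pX3_pmf (v1 j) (v2 j)).
have chYJ (x1 : {ffun J -> X1}) (x2 : {ffun J -> X2}) (x3 : {ffun J -> X3}) :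
    is_pmf (vec_ch chY x1 x2 x3).
  exact: prodp_pmf (fun j => chY_pmf (x1 j) (x2 j) (x3 j)).
have chRJ (x1 : {ffun J -> X1}) (x2 : {ffun J -> X2}) (x3 : {ffun J -> X3}) :
    is_pmf (vec_ch chR x1 x2 x3).
  exact: prodp_pmf (fun j => chR_pmf (x1 j) (x2 j) (x3 j)).
have := block_random_coding pV1J pX1J pV2J pX2J pX3J chYJ chRJ g_gt0
  rs1_0 rs2_0 rs12_0 rs1_1 rs2_1 rs12_1 ds1_0 ds2_0 ds12_0 ds1_1 ds2_1 ds12_1
  (@vec_s1 Ic) (@vec_s2 Ic) (@vec_w3 Ic) (@vec_s1 Ip) (@vec_s2 Ip) (@vec_w Ip)
  (prodp_pmf (fun _ : Ic => src_pmf)) (prodp_pmf (fun _ : Ip => src_pmf)).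
case/(block_avg_exists pV1J pX1J pV2J pX2J pX3J) => c1 [c2 [c3 Hc]].
(* Default letters for when no candidate is accepted; the support of [src] shows that the alphabets
   are inhabited. A default can only reduce the error. *)
have [[[[a b] u] v] _] := pmf_supp src_pmf.
pose bc := @BlockCode Ip Ic J
  (fun q o => (c1 q).2 o) (fun q o => (c2 q).2 o) (fun q1 q2 => c3 (q1, q2))
  (fun q1 q2 y w => odflt ([ffun=> a], [ffun=> b])
     (relay_dec (vecX1 pX1 (J := J)) (vecX2 pX2 (J := J)) (vec_ch chR (J := J)) g
        (vec_sg rs1 (I := Ic)) (vec_sg rs2 (I := Ic)) (vec_sg rs12 (I := Ic))
        (c1 q1) (c2 q2) (c3 (q1, q2)) y w))
  (fun o1 o2 y w => odflt ([ffun=> a], [ffun=> b])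
     (dest_dec (prodp (fun=> pV1)) (vecX1 pX1 (J := J)) (prodp (fun=> pV2))
        (vecX2 pX2 (J := J)) (vecX3 pX3 (J := J)) (vec_ch chY (J := J)) g
        (vec_sg ds1 (I := Ip)) (vec_sg ds2 (I := Ip)) (vec_sg ds12 (I := Ip))
        c1 c2 c3 o1 o2 y w)).
exists bc.
have odflt_neq (A : eqType) (x0 x : A) z :
    (odflt x0 z != x)%:R <= (z != Some x)%:R :> R.
  case: z => [z|] /=; last by case: (_ != _); rewrite ?ler01.
  by rewrite (inj_eq (@Some_inj _)).
have src_0 (I : finType) := (prodp_pmf (fun _ : I => src_pmf)).1.
refine (le_trans (le_trans _ Hc) _).
  rewrite lerD //.
    do 2!(apply: ler_Ex => // ?).
    by apply: ler_Ex => [|y]; [exact: (chRJ _ _ _).1|exact: odflt_neq].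
  rewrite [X in _ <= X]Ex_swap; do 2!(apply: ler_Ex => // ?).
  by apply: ler_Ex => [|y]; [exact: (chYJ _ _ _).1|exact: odflt_neq].
(* Six test failures of probability at most [g^-1] each, and [6 / g] for the false alarms of both
   decoders. *)
have -> : 12 * g^-1 = (g^-1 + g^-1 + g^-1) + (g^-1 + g^-1 + g^-1) + 6 / g.
  by ring.
rewrite lerD2r lerD //.
  apply: le_trans (lerD (lerD R1 R2) R3).
  rewrite -!ExD; apply: eq_ler; apply: eq_Ex => o.
  rewrite -!avg_lettersD; apply: eq_avg_letters => v1 x1 v2 x2 x3 y.
  rewrite /relay_fail rden1_vec rden2_vec rden12_vec /vec_sg.
  by congr (_ + _ + _); congr (~~ (_ <= _ * _)%R)%:R; apply: eq_bigr => i _;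
    rewrite !ffunE.
apply: le_trans (lerD (lerD D1 D2) D3).
rewrite -!ExD; apply: eq_ler; apply: eq_Ex => o.
rewrite -!avg_lettersD; apply: eq_avg_letters => v1 x1 v2 x2 x3 y.
rewrite /dest_fail dden1_vec dden2_vec dden12_vec /vec_sg.
by congr (_ + _ + _); congr (~~ (_ <= _ * _)%R)%:R; apply: eq_bigr => i _;
  rewrite !ffunE.
Qed.

End VectorBlock.

(** * Information measures as expectations of log-likelihood ratios *)

Section InformationMeasures.
Variables (R : realType) (Om : finType) (P : Om -> R).
Hypothesis P_ge0 : forall o, 0 <= P o.

Lemma pr_eqE (A : finType) (X : Om -> A) x :
  pr_eq P X x = \E_(o ~ P) (X o == x)%:R.
Proof.
rewrite /pr_eq /prob big_mkcond; apply: eq_bigr => o _ /=.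
by case: (X o == x); rewrite ?mulr1 ?mulr0.
Qed.

Lemma pr_eq_ge0 (A : finType) (X : Om -> A) x : 0 <= pr_eq P X x.
Proof. exact: sumr_ge0. Qed.

Lemma pr_eq_gt0 (A : finType) (X : Om -> A) o : 0 < P o -> 0 < pr_eq P X (X o).
Proof.
move=> Po; rewrite /pr_eq /prob (bigD1 o) ?inE //=.
by rewrite ltr_pwDl // sumr_ge0.
Qed.

Lemma sum_pr_eq (A : finType) (X : Om -> A) (h : A -> R) :
  \sum_x pr_eq P X x * h x = \E_(o ~ P) h (X o).
Proof.
rewrite /Ex (partition_big X xpredT) //=; apply: eq_bigr => x _.
by rewrite /pr_eq /prob big_distrl /=; apply: eq_bigr => o /eqP<-.
Qed.

Lemma pr_eq_marginal (A B : finType) (X : Om -> A) (Y : Om -> B) y :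
  \sum_x pr_eq P [% X, Y] (x, y) = pr_eq P Y y.
Proof.
under eq_bigr => x _ do rewrite pr_eqE; rewrite pr_eqE -Ex_sum.
apply: eq_Ex => o; rewrite (bigD1 (X o)) //= xpair_eqE eqxx /= big1 ?addr0 //.
by move=> x /negPf xX; rewrite xpair_eqE eq_sym xX.
Qed.

Section Conditional.
Variables (A B : finType) (X : Om -> A) (Y : Om -> B).

Lemma cond_pr_ge0 x y : 0 <= cond_pr P X Y x y.
Proof. by rewrite divr_ge0 ?pr_eq_ge0. Qed.

Lemma sum_cond_pr_le1 y : \sum_x cond_pr P X Y x y <= 1.
Proof.
rewrite /cond_pr -big_distrl /= pr_eq_marginal.
by case: (eqVneq (pr_eq P Y y) 0) => [->|y0]; rewrite ?mul0r ?mulfV.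
Qed.

Lemma cond_pr_le1 x y : cond_pr P X Y x y <= 1.
Proof.
apply: le_trans (sum_cond_pr_le1 y); rewrite (bigD1 x) //= lerDl.
by apply: sumr_ge0 => *; apply: cond_pr_ge0.
Qed.

Lemma cond_pr_gt0 o : 0 < P o -> 0 < cond_pr P X Y (X o) (Y o).
Proof.
move=> Po; rewrite divr_gt0 ?(pr_eq_gt0 Y) //.
exact: (pr_eq_gt0 (fun o => (X o, Y o))).
Qed.

(** The factor [ln 2] converts bits into nats, the unit of the Chernoff bounds. *)
Lemma cond_entropyE :
  \E_(o ~ P) - ln (cond_pr P X Y (X o) (Y o)) = ln 2 * cond_entropy P X Y.
Proof.
have ln2 : ln (2 : R) != 0 by rewrite gt_eqF // ln_gt0 // ltr1n.
rewrite /cond_entropy pair_bigA /= (sum_pr_eq (fun o => (X o, Y o))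
  (fun u => log2 (cond_pr P X Y u.1 u.2))) /= -ExN -ExZl.
by apply: eq_Ex => o; rewrite /log2 mulrN mulrCA mulfV ?mulr1.
Qed.

Lemma cond_entropy_ge0 : 0 <= cond_entropy P X Y.
Proof.
have ln2 : 0 < ln (2 : R) by rewrite ln_gt0 // ltr1n.
rewrite -(pmulr_rge0 _ ln2) -cond_entropyE; apply: Ex_ge0 => // o.
by rewrite oppr_ge0 ln_le0 // cond_pr_le1.
Qed.

End Conditional.

(** With [a] the law of [Z], [b] that of [X] given [Z], and [k] the channel, [a] and [b] cancel in
    the ratio. What remains is the channel likelihood over the output law with [X] redrawn, exactly
    what a test compares. *)
Lemma cond_mutual_infoE (A B C : finType) (X : Om -> A) (Y : Om -> B)
    (Z : Om -> C) (a : C -> R) (b : C -> A -> R) (k : C -> A -> B -> R) :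
  (forall x y z, pr_eq P [% X, Y, Z] (x, y, z) = a z * b z x * k z x y) ->
  (forall z, is_pmf (b z)) -> (forall z x, is_pmf (k z x)) ->
  ln 2 * cond_mutual_info P X Y Z =
  \E_(o ~ P) ln (k (Z o) (X o) (Y o) / \E_(x ~ b (Z o)) k (Z o) x (Y o)).
Proof.
move=> abk b_pmf k_pmf; pose D z y := \E_(x ~ b z) k z x y.
have k_ge0 z x y : 0 <= k z x y by case: (k_pmf z x).
have b_ge0 z x : 0 <= b z x by case: (b_pmf z).
have abkXZ x z : pr_eq P [% X, Z] (x, z) = a z * b z x.
  rewrite -(pr_eq_marginal Y) -[RHS]mulr1 -(k_pmf z x).2 big_distrr /=.
  apply: eq_bigr => y _; rewrite -abk !pr_eqE; apply: eq_Ex => o.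
  by rewrite !xpair_eqE andbCA andbA.
have abkYZ y z : pr_eq P [% Y, Z] (y, z) = a z * D z y.
  rewrite -(pr_eq_marginal X) /D /Ex big_distrr /=.
  apply: eq_bigr => x _; rewrite mulrA -abk !pr_eqE; apply: eq_Ex => o.
  by rewrite !xpair_eqE andbA.
have abkZ z : pr_eq P Z z = a z.
  rewrite -(pr_eq_marginal X) -[RHS]mulr1 -(b_pmf z).2 big_distrr /=.
  by apply: eq_bigr => x _; rewrite abkXZ.
have ln2 : ln (2 : R) != 0 by rewrite gt_eqF // ln_gt0 // ltr1n.
transitivity (\sum_(u : A * B * C) pr_eq P [% X, Y, Z] u *
    ln (k u.2 u.1.1 u.1.2 / D u.2 u.1.2)); last exact: sum_pr_eq.
rewrite /cond_mutual_info !pair_bigA /= big_distrr /=.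
apply: eq_bigr => -[[x y] z] _ /=; rewrite mulrCA.
rewrite /cond_pr abkXZ abkYZ abkZ abk.
(* Null triples contribute nothing; on the others every factor is nonzero and the fraction
   simplifies. *)
case: (eqVneq (a z * b z x * k z x y) 0) => [->|]; first by rewrite !mul0r.
rewrite !mulf_eq0 !negb_or -andbA => /and3P[a0 b0 k0]; congr (_ * _).
have D0 : D z y != 0.
  by rewrite gt_eqF // (@Ex_gt0 _ _ _ _ x) // lt0r ?b0 ?k0 ?b_ge0 ?k_ge0.
rewrite /log2 mulrCA mulfV // mulr1; congr (ln _); field.
by rewrite D0 a0.
Qed.

Lemma mutual_infoE (A B : finType) (X : Om -> A) (Y : Om -> B)
    (b : A -> R) (k : A -> B -> R) :
  (forall x y, pr_eq P [% X, Y] (x, y) = b x * k x y) ->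
  is_pmf b -> (forall x, is_pmf (k x)) ->
  ln 2 * mutual_info P X Y =
  \E_(o ~ P) ln (k (X o) (Y o) / \E_(x ~ b) k x (Y o)).
Proof.
move=> bk b_pmf k_pmf; pose D y := \E_(x ~ b) k x y.
have k_ge0 x y : 0 <= k x y by case: (k_pmf x).
have b_ge0 x : 0 <= b x by case: b_pmf.
have bkX x : pr_eq P X x = b x.
  rewrite -(pr_eq_marginal Y) -[RHS]mulr1 -(k_pmf x).2 big_distrr /=.
  apply: eq_bigr => y _; rewrite -bk !pr_eqE; apply: eq_Ex => o.
  by rewrite !xpair_eqE andbC.
have bkY y : pr_eq P Y y = D y.
  by rewrite -(pr_eq_marginal X); apply: eq_bigr => x _; rewrite bk.
have ln2 : ln (2 : R) != 0 by rewrite gt_eqF // ln_gt0 // ltr1n.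
transitivity (\sum_(u : A * B) pr_eq P [% X, Y] u *
    ln (k u.1 u.2 / D u.2)); last exact: sum_pr_eq.
rewrite /mutual_info pair_bigA /= big_distrr /=.
apply: eq_bigr => -[x y] _ /=; rewrite mulrCA bkX bkY bk.
case: (eqVneq (b x * k x y) 0) => [->|]; first by rewrite !mul0r.
rewrite !mulf_eq0 !negb_or => /andP[b0 k0]; congr (_ * _).
have D0 : D y != 0.
  by rewrite gt_eqF // (@Ex_gt0 _ _ _ _ x) // lt0r ?b0 ?k0 ?b_ge0 ?k_ge0.
rewrite /log2 mulrCA mulfV // mulr1; congr (ln _); field.
by rewrite D0 b0.
Qed.

End InformationMeasures.

(** * From the six rate conditions to the single-letter tests *)

Section SingleLetter.
Variables (R : realType) (S1 S2 W3 W X1 X2 X3 Y Y3 V1 V2 : finType).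
Variables (src : S1 * S2 * W3 * W -> R) (ch : X1 -> X2 -> X3 -> Y * Y3 -> R).
Variables (pV1 : V1 -> R) (pX1 : V1 -> X1 -> R).
Variables (pV2 : V2 -> R) (pX2 : V2 -> X2 -> R) (pX3 : V1 -> V2 -> X3 -> R).
Variables (q : aux_space S1 S2 W3 W X1 X2 X3 V1 V2 -> R) (kappa : R).
Hypothesis src_pmf : is_pmf src.
Hypothesis ch_pmf : forall x1 x2 x3, is_pmf (ch x1 x2 x3).
Hypothesis pV1_pmf : is_pmf pV1.
Hypothesis pX1_pmf : forall v, is_pmf (pX1 v).
Hypothesis pV2_pmf : is_pmf pV2.
Hypothesis pX2_pmf : forall v, is_pmf (pX2 v).
Hypothesis pX3_pmf : forall v1 v2, is_pmf (pX3 v1 v2).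
Hypothesis qE : forall s1 s2 w3 w v1 v2 x1 x2 x3,
  q (s1, s2, w3, w, v1, v2, x1, x2, x3) =
  src (s1, s2, w3, w) * pV1 v1 * pX1 v1 x1 * pV2 v2 * pX2 v2 x2 * pX3 v1 v2 x3.

(** Relay and destination failures are bounded separately, so each needs only its own marginal
    channel. *)
Definition ch_dest x1 x2 x3 y := \sum_y3 ch x1 x2 x3 (y, y3).
Definition ch_relay x1 x2 x3 y3 := \sum_y ch x1 x2 x3 (y, y3).

Lemma Ex_ch_dest x1 x2 x3 (f : Y -> R) :
  \E_(u ~ ch x1 x2 x3) f u.1 = \E_(y ~ ch_dest x1 x2 x3) f y.
Proof.
rewrite /Ex /ch_dest; under [RHS]eq_bigr => y _ do rewrite big_distrl /=.
by rewrite pair_bigA; apply: eq_bigr => -[y y3].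
Qed.

Lemma Ex_ch_relay x1 x2 x3 (f : Y3 -> R) :
  \E_(u ~ ch x1 x2 x3) f u.2 = \E_(y ~ ch_relay x1 x2 x3) f y.
Proof.
rewrite /Ex /ch_relay; under [RHS]eq_bigr => y _ do rewrite big_distrl /=.
by rewrite exchange_big pair_bigA; apply: eq_bigr => -[y y3].
Qed.

Lemma ch_dest_pmf x1 x2 x3 : is_pmf (ch_dest x1 x2 x3).
Proof.
split=> [y|]; first by apply: sumr_ge0 => y3 _; case: (ch_pmf x1 x2 x3).
rewrite -[RHS](Ex_cst 1 (ch_pmf x1 x2 x3)) (Ex_ch_dest _ _ _ (fun=> 1)).
by apply: eq_bigr => y _; rewrite mulr1.
Qed.

Lemma ch_relay_pmf x1 x2 x3 : is_pmf (ch_relay x1 x2 x3).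
Proof.
split=> [y|]; first by apply: sumr_ge0 => y3 _; case: (ch_pmf x1 x2 x3).
rewrite -[RHS](Ex_cst 1 (ch_pmf x1 x2 x3)) (Ex_ch_relay _ _ _ (fun=> 1)).
by apply: eq_bigr => y _; rewrite mulr1.
Qed.

Notation P := (joint_law ch q).
Local Notation jS1 := (@rS1 _ _ _ _ _ _ _ _ _ _ _).
Local Notation jS2 := (@rS2 _ _ _ _ _ _ _ _ _ _ _).
Local Notation jW3 := (@rW3 _ _ _ _ _ _ _ _ _ _ _).
Local Notation jW := (@rW _ _ _ _ _ _ _ _ _ _ _).
Local Notation jV1 := (@rV1 _ _ _ _ _ _ _ _ _ _ _).
Local Notation jV2 := (@rV2 _ _ _ _ _ _ _ _ _ _ _).
Local Notation jX1 := (@rX1 _ _ _ _ _ _ _ _ _ _ _).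
Local Notation jX2 := (@rX2 _ _ _ _ _ _ _ _ _ _ _).
Local Notation jX3 := (@rX3 _ _ _ _ _ _ _ _ _ _ _).
Local Notation jY := (@rY _ _ _ _ _ _ _ _ _ _ _).
Local Notation jY3 := (@rY3 _ _ _ _ _ _ _ _ _ _ _).
Notation avg ch := (avg_letters pV1 pX1 pV2 pX2 pX3 ch).

Lemma joint_law_ge0 o : 0 <= P o.
Proof.
case: o => -[[[[[[[[[s1 s2] w3] w] v1] v2] x1] x2] x3] y] y3 /=.
rewrite qE; do ?apply: mulr_ge0; [exact: src_pmf.1|exact: pV1_pmf.1|
  exact: (pX1_pmf v1).1|exact: pV2_pmf.1|exact: (pX2_pmf v2).1|
  exact: (pX3_pmf v1 v2).1|exact: (ch_pmf x1 x2 x3).1].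
Qed.

(** The factorization makes the source letter independent of the channel letter, hence the iterated
    expectation. *)
Lemma Ex_joint_law (f : S1 * S2 * W3 * W -> V1 -> X1 -> V2 -> X2 -> X3 ->
    Y * Y3 -> R) :
  \E_(o ~ P) f (rS1 o, rS2 o, rW3 o, rW o) (rV1 o) (rX1 o) (rV2 o) (rX2 o)
               (rX3 o) (rY o, rY3 o) =
  \E_(s ~ src) avg ch (f s).
Proof.
under [RHS]eq_Ex => s do rewrite avg_lettersE.
have -> : \E_(s ~ src) Ex (letter_law pV1 pX1 pV2 pX2 pX3 ch) (on_letter (f s)) =
  \E_(u ~ fun u => src u.1 * letter_law pV1 pX1 pV2 pX2 pX3 ch u.2)
    on_letter (f u.1) u.2.
  by rewrite (Ex_pair src (fun=> letter_law pV1 pX1 pV2 pX2 pX3 ch)).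
pose j (u : (S1 * S2 * W3 * W) * letter V1 V2 X1 X2 X3 (Y * Y3)%type) :
    joint_space S1 S2 W3 W X1 X2 X3 Y Y3 V1 V2 :=
  let: (s1, s2, w3, w, (v1, x1, v2, x2, x3, (y, y3))) := u in
  (s1, s2, w3, w, v1, v2, x1, x2, x3, y, y3).
rewrite {1}/Ex (reindex j) /=.
  apply: eq_bigr => -[[[[s1 s2] w3] w] [[[[[v1 x1] v2] x2] x3] [y y3]]] _ /=.
  by rewrite qE !mulrA.
exists (fun o => (rS1 o, rS2 o, rW3 o, rW o,
  (rV1 o, rX1 o, rV2 o, rX2 o, rX3 o, (rY o, rY3 o)))).
  by case=> -[[[s1 s2] w3] w] [[[[[v1 x1] v2] x2] x3] [y y3]].
by case=> -[[[[[[[[[s1 s2] w3] w] v1] v2] x1] x2] x3] y] y3.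
Qed.

Lemma Ex_joint_src (f : S1 * S2 * W3 * W -> R) :
  \E_(o ~ P) f (rS1 o, rS2 o, rW3 o, rW o) = \E_(s ~ src) f s.
Proof.
rewrite (Ex_joint_law (fun s _ _ _ _ _ _ => f s)); apply: eq_Ex => s.
rewrite avg_lettersE -[RHS](Ex_cst (f s) (letter_law_pmf pV1_pmf pX1_pmf
  pV2_pmf pX2_pmf pX3_pmf ch_pmf)).
by apply: eq_Ex => -[[[[[v1 x1] v2] x2] x3] u].
Qed.

Lemma Ex_joint_dest (f : V1 -> X1 -> V2 -> X2 -> X3 -> Y -> R) :
  \E_(o ~ P) f (rV1 o) (rX1 o) (rV2 o) (rX2 o) (rX3 o) (rY o) = avg ch_dest f.
Proof.
rewrite (Ex_joint_law (fun _ v1 x1 v2 x2 x3 u => f v1 x1 v2 x2 x3 u.1)).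
rewrite Ex_cst //; apply: eq_Ex => v1; apply: eq_Ex => x1; apply: eq_Ex => v2.
apply: eq_Ex => x2; apply: eq_Ex => x3; exact: Ex_ch_dest.
Qed.

Lemma Ex_joint_relay (f : V1 -> X1 -> V2 -> X2 -> X3 -> Y3 -> R) :
  \E_(o ~ P) f (rV1 o) (rX1 o) (rV2 o) (rX2 o) (rX3 o) (rY3 o) = avg ch_relay f.
Proof.
rewrite (Ex_joint_law (fun _ v1 x1 v2 x2 x3 u => f v1 x1 v2 x2 x3 u.2)).
rewrite Ex_cst //; apply: eq_Ex => v1; apply: eq_Ex => x1; apply: eq_Ex => v2.
apply: eq_Ex => x2; apply: eq_Ex => x3; exact: Ex_ch_relay.
Qed.

(** Transfers positivity of a posterior from the joint space, where it is defined, to source letters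
    alone. *)
Lemma joint_law_supp s : 0 < src s ->
  exists2 o, 0 < P o & (rS1 o, rS2 o, rW3 o, rW o) = s.
Proof.
case: s => -[[s1 s2] w3] w s_gt0.
have [v1 v1_gt0] := pmf_supp pV1_pmf; have [x1 x1_gt0] := pmf_supp (pX1_pmf v1).
have [v2 v2_gt0] := pmf_supp pV2_pmf; have [x2 x2_gt0] := pmf_supp (pX2_pmf v2).
have [x3 x3_gt0] := pmf_supp (pX3_pmf v1 v2).
have [[y y3] y_gt0] := pmf_supp (ch_pmf x1 x2 x3).
exists (s1, s2, w3, w, v1, v2, x1, x2, x3, y, y3) => //=.
by rewrite qE !mulr_gt0.
Qed.

Section SourceTest.
Variables (A B : finType) (X : joint_space S1 S2 W3 W X1 X2 X3 Y Y3 V1 V2 -> A).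
Variables (Z : joint_space S1 S2 W3 W X1 X2 X3 Y Y3 V1 V2 -> B).
Variables (T : finType) (cht : X1 -> X2 -> X3 -> T -> R).
Variables (sg : S1 * S2 * W3 * W -> R) (D : V1 -> X1 -> V2 -> X2 -> X3 -> T -> R).

Lemma test_cond_of_entropy (I : R) :
  (forall o, sg (rS1 o, rS2 o, rW3 o, rW o) = cond_pr P X Z (X o) (Z o)) ->
  cond_entropy P X Z < kappa * I ->
  ln 2 * I = avg cht (fun v1 x1 v2 x2 x3 y =>
    ln (cht x1 x2 x3 y / D v1 x1 v2 x2 x3 y)) ->
  test_cond pV1 pX1 pV2 pX2 pX3 cht src sg kappa D.
Proof.
move=> sgE HI lnI; have ln2 : 0 < ln (2 : R) by rewrite ln_gt0 // ltr1n.
have E : \E_(s ~ src) - ln (sg s) = ln 2 * cond_entropy P X Z.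
  rewrite -(Ex_joint_src (fun s => - ln (sg s))) -cond_entropyE.
  by apply: eq_Ex => o; rewrite sgE.
split=> [s s_gt0||].
- have [o o_gt0 <-] := joint_law_supp s_gt0.
  by rewrite sgE; apply: cond_pr_gt0 => //; apply: joint_law_ge0.
- by rewrite E mulr_ge0 ?(ltW ln2) ?cond_entropy_ge0 //; apply: joint_law_ge0.
by rewrite E -lnI mulrCA ltr_pM2l.
Qed.

End SourceTest.

Lemma natrb (R' : pzSemiRingType) (b c : bool) :
  (b && c)%:R = b%:R * c%:R :> R'.
Proof. by case: b; rewrite ?mul1r ?mul0r. Qed.

(** Given [V1], the input [X1] is independent of [(X2, X3)], so its conditional law is [pX1 v1]
    although [X3] also depends on [V1]. The centre [V2] is averaged into the law of the conditioning
    letter. *)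
Lemma info_relay1 : ln 2 * cond_mutual_info P jX1
    jY3 [% jV1, jX2, jX3] =
  avg ch_relay (fun v1 x1 v2 x2 x3 y =>
    ln (ch_relay x1 x2 x3 y / rden1 pX1 ch_relay v1 x2 x3 y)).
Proof.
rewrite (@cond_mutual_infoE _ _ P _ _ _ _ _ _
  (fun z : V1 * X2 * X3 =>
     pV1 z.1.1 * \E_(v2 ~ pV2) (pX2 v2 z.1.2 * pX3 z.1.1 v2 z.2))
  (fun z => pX1 z.1.1) (fun z x1 => ch_relay x1 z.1.2 z.2)).
- exact: (Ex_joint_relay (fun v1 x1 v2 x2 x3 y =>
    ln (ch_relay x1 x2 x3 y / rden1 pX1 ch_relay v1 x2 x3 y))).
- move=> x1 y [[v1 x2] x3] /=; rewrite pr_eqE.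
  rewrite (Ex_joint_relay (fun v1' x1' _ x2' x3' y' =>
    ((x1', y', (v1', x2', x3')) == (x1, y, (v1, x2, x3)))%:R)).
  transitivity (\E_(v1' ~ pV1) ((v1' == v1)%:R *
    \E_(x1' ~ pX1 v1') ((x1' == x1)%:R * \E_(v2 ~ pV2)
    \E_(x2' ~ pX2 v2) ((x2' == x2)%:R * \E_(x3' ~ pX3 v1' v2) ((x3' == x3)%:R *
    \E_(y' ~ ch_relay x1' x2' x3') (y' == y)%:R))))).
    apply: eq_Ex => v1'; rewrite -!ExZl; apply: eq_Ex => x1'.
    rewrite -!ExZl; apply: eq_Ex => v2; rewrite -!ExZl; apply: eq_Ex => x2'.
    rewrite -!ExZl; apply: eq_Ex => x3'; rewrite -!ExZl; apply: eq_Ex => y'.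
    by rewrite !xpair_eqE !natrb; ring.
  rewrite Ex_delta Ex_delta -!mulrA; congr (_ * _).
  rewrite [RHS]mulrCA; congr (_ * _); rewrite -ExZr; apply: eq_Ex => v2.
  by rewrite Ex_delta Ex_delta Ex_indic; ring.
- by move=> z.
by move=> z x; apply: ch_relay_pmf.
Qed.

Lemma info_relay2 : ln 2 * cond_mutual_info P jX2
    jY3 [% jV2, jX1, jX3] =
  avg ch_relay (fun v1 x1 v2 x2 x3 y =>
    ln (ch_relay x1 x2 x3 y / rden2 pX2 ch_relay v2 x1 x3 y)).
Proof.
rewrite (@cond_mutual_infoE _ _ P _ _ _ _ _ _
  (fun z : V2 * X1 * X3 =>
     pV2 z.1.1 * \E_(v1 ~ pV1) (pX1 v1 z.1.2 * pX3 v1 z.1.1 z.2))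
  (fun z => pX2 z.1.1) (fun z x2 => ch_relay z.1.2 x2 z.2)).
- exact: (Ex_joint_relay (fun v1 x1 v2 x2 x3 y =>
    ln (ch_relay x1 x2 x3 y / rden2 pX2 ch_relay v2 x1 x3 y))).
- move=> x2 y [[v2 x1] x3] /=; rewrite pr_eqE.
  rewrite (Ex_joint_relay (fun v1' x1' v2' x2' x3' y' =>
    ((x2', y', (v2', x1', x3')) == (x2, y, (v2, x1, x3)))%:R)).
  transitivity (\E_(v1 ~ pV1) \E_(x1' ~ pX1 v1) ((x1' == x1)%:R *
    \E_(v2' ~ pV2) ((v2' == v2)%:R *
    \E_(x2' ~ pX2 v2') ((x2' == x2)%:R * \E_(x3' ~ pX3 v1 v2') ((x3' == x3)%:R *
    \E_(y' ~ ch_relay x1' x2' x3') (y' == y)%:R))))).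
    apply: eq_Ex => v1; apply: eq_Ex => x1'.
    rewrite -!ExZl; apply: eq_Ex => v2'; rewrite -!ExZl; apply: eq_Ex => x2'.
    rewrite -!ExZl; apply: eq_Ex => x3'; rewrite -!ExZl; apply: eq_Ex => y'.
    by rewrite !xpair_eqE !natrb; ring.
  rewrite -!mulrA [RHS]mulrCA -ExZr; apply: eq_Ex => v1.
  by rewrite Ex_delta Ex_delta Ex_delta Ex_delta Ex_indic; ring.
- by move=> z.
by move=> z x; apply: ch_relay_pmf.
Qed.

Lemma info_relay12 : ln 2 * cond_mutual_info P [% jX1, jX2]
    jY3 [% jV1, jV2, jX3] =
  avg ch_relay (fun v1 x1 v2 x2 x3 y =>
    ln (ch_relay x1 x2 x3 y / rden12 pX1 pX2 ch_relay v1 v2 x3 y)).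
Proof.
rewrite (@cond_mutual_infoE _ _ P _ _ _ _ _ _
  (fun z : V1 * V2 * X3 => pV1 z.1.1 * pV2 z.1.2 * pX3 z.1.1 z.1.2 z.2)
  (fun z (x : X1 * X2) => pX1 z.1.1 x.1 * pX2 z.1.2 x.2)
  (fun z x => ch_relay x.1 x.2 z.2)).
- rewrite -(Ex_joint_relay (fun v1 x1 v2 x2 x3 y =>
    ln (ch_relay x1 x2 x3 y / rden12 pX1 pX2 ch_relay v1 v2 x3 y))).
  apply: eq_Ex => o; congr (ln (_ / _)).
  exact: (Ex_pair (pX1 _) (fun=> pX2 _)).
- move=> [x1 x2] y [[v1 v2] x3] /=; rewrite pr_eqE.
  rewrite (Ex_joint_relay (fun v1' x1' v2' x2' x3' y' =>
    (((x1', x2'), y', (v1', v2', x3')) == ((x1, x2), y, (v1, v2, x3)))%:R)).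
  transitivity (\E_(v1' ~ pV1) ((v1' == v1)%:R *
    \E_(x1' ~ pX1 v1') ((x1' == x1)%:R * \E_(v2' ~ pV2) ((v2' == v2)%:R *
    \E_(x2' ~ pX2 v2') ((x2' == x2)%:R * \E_(x3' ~ pX3 v1' v2') ((x3' == x3)%:R *
    \E_(y' ~ ch_relay x1' x2' x3') (y' == y)%:R)))))).
    apply: eq_Ex => v1'; rewrite -!ExZl; apply: eq_Ex => x1'.
    rewrite -!ExZl; apply: eq_Ex => v2'; rewrite -!ExZl; apply: eq_Ex => x2'.
    rewrite -!ExZl; apply: eq_Ex => x3'; rewrite -!ExZl; apply: eq_Ex => y'.
    by rewrite !xpair_eqE !natrb; ring.
  by rewrite !Ex_delta Ex_indic; ring.
- by move=> z; apply: (pmf_pair (pX1_pmf _) (fun=> pX2_pmf _)).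
by move=> z x; apply: ch_relay_pmf.
Qed.

(** [V1] is absent from the information term, so the law of [(X1, X3)] given [(V2, X2)] is a mixture
    over [v1], depending on [V2] only. The same mixture defines [dden1]. *)
Lemma info_dest1 : ln 2 * cond_mutual_info P [% jX1, jX3]
    jY [% jV2, jX2] =
  avg ch_dest (fun v1 x1 v2 x2 x3 y =>
    ln (ch_dest x1 x2 x3 y / dden1 pV1 pX1 pX3 ch_dest v2 x2 y)).
Proof.
have bE v2 (f : X1 * X3 -> R) :
    \E_(x ~ fun x => \E_(v1 ~ pV1) (pX1 v1 x.1 * pX3 v1 v2 x.2)) f x =
    \E_(v1 ~ pV1) \E_(x1 ~ pX1 v1) \E_(x3 ~ pX3 v1 v2) f (x1, x3).
  rewrite {1}/Ex; under eq_bigr => x _ do rewrite -ExZr.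
  rewrite -Ex_sum; apply: eq_Ex => v1.
  exact: (Ex_pair (pX1 v1) (fun=> pX3 v1 v2)).
rewrite (@cond_mutual_infoE _ _ P _ _ _ _ _ _
  (fun z : V2 * X2 => pV2 z.1 * pX2 z.1 z.2)
  (fun z (x : X1 * X3) => \E_(v1 ~ pV1) (pX1 v1 x.1 * pX3 v1 z.1 x.2))
  (fun z x => ch_dest x.1 z.2 x.2)).
- rewrite -(Ex_joint_dest (fun v1 x1 v2 x2 x3 y =>
    ln (ch_dest x1 x2 x3 y / dden1 pV1 pX1 pX3 ch_dest v2 x2 y))).
  by apply: eq_Ex => o; congr (ln (_ / _)); exact: bE.
- move=> [x1 x3] y [v2 x2] /=; rewrite pr_eqE.
  rewrite (Ex_joint_dest (fun v1' x1' v2' x2' x3' y' =>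
    (((x1', x3'), y', (v2', x2')) == ((x1, x3), y, (v2, x2)))%:R)).
  transitivity (\E_(v1 ~ pV1)
    \E_(x1' ~ pX1 v1) ((x1' == x1)%:R * \E_(v2' ~ pV2) ((v2' == v2)%:R *
    \E_(x2' ~ pX2 v2') ((x2' == x2)%:R * \E_(x3' ~ pX3 v1 v2') ((x3' == x3)%:R *
    \E_(y' ~ ch_dest x1' x2' x3') (y' == y)%:R))))).
    apply: eq_Ex => v1; apply: eq_Ex => x1'.
    rewrite -!ExZl; apply: eq_Ex => v2'; rewrite -!ExZl; apply: eq_Ex => x2'.
    rewrite -!ExZl; apply: eq_Ex => x3'; rewrite -!ExZl; apply: eq_Ex => y'.
    by rewrite !xpair_eqE !natrb; ring.
  rewrite -!mulrA -!ExZr -!ExZl; apply: eq_Ex => v1.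
  by rewrite !Ex_delta Ex_indic; ring.
- move=> z; split=> [x|].
    apply: Ex_ge0 => [|v1]; first exact: pV1_pmf.1.
    by rewrite mulr_ge0 //; [exact: (pX1_pmf v1).1|exact: (pX3_pmf v1 z.1).1].
  transitivity (\E_(v1 ~ pV1) \E_(x1 ~ pX1 v1) \E_(x3 ~ pX3 v1 z.1) (1 : R)).
    by rewrite -(bE z.1 (fun=> 1)); apply: eq_bigr => x _; rewrite mulr1.
  rewrite -[RHS](Ex_cst 1 pV1_pmf); apply: eq_Ex => v1.
  by rewrite -[RHS](Ex_cst 1 (pX1_pmf v1)); apply: eq_Ex => x1; rewrite Ex_cst.
by move=> z x; apply: ch_dest_pmf.
Qed.

Lemma info_dest2 : ln 2 * cond_mutual_info P [% jX2, jX3]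
    jY [% jV1, jX1] =
  avg ch_dest (fun v1 x1 v2 x2 x3 y =>
    ln (ch_dest x1 x2 x3 y / dden2 pV2 pX2 pX3 ch_dest v1 x1 y)).
Proof.
have bE v1 (f : X2 * X3 -> R) :
    \E_(x ~ fun x => \E_(v2 ~ pV2) (pX2 v2 x.1 * pX3 v1 v2 x.2)) f x =
    \E_(v2 ~ pV2) \E_(x2 ~ pX2 v2) \E_(x3 ~ pX3 v1 v2) f (x2, x3).
  rewrite {1}/Ex; under eq_bigr => x _ do rewrite -ExZr.
  rewrite -Ex_sum; apply: eq_Ex => v2.
  exact: (Ex_pair (pX2 v2) (fun=> pX3 v1 v2)).
rewrite (@cond_mutual_infoE _ _ P _ _ _ _ _ _
  (fun z : V1 * X1 => pV1 z.1 * pX1 z.1 z.2)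
  (fun z (x : X2 * X3) => \E_(v2 ~ pV2) (pX2 v2 x.1 * pX3 z.1 v2 x.2))
  (fun z x => ch_dest z.2 x.1 x.2)).
- rewrite -(Ex_joint_dest (fun v1 x1 v2 x2 x3 y =>
    ln (ch_dest x1 x2 x3 y / dden2 pV2 pX2 pX3 ch_dest v1 x1 y))).
  by apply: eq_Ex => o; congr (ln (_ / _)); exact: bE.
- move=> [x2 x3] y [v1 x1] /=; rewrite pr_eqE.
  rewrite (Ex_joint_dest (fun v1' x1' v2' x2' x3' y' =>
    (((x2', x3'), y', (v1', x1')) == ((x2, x3), y, (v1, x1)))%:R)).
  transitivity (\E_(v1' ~ pV1) ((v1' == v1)%:R *
    \E_(x1' ~ pX1 v1') ((x1' == x1)%:R * \E_(v2 ~ pV2)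
    \E_(x2' ~ pX2 v2) ((x2' == x2)%:R * \E_(x3' ~ pX3 v1' v2) ((x3' == x3)%:R *
    \E_(y' ~ ch_dest x1' x2' x3') (y' == y)%:R))))).
    apply: eq_Ex => v1'; rewrite -!ExZl; apply: eq_Ex => x1'.
    rewrite -!ExZl; apply: eq_Ex => v2; rewrite -!ExZl; apply: eq_Ex => x2'.
    rewrite -!ExZl; apply: eq_Ex => x3'; rewrite -!ExZl; apply: eq_Ex => y'.
    by rewrite !xpair_eqE !natrb; ring.
  rewrite Ex_delta Ex_delta -!mulrA; congr (_ * (_ * _)).
  rewrite -!ExZr; apply: eq_Ex => v2.
  by rewrite Ex_delta Ex_delta Ex_indic; ring.
- move=> z; split=> [x|].
    apply: Ex_ge0 => [|v2]; first exact: pV2_pmf.1.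
    by rewrite mulr_ge0 //; [exact: (pX2_pmf v2).1|exact: (pX3_pmf z.1 v2).1].
  transitivity (\E_(v2 ~ pV2) \E_(x2 ~ pX2 v2) \E_(x3 ~ pX3 z.1 v2) (1 : R)).
    by rewrite -(bE z.1 (fun=> 1)); apply: eq_bigr => x _; rewrite mulr1.
  rewrite -[RHS](Ex_cst 1 pV2_pmf); apply: eq_Ex => v2.
  by rewrite -[RHS](Ex_cst 1 (pX2_pmf v2)); apply: eq_Ex => x2; rewrite Ex_cst.
by move=> z x; apply: ch_dest_pmf.
Qed.

Lemma info_dest12 : ln 2 * mutual_info P [% jX1, jX2, jX3]
    jY =
  avg ch_dest (fun v1 x1 v2 x2 x3 y =>
    ln (ch_dest x1 x2 x3 y / dden12 pV1 pX1 pV2 pX2 pX3 ch_dest y)).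
Proof.
pose b (x : X1 * X2 * X3) := \E_(v1 ~ pV1) \E_(v2 ~ pV2)
  (pX1 v1 x.1.1 * pX2 v2 x.1.2 * pX3 v1 v2 x.2).
have bE (f : X1 * X2 * X3 -> R) :
    Ex b f = \E_(v1 ~ pV1) \E_(x1 ~ pX1 v1) \E_(v2 ~ pV2) \E_(x2 ~ pX2 v2)
      \E_(x3 ~ pX3 v1 v2) f (x1, x2, x3).
  rewrite {1}/Ex /b; under eq_bigr => x _ do rewrite -ExZr.
  rewrite -Ex_sum; apply: eq_Ex => v1; rewrite Ex_swap.
  under eq_bigr => x _ do rewrite -ExZr.
  rewrite -Ex_sum; apply: eq_Ex => v2.
  apply: (etrans (Ex_pair (fun x : X1 * X2 => pX1 v1 x.1 * pX2 v2 x.2)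
                          (fun=> pX3 v1 v2) f)).
  exact: (Ex_pair (pX1 v1) (fun=> pX2 v2)
            (fun x => \E_(x3 ~ pX3 v1 v2) f (x, x3))).
rewrite (@mutual_infoE _ _ P _ _ _ _ b (fun x => ch_dest x.1.1 x.1.2 x.2)).
- rewrite -(Ex_joint_dest (fun v1 x1 v2 x2 x3 y =>
    ln (ch_dest x1 x2 x3 y / dden12 pV1 pX1 pV2 pX2 pX3 ch_dest y))).
  by apply: eq_Ex => o; congr (ln (_ / _)); exact: bE.
- move=> [[x1 x2] x3] y /=; rewrite pr_eqE.
  rewrite (Ex_joint_dest (fun v1' x1' v2' x2' x3' y' =>
    (((x1', x2', x3'), y') == ((x1, x2, x3), y))%:R)).
  transitivity (\E_(v1 ~ pV1)
    \E_(x1' ~ pX1 v1) ((x1' == x1)%:R * \E_(v2 ~ pV2)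
    \E_(x2' ~ pX2 v2) ((x2' == x2)%:R * \E_(x3' ~ pX3 v1 v2) ((x3' == x3)%:R *
    \E_(y' ~ ch_dest x1' x2' x3') (y' == y)%:R)))).
    apply: eq_Ex => v1; apply: eq_Ex => x1'.
    rewrite -!ExZl; apply: eq_Ex => v2; rewrite -!ExZl; apply: eq_Ex => x2'.
    rewrite -!ExZl; apply: eq_Ex => x3'; rewrite -!ExZl; apply: eq_Ex => y'.
    by rewrite !xpair_eqE !natrb; ring.
  rewrite /b -!ExZr; apply: eq_Ex => v1.
  rewrite Ex_delta -ExZr -ExZl; apply: eq_Ex => v2.
  by rewrite !Ex_delta Ex_indic; ring.
- split=> [x|].
    apply: Ex_ge0 => [|v1]; first exact: pV1_pmf.1.
    apply: Ex_ge0 => [|v2]; first exact: pV2_pmf.1.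
    by rewrite !mulr_ge0 //; [exact: (pX1_pmf v1).1|exact: (pX2_pmf v2).1|
      exact: (pX3_pmf v1 v2).1].
  transitivity (Ex b (fun=> 1)); first by apply: eq_bigr => x _; rewrite mulr1.
  rewrite bE -[RHS](Ex_cst 1 pV1_pmf); apply: eq_Ex => v1.
  rewrite -[RHS](Ex_cst 1 (pX1_pmf v1)); apply: eq_Ex => x1.
  rewrite -[RHS](Ex_cst 1 pV2_pmf); apply: eq_Ex => v2.
  by rewrite -[RHS](Ex_cst 1 (pX2_pmf v2)); apply: eq_Ex => x2; rewrite Ex_cst.
by move=> x; apply: ch_dest_pmf.
Qed.

Section Posteriors.
Variables (A : finType) (X : joint_space S1 S2 W3 W X1 X2 X3 Y Y3 V1 V2 -> A).

(** Taken under the full joint law so as to match the conditional entropies in the rate conditions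
    verbatim. *)
Definition post1 s1 s2 a := cond_pr P jS1
  [% jS2, X] s1 (s2, a).
Definition post2 s1 s2 a := cond_pr P jS2
  [% jS1, X] s2 (s1, a).
Definition post12 s1 s2 a := cond_pr P [% jS1, jS2] X (s1, s2) a.

Lemma post_cond_law3 : cond_law3 post1 post2 post12.
Proof.
have P0 := joint_law_ge0.
split; first by split=> *; apply: cond_pr_ge0.
- by move=> b c; apply: sum_cond_pr_le1.
- by move=> b c; apply: sum_cond_pr_le1.
move=> c; rewrite pair_bigA /=.
apply: le_trans (@sum_cond_pr_le1 _ _ P _ _
  [% jS1, jS2] X c).
by apply: ler_sum => -[].
Qed.

End Posteriors.

Lemma relay_tests_of_conditions :
  relay_conditions kappa P ->
  relay_tests pV1 pX1 pV2 pX2 pX3 ch_relay src kappa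
    (post1 jW3) (post2 jW3)
    (post12 jW3).
Proof.
case=> H1 H2 H12; split.
- exact: (test_cond_of_entropy _ H1 info_relay1).
- exact: (test_cond_of_entropy _ H2 info_relay2).
exact: (test_cond_of_entropy _ H12 info_relay12).
Qed.

Lemma dest_tests_of_conditions :
  dest_conditions kappa P ->
  dest_tests pV1 pX1 pV2 pX2 pX3 ch_dest src kappa
    (post1 jW) (post2 jW)
    (post12 jW).
Proof.
case=> H1 H2 H12; split.
- exact: (test_cond_of_entropy _ H1 info_dest1).
- exact: (test_cond_of_entropy _ H2 info_dest2).
exact: (test_cond_of_entropy _ H12 info_dest12).
Qed.

End SingleLetter.

(** * Causal channel use *)

Section Causality.
Variables (R : realType) (T : finType).

Lemma past_last n (F : {ffun 'I_n -> T}) (a : T) (k : 'I_n) :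
  let G := [ffun i : 'I_n.+1 => if unlift ord_max i is Some j then F j else a] in
  past G (widen_ord (leqnSn n) k) = past F k :> {ffun 'I_k -> T}.
Proof.
move=> G; apply/ffunP => j; rewrite /G !ffunE.
have -> : widen_ord (ltnW (ltn_ord (widen_ord (leqnSn n) k))) j =
    lift ord_max (widen_ord (ltnW (ltn_ord k)) j).
  apply: val_inj; rewrite /= /bump leqNgt.
  by rewrite (ltn_trans (ltn_ord j) (ltn_ord k)).
by rewrite liftK.
Qed.

(** Sum out the last letter first: by [past_last] no earlier factor sees it, and its own conditional
    law has mass one. *)
Lemma causal_law_sum n (f : forall k : 'I_n, {ffun 'I_k -> T} -> T -> R) :
  (forall k p, is_pmf (f k p)) ->
  \sum_(F : {ffun 'I_n -> T}) \prod_k f k (past F k) (F k) = 1.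
Proof.
elim: n f => [|n IH] f f_pmf.
  under eq_bigr => F _ do rewrite big_ord0.
  rewrite sumr_const -[#|_|]/#|{: {ffun 'I_0 -> T}}| card_ffun card_ord expn0.
  by [].
pose ext (u : {ffun 'I_n -> T} * T) : {ffun 'I_n.+1 -> T} :=
  [ffun i => if unlift ord_max i is Some j then u.1 j else u.2].
rewrite (reindex ext) /=; last first.
  exists (fun G => ([ffun j => G (lift ord_max j)], G ord_max)).
    case=> F a _; congr pair; last by rewrite ffunE unlift_none.
    by apply/ffunP => j; rewrite !ffunE liftK.
  move=> G _; apply/ffunP => i; rewrite ffunE.
  by case: unliftP => [j ->|->]; rewrite ?ffunE.
pose f' (k : 'I_n) : {ffun 'I_k -> T} -> T -> R := f (widen_ord (leqnSn n) k).
rewrite -[RHS](IH f') => [|k p]; last exact: f_pmf.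
rewrite -(pair_bigA _ (fun F a =>
  \prod_k f k (past (ext (F, a)) k) (ext (F, a) k))) /=.
apply: eq_bigr => F _.
pose p := [ffun j : 'I_n => F j] : {ffun 'I_(@ord_max n) -> T}.
transitivity (\prod_k f' k (past F k) (F k) * \sum_a f ord_max p a); last first.
  by rewrite (f_pmf ord_max p).2 mulr1.
rewrite big_distrr /=; apply: eq_bigr => a _.
rewrite big_ord_recr /=; congr (_ * _).
  apply: eq_bigr => k _; rewrite /f' past_last; congr (f _ _ _).
  rewrite ffunE; have -> : widen_ord (leqnSn n) k = lift ord_max k.
    by apply: val_inj; rewrite /= /bump leqNgt ltn_ord.
  by rewrite liftK.
rewrite ffunE unlift_none; congr (f _ _ _); apply/ffunP => j; rewrite !ffunE.
have -> : widen_ord (ltnW (ltn_ord (@ord_max n))) j = lift ord_max (j : 'I_n).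
  by apply: val_inj; rewrite /= /bump leqNgt ltn_ord.
by rewrite liftK.
Qed.

(** Passes from the output pair to the component that one decoder reads; the fibres of a
    coordinatewise map are themselves products. *)
Lemma Ex_prodp_map (K A : finType) (mu : K -> T -> R) (nu : K -> A -> R)
    (f : T -> A) (g : {ffun K -> A} -> R) :
  (forall k a, nu k a = \sum_(x | f x == a) mu k x) ->
  \E_(F ~ prodp mu) g [ffun k => f (F k)] = \E_(G ~ prodp nu) g G.
Proof.
move=> nuE; rewrite {1}/Ex (partition_big (fun F : {ffun K -> T} =>
  [ffun k => f (F k)]) xpredT) //=; apply: eq_bigr => G _.
rewrite (eq_bigr (fun F => prodp mu F * g G)) => [|F /eqP-> //].
rewrite -big_distrl /=; congr (_ * _).
rewrite /prodp; under [RHS]eq_bigr => k _ do rewrite nuE.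
rewrite bigA_distr_big_dep /=; apply: eq_bigl => F.
apply/eqP/familyP => [FG k|FG]; first by rewrite -FG ffunE unfold_in.
by apply/ffunP => k; rewrite ffunE; have := FG k; rewrite unfold_in => /eqP.
Qed.

End Causality.

(** * Block-Markov code and genie argument *)

Section BlockMarkov.
Variables (R : realType) (S1 S2 W3 W X1 X2 X3 Y Y3 : finType).
Variables (src : S1 * S2 * W3 * W -> R) (ch : X1 -> X2 -> X3 -> Y * Y3 -> R).
Hypothesis src_pmf : is_pmf src.
Hypothesis ch_pmf : forall x1 x2 x3, is_pmf (ch x1 x2 x3).
Variables (a1 : S1) (a2 : S2) (a3 : Y3) (m n B : nat).
Variables (beta : 'I_m -> nat) (gam : 'I_n -> 'I_B.+1).
Hypothesis beta_lt : forall i, (beta i < B)%N.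
Hypothesis gam_lt : forall j k : 'I_n, (gam j < gam k)%N -> (j < k)%N.

Definition prev_idx (b : nat) : finType := {i : 'I_m | (beta i).+1 == b}.
Definition cur_idx (b : nat) : finType := {i : 'I_m | beta i == b}.
Definition use_idx (b : 'I_B.+1) : finType := {k : 'I_n | gam k == b}.

Variable F : forall b : 'I_B.+1,
  block_code S1 S2 W3 W X1 X2 X3 Y Y3 (prev_idx b) (cur_idx b) (use_idx b).

Definition restr (N : nat) (T : Type) (A : pred 'I_N) (s : {ffun 'I_N -> T}) :
    {ffun {i | A i} -> T} := [ffun i => s (val i)].

Definition paste (N : nat) (T : Type) (A : pred 'I_N) (d : {ffun {i | A i} -> T})
    (s : {ffun 'I_N -> T}) : {ffun 'I_N -> T} :=
  [ffun i => if insub i is Some j then d j else s i].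

Local Notation prv b s := (restr (fun i => (beta i).+1 == b) s).
Local Notation cur b s := (restr (fun i => beta i == b) s).
Local Notation use b y := (restr (fun k => gam k == b) y).

Lemma paste_restr (N : nat) (T : Type) (A : pred 'I_N) (s e : {ffun 'I_N -> T}) i :
  paste (restr A s) e i = if A i then s i else e i.
Proof.
rewrite ffunE; case: insubP => [j -> <-|/negPf-> //].
by rewrite ffunE.
Qed.

Lemma eq_restr (N : nat) (T : Type) (A : pred 'I_N) (s e : {ffun 'I_N -> T}) :
  (forall i, A i -> e i = s i) -> restr A e = restr A s.
Proof. by move=> es; apply/ffunP => -[i Ai]; rewrite !ffunE es. Qed.

Definition glue (T : Type) (x : forall b, {ffun use_idx b -> T}) :
    {ffun 'I_n -> T} := [ffun k => x (gam k) (Sub k (eqxx (gam k)))].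

Lemma glueE (T : Type) (x : forall b, {ffun use_idx b -> T}) b (k : use_idx b) :
  glue x (val k) = x b k.
Proof.
case: k => k kb; rewrite ffunE /=; move: (kb); rewrite -(eqP kb) => kb'.
by congr (x _ _); apply: val_inj.
Qed.

Definition msg : Type := ({ffun 'I_m -> S1} * {ffun 'I_m -> S2})%type.
Definition msg0 : msg := ([ffun=> a1], [ffun=> a2]).

Definition sent1 (s1 : {ffun 'I_m -> S1}) :=
  glue (fun b => blk_x1 (F b) (prv b s1) (cur b s1)).
Definition sent2 (s2 : {ffun 'I_m -> S2}) :=
  glue (fun b => blk_x2 (F b) (prv b s2) (cur b s2)).
Definition sent3 (e : msg) :=
  glue (fun b => blk_x3 (F b) (prv b e.1) (prv b e.2)).

Definition relay_step (y : {ffun 'I_n -> Y3}) (w : {ffun 'I_m -> W3})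
    (b : 'I_B.+1) (e : msg) : msg :=
  let d := blk_rdec (F b) (prv b e.1) (prv b e.2) (use b y) (cur b w) in
  (paste d.1 e.1, paste d.2 e.2).

Fixpoint relay_est y w (t : nat) : msg :=
  if t is t'.+1 then relay_step y w (inord t') (relay_est y w t') else msg0.

Definition dest_step (y : {ffun 'I_n -> Y}) (w : {ffun 'I_m -> W})
    (b : 'I_B.+1) (e : msg) : msg :=
  let d := blk_ddec (F b) (cur b e.1) (cur b e.2) (use b y) (prv b w) in
  (paste d.1 e.1, paste d.2 e.2).

(** Block [B - t'] reveals the source letters of block [B - t' - 1]. The current letters it requires
    were found one step earlier, and block [B] has none. *)
Fixpoint dest_est y w (t : nat) : msg :=
  if t is t'.+1 then dest_step y w (inord (B - t')) (dest_est y w t') else msg0.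

(** Pads the outputs not yet received. The estimate used at time [k] reads only blocks before
    [gam k], all received by then, so the padding is never consulted. *)
Definition extend (k : 'I_n) (p : {ffun 'I_k -> Y3}) : {ffun 'I_n -> Y3} :=
  [ffun j : 'I_n => if insub (val j) is Some j' then p j' else a3].

(** [B] backward steps suffice, because channel block 0 carries no previous letters. *)
Definition bm_code : mabrc_code S1 S2 W3 W X1 X2 X3 Y Y3 m n := MabrcCode
  (MarcCode sent1 sent2
     (fun k p w => sent3 (relay_est (extend p) w (gam k)) k)
     (fun y w => dest_est y w B))
  (fun y w => relay_est y w B.+1).

(** The decoder is fed the true previous messages instead of the estimates, so the event involves a
    single block. *)
Definition relay_bad (b : 'I_B.+1) (o : run S1 S2 W3 W Y Y3 m n) : bool :=
  let: (s1, s2, w3, w, y, y3) := o in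
  blk_rdec (F b) (prv b s1) (prv b s2) (use b y3) (cur b w3)
    != (cur b s1, cur b s2).

Definition dest_bad (b : 'I_B.+1) (o : run S1 S2 W3 W Y Y3 m n) : bool :=
  let: (s1, s2, w3, w, y, y3) := o in
  blk_ddec (F b) (cur b s1) (cur b s2) (use b y) (prv b w)
    != (prv b s1, prv b s2).

Definition all_good o := [forall b, ~~ relay_bad b o && ~~ dest_bad b o].

(** Induction on blocks: a correct estimate so far hands the next decoder the true previous
    messages. Agreement of [y3'] is asked on finished blocks only, so that padded outputs qualify in
    the middle of the transmission. *)
Lemma relay_est_good s1 s2 w3 w y y3 (y3' : {ffun 'I_n -> Y3}) t :
  all_good (s1, s2, w3, w, y, y3) -> (t <= B.+1)%N ->
  (forall k, (gam k < t)%N -> y3' k = y3 k) ->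
  forall i, (beta i < t)%N -> (relay_est y3' w3 t).1 i = s1 i /\
                              (relay_est y3' w3 t).2 i = s2 i.
Proof.
move=> /forallP good; elim: t => // t IH tB y3E i it.
have {}IH := IH (ltnW tB) (fun k kt => y3E k (ltnW kt)).
have bt : @inord B t = t :> nat by rewrite inordK.
have /= := good (inord t) => /andP[/negPn/eqP dec _].
rewrite /relay_step.
have -> : prv (inord t : 'I_B.+1) (relay_est y3' w3 t).1 = prv (inord t : 'I_B.+1) s1.
  by apply: eq_restr => j; rewrite bt => /eqP jt; case: (IH j); rewrite // -jt.
have -> : prv (inord t : 'I_B.+1) (relay_est y3' w3 t).2 = prv (inord t : 'I_B.+1) s2.
  by apply: eq_restr => j; rewrite bt => /eqP jt; case: (IH j); rewrite // -jt.
have -> : use (inord t) y3' = use (inord t) y3.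
  by apply: eq_restr => k /eqP kt; apply: y3E; rewrite kt bt.
rewrite dec !paste_restr bt; case: eqP => // /eqP ne.
by apply: IH; rewrite ltn_neqAle ne -ltnS.
Qed.

(** The mirror induction, from the last block down; it starts vacuously because [beta i < B]. *)
Lemma dest_est_good s1 s2 w3 w y y3 t :
  all_good (s1, s2, w3, w, y, y3) -> (t <= B)%N ->
  forall i, (B - t <= beta i)%N -> (dest_est y w t).1 i = s1 i /\
                                   (dest_est y w t).2 i = s2 i.
Proof.
move=> /forallP good; elim: t => [_ i|t IH tB i it].
  by rewrite subn0 leqNgt beta_lt.
have {}IH := IH (ltnW tB).
have bt : @inord B (B - t) = (B - t)%N :> nat by rewrite inordK // ltnS leq_subr.
have /= := good (inord (B - t)) => /andP[_ /negPn/eqP dec].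
rewrite /dest_step.
have -> : cur (inord (B - t) : 'I_B.+1) (dest_est y w t).1 =
          cur (inord (B - t) : 'I_B.+1) s1.
  by apply: eq_restr => j; rewrite bt => /eqP jt; case: (IH j); rewrite // jt.
have -> : cur (inord (B - t) : 'I_B.+1) (dest_est y w t).2 =
          cur (inord (B - t) : 'I_B.+1) s2.
  by apply: eq_restr => j; rewrite bt => /eqP jt; case: (IH j); rewrite // jt.
rewrite dec !paste_restr bt; case: eqP => // /eqP ne.
by apply: IH; move: it ne; lia.
Qed.

(** The relay input is computed from the true sources, so given these the outputs have a product
    law. *)
Definition genie_law (o : run S1 S2 W3 W Y Y3 m n) : R :=
  let: (s1, s2, w3, w, y, y3) := o in
  (\prod_(i < m) src (s1 i, s2 i, w3 i, w i)) *
  (\prod_(k < n) ch (sent1 s1 k) (sent2 s2 k) (sent3 (s1, s2) k) (y k, y3 k)).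

(** By [gam_lt] every use of an earlier block lies in the relay's past, so its estimates rest on
    true outputs and are correct when all blocks are good. *)
Lemma run_law_good o : all_good o -> run_law src ch bm_code o = genie_law o.
Proof.
case: o => -[[[[s1 s2] w3] w] y] y3 good /=; congr (_ * _).
apply: eq_bigr => k _; congr (ch _ _ _ _); rewrite /sent3 !ffunE.
have est := @relay_est_good _ _ _ _ _ _ (extend (past y3 k)) _ good
  (ltnW (ltn_ord (gam k))).
have {}est : forall i, (beta i < gam k)%N ->
    (relay_est (extend (past y3 k)) w3 (gam k)).1 i = s1 i /\
    (relay_est (extend (past y3 k)) w3 (gam k)).2 i = s2 i.
  apply: est => j jk; rewrite ffunE; have jk' := gam_lt jk.
  case: insubP => [j' _ j'E|]; last by rewrite jk'.
  by rewrite ffunE; congr (y3 _); apply: val_inj.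
by congr (blk_x3 (F _) _ _ _); apply: eq_restr => i /eqP ib; case: (est i);
  rewrite // -ib.
Qed.

Lemma all_good_decodes o :
  all_good o -> ~~ [predU dest_error bm_code & relay_error bm_code] o.
Proof.
case: o => -[[[[s1 s2] w3] w] y] y3 good.
rewrite !inE /= negb_or !negbK; apply/andP; split; apply/eqP.
  have est := dest_est_good good (leqnn B); rewrite subnn in est.
  rewrite [LHS]surjective_pairing.
  by congr pair; apply/ffunP => i; case: (est i).
have est := @relay_est_good _ _ _ _ _ _ y3 _ good (leqnn _) (fun _ _ => erefl).
rewrite [LHS]surjective_pairing.
by congr pair; apply/ffunP => i; case: (est i) => //; apply: ltnW; apply: beta_lt.
Qed.

Lemma sum_run (f : run S1 S2 W3 W Y Y3 m n -> R) :
  \sum_o f o = \sum_(t : {ffun 'I_m -> S1 * S2 * W3 * W})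
    \sum_(u : {ffun 'I_n -> Y * Y3}) f (vec_s1 t, vec_s2 t, vec_w3 t, vec_w t,
      [ffun k => (u k).1], [ffun k => (u k).2]).
Proof.
rewrite pair_bigA /=.
rewrite (reindex (fun p : {ffun 'I_m -> S1 * S2 * W3 * W} * {ffun 'I_n -> Y * Y3} =>
  (vec_s1 p.1, vec_s2 p.1, vec_w3 p.1, vec_w p.1,
   [ffun k => (p.2 k).1], [ffun k => (p.2 k).2]))) //=.
exists (fun o : run S1 S2 W3 W Y Y3 m n => let: (s1, s2, w3, w, y, y3) := o in
  ([ffun i => (s1 i, s2 i, w3 i, w i)], [ffun k => (y k, y3 k)])).
  case=> t u _ /=; congr pair; apply/ffunP => i; rewrite !ffunE.
    by case: (t i) => -[[]].
  by case: (u i).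
case=> -[[[[s1 s2] w3] w] y] y3 _ /=.
by congr (_, _, _, _, _, _); apply/ffunP => i; rewrite !ffunE.
Qed.

Lemma vec_src (t : {ffun 'I_m -> S1 * S2 * W3 * W}) :
  \prod_(i < m) src (vec_s1 t i, vec_s2 t i, vec_w3 t i, vec_w t i) =
  prodp (fun=> src) t.
Proof. by apply: eq_bigr => i _; rewrite !ffunE; case: (t i) => -[[]]. Qed.

(** Outputs feed back into later inputs, so this is no product law; [causal_law_sum] is applied to
    the pairs of outputs. *)
Lemma sum_run_law : \sum_o run_law src ch bm_code o = 1.
Proof.
rewrite sum_run -(prodp_pmf (fun _ : 'I_m => src_pmf)).2.
apply: eq_bigr => t _; rewrite /= vec_src -big_distrr /=.
rewrite -[RHS]mulr1; congr (_ * _).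
pose f (k : 'I_n) (p : {ffun 'I_k -> Y * Y3}) :=
  ch (sent1 (vec_s1 t) k) (sent2 (vec_s2 t) k)
     (sent3 (relay_est (extend [ffun j => (p j).2]) (vec_w3 t) (gam k)) k).
rewrite -[RHS](causal_law_sum (f := f)) => [|k p]; last exact: ch_pmf.
apply: eq_bigr => u _; apply: eq_bigr => k _; rewrite /f.
have -> : past [ffun k => (u k).2] k = [ffun j => (past u k j).2].
  by apply/ffunP => j; rewrite !ffunE.
by congr (ch _ _ _ _); rewrite !ffunE; case: (u k).
Qed.

Lemma genie_lawE (h : run S1 S2 W3 W Y Y3 m n -> R) :
  \E_(o ~ genie_law) h o = \E_(t ~ prodp (fun=> src))
  \E_(u ~ prodp (fun k => ch (sent1 (vec_s1 t) k) (sent2 (vec_s2 t) k)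
                             (sent3 (vec_s1 t, vec_s2 t) k)))
    h (vec_s1 t, vec_s2 t, vec_w3 t, vec_w t,
       [ffun k => (u k).1], [ffun k => (u k).2]).
Proof.
rewrite /Ex sum_run; apply: eq_bigr => t _; rewrite big_distrr /=.
apply: eq_bigr => u _; rewrite vec_src mulrA; congr (_ * _ * _).
by apply: eq_bigr => k _; rewrite !ffunE; case: (u k).
Qed.

(** Adjacent blocks use disjoint, hence independent, source letters. That a source block recurs for
    the next [b] is harmless, as blocks are combined by a union bound only. *)
Lemma Ex_prev_cur b (g : {ffun prev_idx b -> S1 * S2 * W3 * W} ->
    {ffun cur_idx b -> S1 * S2 * W3 * W} -> R) :
  \E_(t ~ prodp (fun=> src)) g (prv b t) (cur b t) =
  \E_(q ~ prodp (fun=> src)) \E_(o ~ prodp (fun=> src)) g q o.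
Proof.
apply: (Ex_prodp_restrict2 (mu := fun _ : 'I_m => src) (h1 := val) (h2 := val))
  => //; try exact: val_inj.
case=> i ib [j jb] /=; apply: contraTneq ib => ->.
by rewrite (eqP jb) -[_ == _]/(b.+1 == b) gtn_eqF.
Qed.

Lemma restr_s1 (A : pred 'I_m) (t : {ffun 'I_m -> S1 * S2 * W3 * W}) :
  restr A (vec_s1 t) = vec_s1 (restr A t).
Proof. by apply/ffunP => i; rewrite !ffunE. Qed.

Lemma restr_s2 (A : pred 'I_m) (t : {ffun 'I_m -> S1 * S2 * W3 * W}) :
  restr A (vec_s2 t) = vec_s2 (restr A t).
Proof. by apply/ffunP => i; rewrite !ffunE. Qed.

Lemma restr_w3 (A : pred 'I_m) (t : {ffun 'I_m -> S1 * S2 * W3 * W}) :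
  restr A (vec_w3 t) = vec_w3 (restr A t).
Proof. by apply/ffunP => i; rewrite !ffunE. Qed.

Lemma restr_w (A : pred 'I_m) (t : {ffun 'I_m -> S1 * S2 * W3 * W}) :
  restr A (vec_w t) = vec_w (restr A t).
Proof. by apply/ffunP => i; rewrite !ffunE. Qed.

(** Under the genie the inputs are functions of the sources, so restricting to one block and one
    receiver leaves the memoryless law [block_in]. *)
Lemma Ex_block_output (T : finType) (f : Y * Y3 -> T) b
    (cht : X1 -> X2 -> X3 -> T -> R) (t : {ffun 'I_m -> S1 * S2 * W3 * W})
    (g : {ffun use_idx b -> T} -> R) :
  (forall x1 x2 x3 a, cht x1 x2 x3 a = \sum_(u | f u == a) ch x1 x2 x3 u) ->
  \E_(u ~ prodp (fun k => ch (sent1 (vec_s1 t) k) (sent2 (vec_s2 t) k)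
                             (sent3 (vec_s1 t, vec_s2 t) k)))
    g (use b [ffun k => f (u k)]) =
  \E_(y ~ block_in (F b) cht (prv b t) (cur b t)) g y.
Proof.
move=> chtE; pose mu k := ch (sent1 (vec_s1 t) k) (sent2 (vec_s2 t) k)
                             (sent3 (vec_s1 t, vec_s2 t) k).
transitivity (\E_(u ~ prodp mu) (fun H : {ffun use_idx b -> Y * Y3} =>
    g [ffun j => f (H j)]) [ffun j => u (val j)]).
  by apply: eq_Ex => u; congr g; apply/ffunP => j; rewrite !ffunE.
rewrite (@Ex_prodp_restrict _ _ _ _ mu val (fun H : {ffun use_idx b -> Y * Y3} =>
  g [ffun j => f (H j)])); [|by move=> k; apply: ch_pmf|exact: val_inj].
apply: Ex_prodp_map => k a; rewrite chtE; apply: eq_bigr => u _.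
by rewrite /mu !glueE !restr_s1 !restr_s2.
Qed.

Lemma genie_relay_bad b :
  \E_(o ~ genie_law) (relay_bad b o)%:R =
  block_rerr (ch_relay ch) src (F b).
Proof.
rewrite genie_lawE /block_rerr -Ex_prev_cur; apply: eq_Ex => t.
rewrite -!restr_s1 -!restr_s2 -restr_w3.
rewrite -(Ex_block_output (f := snd)) // => x1 x2 x3 y3; rewrite /ch_relay.
rewrite (reindex (fun y => (y, y3))) /=.
  by apply: eq_bigl => y; rewrite eqxx.
by exists fst => [y|[y y3']] //=; rewrite inE => /eqP /= ->.
Qed.

Lemma genie_dest_bad b :
  \E_(o ~ genie_law) (dest_bad b o)%:R =
  block_derr (ch_dest ch) src (F b).
Proof.
rewrite genie_lawE /block_derr -Ex_prev_cur; apply: eq_Ex => t.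
rewrite -!restr_s1 -!restr_s2 -restr_w.
rewrite -(Ex_block_output (f := fst)) // => x1 x2 x3 y; rewrite /ch_dest.
rewrite (reindex (fun y3 => (y, y3))) /=.
  by apply: eq_bigl => y3; rewrite eqxx.
by exists snd => [y3|[y' y3]] //=; rewrite inE => /eqP /= ->.
Qed.

Lemma sum_genie_law : \sum_o genie_law o = 1.
Proof.
transitivity (\E_(o ~ genie_law) (1 : R)).
  by apply: eq_bigr => o _; rewrite mulr1.
rewrite genie_lawE -[RHS](Ex_cst 1 (prodp_pmf (fun _ : 'I_m => src_pmf))).
by apply: eq_Ex => t; rewrite Ex_cst //; apply: prodp_pmf => k; apply: ch_pmf.
Qed.

Lemma genie_law_ge0 o : 0 <= genie_law o.
Proof.
case: o => -[[[[s1 s2] w3] w] y] y3 /=.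
by rewrite mulr_ge0 ?prodr_ge0 // => *; [exact: src_pmf.1|exact: (ch_pmf _ _ _).1].
Qed.

Lemma run_law_ge0 (c : marc_code S1 S2 W3 W X1 X2 X3 Y Y3 m n) o :
  0 <= run_law src ch c o.
Proof.
case: o => -[[[[s1 s2] w3] w] y] y3 /=.
by rewrite mulr_ge0 ?prodr_ge0 // => *; [exact: src_pmf.1|exact: (ch_pmf _ _ _).1].
Qed.

(* The relay of the code and the genie-aided relay send the same inputs as long
   as no block fails, and both laws have total mass one. *)
Theorem bm_code_error :
  mabrc_Pe src ch bm_code <=
  \sum_b (block_rerr (ch_relay ch) src (F b) + block_derr (ch_dest ch) src (F b)).
Proof.
apply: (@le_trans _ _ (\sum_(o | ~~ all_good o) run_law src ch bm_code o)).
  rewrite /mabrc_Pe /prob [leRHS](bigID [predU dest_error bm_code & relay_error bm_code]).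
  rewrite /= -[leLHS]addr0 lerD //; last by apply: sumr_ge0 => *; apply: run_law_ge0.
  apply: eq_ler; apply: eq_bigl => o.
  by apply/idP/andP => [err|[]] //; split=> //; apply: contraL err; apply: all_good_decodes.
have -> : \sum_(o | ~~ all_good o) run_law src ch bm_code o =
    \sum_(o | ~~ all_good o) genie_law o.
  have := sum_run_law; rewrite -sum_genie_law (bigID all_good) /=.
  rewrite [in RHS](bigID all_good) /= (eq_bigr genie_law) => [|o]; last exact: run_law_good.
  by move/addrI.
have -> : \sum_b (block_rerr (ch_relay ch) src (F b) +
                   block_derr (ch_dest ch) src (F b)) =
    \E_(o ~ genie_law) \sum_b ((relay_bad b o)%:R + (dest_bad b o)%:R).
  rewrite Ex_sum; apply: eq_bigr => b _.
  by rewrite ExD genie_relay_bad genie_dest_bad.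
rewrite big_mkcond; apply: ler_sum => o _; case: ifPn => [|_]; last first.
  by rewrite mulr_ge0 ?genie_law_ge0 // sumr_ge0 // => b _; rewrite addr_ge0.
rewrite /all_good negb_forall => /existsP[b bad]; rewrite ler_peMr ?genie_law_ge0 //.
rewrite (bigD1 b) //=.
have bad1 : 1 <= (relay_bad b o)%:R + (dest_bad b o)%:R :> R.
  by move: bad; case: (relay_bad b o); case: (dest_bad b o) => //= _;
    rewrite ?addr0 ?add0r ?lerDl.
apply: le_trans bad1 _; rewrite lerDl sumr_ge0 // => b' _; rewrite addr_ge0 //.
Qed.

End BlockMarkov.

(** * Block lengths *)

Section Sizes.

(** The minimum assigns the leftover uses to the last block; longer blocks only help, since sizes
    enter as lower bounds. *)
Definition channel_block (n l B : nat) (k : 'I_n) : 'I_B.+1 :=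
  inord (minn (k %/ l) B).

Lemma channel_blockE n l B (k : 'I_n) :
  channel_block l B k = minn (k %/ l) B :> nat.
Proof. by rewrite inordK // ltnS geq_minr. Qed.

Lemma channel_block_lt n l B (j k : 'I_n) :
  (channel_block l B j < channel_block l B k)%N -> (j < k)%N.
Proof.
rewrite !channel_blockE; apply: contraTT; rewrite -!leqNgt => kj.
by have := leq_div2r l kj; lia.
Qed.

Lemma card_channel_block n l B (b : 'I_B.+1) : (l * B.+1 <= n)%N ->
  (l <= #|{: {k : 'I_n | channel_block l B k == b}}|)%N.
Proof.
move=> ln; have bB : (b <= B)%N by rewrite -ltnS.
have lt_n (r : 'I_l) : (b * l + r < n)%N.
  apply: leq_trans ln; rewrite mulnS [(b * l)%N]mulnC addnC -addSn.
  by rewrite leq_add ?leq_mul // ltn_ord.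
have blk r : channel_block l B (Ordinal (lt_n r)) == b.
  have l_gt0 : (0 < l)%N by apply: leq_ltn_trans (ltn_ord r).
  by rewrite -val_eqE /= channel_blockE /= divnMDl // divn_small // addn0 (minn_idPl bB).
rewrite -[leqLHS]card_ord.
apply: (@leq_card _ _ (fun r : 'I_l =>
  exist _ (Ordinal (lt_n r)) (blk r) : {k : 'I_n | channel_block l B k == b})).
by move=> r r' /(congr1 (fun u => val (val u))) /= /addnI /val_inj.
Qed.

(** Within one residue class the quotient by [B] determines the index. *)
Lemma card_residue m B (A : pred 'I_m) :
  (forall i j, A i -> A j -> i = j %[mod B]) ->
  (#|{: {i : 'I_m | A i}}| <= (m %/ B).+1)%N.
Proof.
move=> AB; rewrite -[leqRHS]card_ord.
apply: (@leq_card _ _ (fun i : {i : 'I_m | A i} =>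
  inord (val i %/ B) : 'I_(m %/ B).+1)).
move=> [i Ai] [j Aj] /= /(congr1 val) /=.
have lt_m (k : 'I_m) : (k %/ B < (m %/ B).+1)%N.
  by rewrite ltnS leq_div2r // ltnW.
rewrite !inordK // => ij; apply: val_inj; apply: val_inj => /=.
by rewrite (divn_eq i B) (divn_eq j B) ij (AB i j).
Qed.

End Sizes.

(** * Choice of the block count and achievability *)

Section Achievability.
Variables (R : realType) (S1 S2 W3 W X1 X2 X3 Y Y3 : finType).
Variables (src : S1 * S2 * W3 * W -> R) (ch : X1 -> X2 -> X3 -> Y * Y3 -> R).
Hypothesis src_pmf : is_pmf src.
Hypothesis ch_pmf : forall x1 x2 x3, is_pmf (ch x1 x2 x3).

Lemma marc_of_mabrc_achievable kappa :
  mabrc_achievable src ch kappa -> marc_achievable src ch kappa.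
Proof.
move=> ach eps /ach[m0 Hm0]; exists m0 => m /Hm0[c c_eps]; exists c.
apply: le_lt_trans c_eps; rewrite /marc_Pe /mabrc_Pe /prob.
rewrite [leRHS](bigID (dest_error c)) /= -[leLHS]addr0 lerD //; last first.
  by apply: sumr_ge0 => *; apply: run_law_ge0.
apply: eq_ler; apply: eq_bigl => o.
rewrite -[o \in dest_error c]/(dest_error c o) andbC.
by case: (dest_error c o).
Qed.

Lemma achievable_of_block_codes (y3 : Y3) (kappa c : R) : 0 < kappa -> 0 < c ->
  (forall Ip Ic J : finType,
    #|Ip|%:R <= (kappa^-1 + c) * #|J|%:R -> #|Ic|%:R <= (kappa^-1 + c) * #|J|%:R ->
    exists bc : block_code S1 S2 W3 W X1 X2 X3 Y Y3 Ip Ic J,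
      block_rerr (ch_relay ch) src bc + block_derr (ch_dest ch) src bc
        <= 12 * expR (- (c * #|J|%:R))) ->
  mabrc_achievable src ch kappa.
Proof.
move=> kappa_gt0 c_gt0 codes eps eps_gt0.
have [[[[s1 s2] w3] w] _] := pmf_supp src_pmf.
have ck_gt0 : 0 < c * kappa by rewrite mulr_gt0.
(* B is chosen so that B (1 + c kappa) > B + 1: the excess rate c then pays for the additional
   channel block. It does not depend on m. *)
pose B := (Num.truncn (c * kappa)^-1).+1.
have B_gt : (c * kappa)^-1 < B%:R by apply: truncnS_gt.
have B_gt0 : 0 < B%:R :> R by rewrite ltr0n.
have Bck : 1 < B%:R * (c * kappa) by rewrite -ltr_pdivrMr // mul1r.
pose b : R := B%:R.
(* This is (1 + c kappa) / (b + 1) - 1 / b, the room gained per source letter. *)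
pose d := (b * (c * kappa) - 1) / (b * (b + 1)).
have d_gt0 : 0 < d by rewrite divr_gt0 ?mulr_gt0 ?subr_gt0 //; rewrite addr_gt0.
(* Beyond [t1] the room [m%:R * d] covers the roundings of both block sizes; beyond [t2] the error
   bound, summed over blocks, is below [eps]. *)
pose t1 := (1 + kappa^-1 + c) / d.
pose t2 := (12 * (b + 1) / (c * eps) + 1) * (b + 1) / kappa.
exists (Num.truncn t1 + Num.truncn t2)%N => m m_gt.
have t1m : t1 < m%:R.
  apply: lt_le_trans (truncnS_gt t1) _; rewrite ler_nat.
  by apply: leq_trans m_gt; rewrite ltnS leq_addr.
have t2m : t2 < m%:R.
  apply: lt_le_trans (truncnS_gt t2) _; rewrite ler_nat.
  by apply: leq_trans m_gt; rewrite ltnS leq_addl.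
set n := Num.truncn _; pose l := (n %/ B.+1)%N.
have ln : (l * B.+1 <= n)%N by apply: leq_trunc_div.
have l_ge : kappa * m%:R < (l%:R + 1) * (b + 1).
  have -> : (l%:R + 1) * (b + 1) = (l.+1 * B.+1)%:R :> R.
    by rewrite natrM -[l.+1%:R]natr1 -[B.+1%:R]natr1.
  by apply: lt_le_trans (truncnS_gt _) _; rewrite ler_nat -ltn_divLR.
(* Source letters are interleaved by residue: the encoders see the whole source sequence at once, so
   source blocks need not be contiguous, unlike channel blocks. *)
pose beta (i : 'I_m) := (i %% B)%N.
have beta_lt i : (beta i < B)%N by rewrite ltn_mod.
have lJ (k : 'I_B.+1) : l%:R <= #|use_idx (channel_block (n := n) l B) k|%:R :> R.
  by rewrite ler_nat card_channel_block.
have sz : m%:R / b + 1 <= (kappa^-1 + c) * l%:R.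
  move: t1m; rewrite ltr_pdivrMr // => t1m.
  have l_ge' : kappa * m%:R / (b + 1) - 1 <= l%:R.
    by rewrite lerBlDr ler_pdivrMr ?addr_gt0 // ltW.
  have kc : 0 < kappa^-1 + c by rewrite addr_gt0 // invr_gt0.
  apply: le_trans (ler_wpM2l (ltW kc) l_ge').
  have -> : (kappa^-1 + c) * (kappa * m%:R / (b + 1) - 1) =
      m%:R / b + m%:R * d - (kappa^-1 + c).
    rewrite /d; field.
    by rewrite !gt_eqF // addr_gt0.
  by lra.
have small (A : pred 'I_m) : (forall i j, A i -> A j -> i = j %[mod B]) ->
    forall k : 'I_B.+1, #|{: {i : 'I_m | A i}}|%:R <=
      (kappa^-1 + c) * #|use_idx (channel_block (n := n) l B) k|%:R.
  move=> AB k; apply: (@le_trans _ _ (m %/ B).+1%:R).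
    by rewrite ler_nat card_residue.
  apply: (@le_trans _ _ ((kappa^-1 + c) * l%:R)); last first.
    by rewrite ler_wpM2l // addr_ge0 ?invr_ge0 // ltW.
  apply: le_trans sz; rewrite -natr1 lerD2r ler_pdivlMr // -natrM ler_nat.
  exact: leq_trunc_div.
have /fin_all_exists [F HF] (k : 'I_B.+1) : exists bc : block_code S1 S2 W3 W X1
    X2 X3 Y Y3 (prev_idx beta k) (cur_idx beta k)
    (use_idx (channel_block (n := n) l B) k),
    block_rerr (ch_relay ch) src bc + block_derr (ch_dest ch) src bc
      <= 12 * expR (- (c * l%:R)).
  case: (codes (prev_idx beta k) (cur_idx beta k)
      (use_idx (channel_block (n := n) l B) k)) => [||bc Hbc].
  - by apply: small => i j /eqP; rewrite /beta; lia.
  - by apply: small => i j /eqP ik /eqP jk; move: ik jk; rewrite /beta => -> ->.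
  exists bc; apply: le_trans Hbc _.
  by rewrite ler_pM2l // ler_expR lerN2 ler_pM2l.
exists (bm_code s1 s2 y3 F).
apply: le_lt_trans (bm_code_error src_pmf ch_pmf s1 s2 y3 beta_lt
  (@channel_block_lt n l B) F) _.
apply: (@le_lt_trans _ _ (\sum_(k : 'I_B.+1) 12 * expR (- (c * l%:R)))).
  exact: ler_sum.
rewrite sumr_const card_ord -[_ *+ B.+1]mulr_natr expRN.
have l_gt : 12 * (b + 1) / (c * eps) < l%:R.
  move: t2m; rewrite /t2 ltr_pdivrMr // [m%:R * _]mulrC => t2m.
  have := lt_trans t2m l_ge; rewrite ltr_pM2r ?addr_gt0 //; lra.
have cl_gt0 : 0 < c * l%:R.
  rewrite mulr_gt0 //; apply: lt_trans l_gt.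
  by rewrite divr_gt0 ?mulr_gt0 ?addr_gt0.
(* The crude bound exp x > x is enough, because the number of blocks is fixed. *)
have : (expR (c * l%:R))^-1 < (c * l%:R)^-1.
  rewrite ltf_pV2 ?posrE ?expR_gt0 //.
  by apply: lt_le_trans (expR_ge1Dx _); rewrite ltrDr.
move=> E; apply: (@lt_trans _ _ (12 * (c * l%:R)^-1 * B.+1%:R)).
  by rewrite ltr_pM2r ?ltr0n // ltr_pM2l.
move: l_gt; rewrite ltr_pdivrMr ?mulr_gt0 // => l_gt.
rewrite mulrAC ltr_pdivrMr // -[B.+1%:R]natr1 -/b; lra.
Qed.

End Achievability.

Theorem theorem1 (R : realType) (S1 S2 W3 W X1 X2 X3 Y Y3 : finType)
    (src : S1 * S2 * W3 * W -> R) (ch : X1 -> X2 -> X3 -> Y * Y3 -> R)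
    (src_pmf : is_pmf src) (ch_pmf : forall x1 x2 x3, is_pmf (ch x1 x2 x3))
    (kappa : R) (kappa_gt0 : 0 < kappa) :
  (exists (V1 V2 : finType) (q : aux_space S1 S2 W3 W X1 X2 X3 V1 V2 -> R),
     [/\ is_pmf q, factorizes src q,
         relay_conditions kappa (joint_law ch q)
       & dest_conditions kappa (joint_law ch q)]) ->
  marc_achievable src ch kappa /\ mabrc_achievable src ch kappa.
Proof.
case=> V1 [V2 [q [_ [pV1 [pX1 [pV2 [pX2 [pX3 fact]]]]] relay_c dest_c]]].
case: fact => -[pV1_pmf pX1_pmf] [pV2_pmf pX2_pmf] pX3_pmf qE.
suff ach : mabrc_achievable src ch kappa.
  by split=> //; apply: marc_of_mabrc_achievable.
have [v1 _] := pmf_supp pV1_pmf; have [x1 _] := pmf_supp (pX1_pmf v1).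
have [v2 _] := pmf_supp pV2_pmf; have [x2 _] := pmf_supp (pX2_pmf v2).
have [x3 _] := pmf_supp (pX3_pmf v1 v2).
(* Supplies the padding letter for relay outputs not yet received. *)
have [[_ y3] _] := pmf_supp (ch_pmf x1 x2 x3).
have [c c_gt0 codes] := block_code_exists pV1_pmf pX1_pmf pV2_pmf pX2_pmf pX3_pmf
  (ch_dest_pmf ch_pmf) (ch_relay_pmf ch_pmf) src_pmf kappa_gt0
  (post_cond_law3 src_pmf ch_pmf pV1_pmf pX1_pmf pV2_pmf pX2_pmf pX3_pmf qE _)
  (post_cond_law3 src_pmf ch_pmf pV1_pmf pX1_pmf pV2_pmf pX2_pmf pX3_pmf qE _)
  (relay_tests_of_conditions src_pmf ch_pmf pV1_pmf pX1_pmf pV2_pmf pX2_pmf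
     pX3_pmf qE relay_c)
  (dest_tests_of_conditions src_pmf ch_pmf pV1_pmf pX1_pmf pV2_pmf pX2_pmf
     pX3_pmf qE dest_c).
exact: (achievable_of_block_codes src_pmf ch_pmf y3 kappa_gt0 c_gt0 codes).
Qed.
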